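(* Let $F_{R(S)}$ be a fully residually $F$ quotient of $F*\langle x,y\rangle$. If $F_{R(S)}$ is freely decomposable modulo $F$, then $F_{R(S)}$ is one of the following: \begin{enumerate} \item $F*\langle t\rangle$; \item $F*H$, where $H$ is fully residually free of rank 2; \item $\big(F*_{\langle\alpha\rangle}Ab(\alpha,r)\big)*\langle s\rangle$, with $\alpha\in F$. \end{enumerate}
   Context: $F$ is a fixed free group of rank $N$. An $F$-group is a group with a distinguished embedding of $F$; $F$-homomorphisms are homomorphisms compatible with these embeddings. An $F$-group $G$ is fully residually $F$ if for every finite $P\subset G$ there is an $F$-homomorphism $G\to F$ injective on $P$. A group is fully residually free if every finite subset is mapped injectively by some homomorphism to a free group. A fully residually $F$ quotient of $F*\langle x,y\rangle$ is a fully residually $F$ group that is the image of $F*\langle x,y\rangle$ under an $F$-epimorphism. $G$ is freely decomposable modulo $F$ if $G=A*B$ with $F\leq A$ and $B\ne1$. The rank of a group is the minimal cardinality of a generating set. $Ab(\alpha,r)$ denotes the free abelian group with basis $\{\alpha,r\}$; $\langle t\rangle,\langle s\rangle$ are infinite cyclic. *)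

(* Defs.v *)
From HB Require Import structures.
From mathcomp Require Import all_boot.

Set Implicit Arguments.
Unset Strict Implicit.
Unset Printing Implicit Defensive.

Local Open Scope group_scope.

(* Groups are the (possibly infinite) groupType's of mathcomp.boot.monoid.
   A multiplicative map between groups is a group homomorphism. *)

Definition surjective (S T : Type) (f : S -> T) : Prop :=
  forall y, exists x, f x = y.

Definition generates (G : groupType) (s : seq G) : Prop :=
  forall K : G -> Prop,
    K 1 -> (forall x y, K x -> K y -> K (x * y)) -> (forall x, K x -> K x^-1) ->
    (forall x, x \in s -> K x) -> forall g, K g.

Definition has_rank (G : groupType) (n : nat) : Prop :=
  (exists s : seq G, [/\ uniq s, size s = n & generates s]) /\
  (forall s : seq G, uniq s -> generates s -> (n <= size s)%N).

Definition is_abelian (G : groupType) : Prop := forall x y : G, x * y = y * x.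

(* C is infinite cyclic, generated by z, i.e. C = <z>. *)
Definition is_infinite_cyclic (C : groupType) (z : C) : Prop :=
  (forall g : C, exists n : nat, g = z ^+ n \/ g = z ^- n) /\
  (forall n : nat, z ^+ n.+1 <> 1).

Definition is_free_basis (I : Type) (L : groupType) (b : I -> L) : Prop :=
  forall (K : groupType) (f : I -> K),
    (exists h : {multiplicative L -> K}, forall i, h (b i) = f i) /\
    (forall h h' : {multiplicative L -> K},
       (forall i, h (b i) = f i) -> (forall i, h' (b i) = f i) -> h =1 h').

Definition is_free_abelian_basis (I : Type) (B : groupType) (b : I -> B) : Prop :=
  is_abelian B /\
  forall (K : groupType) (f : I -> K), is_abelian K ->
    (exists h : {multiplicative B -> K}, forall i, h (b i) = f i) /\
    (forall h h' : {multiplicative B -> K},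
       (forall i, h (b i) = f i) -> (forall i, h' (b i) = f i) -> h =1 h').

Definition is_free_of_rank (L : groupType) (n : nat) : Prop :=
  exists b : 'I_n -> L, is_free_basis b.

(* G = A * B, with canonical maps iA and iB. *)
Definition is_free_product (A B G : groupType)
    (iA : {multiplicative A -> G}) (iB : {multiplicative B -> G}) : Prop :=
  forall (K : groupType) (f : {multiplicative A -> K}) (g : {multiplicative B -> K}),
    (exists h : {multiplicative G -> K},
        (forall a, h (iA a) = f a) /\ (forall b, h (iB b) = g b)) /\
    (forall h h' : {multiplicative G -> K},
        (forall a, h (iA a) = f a) -> (forall b, h (iB b) = g b) ->
        (forall a, h' (iA a) = f a) -> (forall b, h' (iB b) = g b) -> h =1 h').

(* G = A *_C B, where C is embedded in A by cA and in B by cB. *)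
Definition is_amalgam (C A B G : groupType)
    (cA : {multiplicative C -> A}) (cB : {multiplicative C -> B})
    (iA : {multiplicative A -> G}) (iB : {multiplicative B -> G}) : Prop :=
  [/\ injective cA, injective cB,
      (forall c, iA (cA c) = iB (cB c)) &
      forall (K : groupType)
             (f : {multiplicative A -> K}) (g : {multiplicative B -> K}),
        (forall c, f (cA c) = g (cB c)) ->
        (exists h : {multiplicative G -> K},
            (forall a, h (iA a) = f a) /\ (forall b, h (iB b) = g b)) /\
        (forall h h' : {multiplicative G -> K},
            (forall a, h (iA a) = f a) -> (forall b, h (iB b) = g b) ->
            (forall a, h' (iA a) = f a) -> (forall b, h' (iB b) = g b) ->
            h =1 h')].

Definition fully_residually_free (H : groupType) : Prop :=
  forall s : seq H,
    exists (I : Type) (L : groupType) (b : I -> L) (h : {multiplicative H -> L}),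
      is_free_basis b /\ {in s &, injective h}.

(* Below, an F-group is a group G with an injective iota : F -> G. *)

Definition fully_residually (F G : groupType)
    (iota : {multiplicative F -> G}) : Prop :=
  forall s : seq G,
    exists h : {multiplicative G -> F},
      (forall a : F, h (iota a) = a) /\ {in s &, injective h}.

(* There is an F-epimorphism from F * <x, y> onto G, where <x, y> is the free
   group L with basis b 0 = x, b 1 = y, and F * <x, y> is P. *)
Definition quotient_of_two_generator_extension (F G : groupType)
    (iota : {multiplicative F -> G}) : Prop :=
  exists (L P : groupType) (b : 'I_2 -> L)
         (i : {multiplicative F -> P}) (j : {multiplicative L -> P})
         (p : {multiplicative P -> G}),
    [/\ is_free_basis b, is_free_product i j,
        (forall a : F, p (i a) = iota a) & surjective p].

Definition freely_decomposable_mod (F G : groupType)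
    (iota : {multiplicative F -> G}) : Prop :=
  exists (A B : groupType)
         (iA : {multiplicative A -> G}) (iB : {multiplicative B -> G}),
    [/\ is_free_product iA iB,
        (forall x : F, exists a : A, iA a = iota x) &
        (exists b : B, b <> 1)].

(* The next three predicates describe G up to F-isomorphism: the canonical map
   from F to the named group is required to be iota. *)

Definition is_F_free_Z (F G : groupType) (iota : {multiplicative F -> G}) : Prop :=
  exists (T : groupType) (t : T) (j : {multiplicative T -> G}),
    is_infinite_cyclic t /\ is_free_product iota j.

Definition is_F_free_limit2 (F G : groupType)
    (iota : {multiplicative F -> G}) : Prop :=
  exists (H : groupType) (j : {multiplicative H -> G}),
    [/\ fully_residually_free H, has_rank H 2 & is_free_product iota j].

(* (F *_<alpha> Ab(alpha, r)) * <s>.  The amalgamated subgroup is the infinite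
   cyclic group C = <z>, mapped to alpha in F and to the first basis element of
   the free abelian group B; M is the amalgam, with canonical maps u and v. *)
Definition is_F_centralizer_ext_free_Z (F G : groupType)
    (iota : {multiplicative F -> G}) : Prop :=
  exists (alpha : F) (C : groupType) (z : C) (B : groupType) (b : 'I_2 -> B)
         (cF : {multiplicative C -> F}) (cB : {multiplicative C -> B})
         (M : groupType)
         (u : {multiplicative F -> M}) (v : {multiplicative B -> M})
         (S : groupType) (s : S)
         (k : {multiplicative M -> G}) (l : {multiplicative S -> G}),
    [/\ is_infinite_cyclic z, cF z = alpha,
        is_free_abelian_basis b /\ cB z = b ord0
      & is_amalgam cF cB u v] /\
    [/\ is_infinite_cyclic s, is_free_product k l
      & forall a : F, k (u a) = iota a].

(* Main.v *)
Require Import Defs.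
From HB Require Import structures.
From mathcomp Require Import all_boot.
From mathcomp Require Import boolp classical_sets filter zify.

Set Implicit Arguments.
Unset Strict Implicit.
Unset Printing Implicit Defensive.

Local Open Scope group_scope.

(* A relative Grushko theorem (fold a graph labelled by the two factors until
   reduced paths spell normal forms) splits the two extra generators between the
   factors: A = <F, s_A> and B = <s_B> with |s_A| + |s_B| <= 2. So either B has
   rank 2 and A = F, or B is cyclic, hence infinite cyclic, and A = <F, t>.

   In the latter case discriminating F-retractions A -> F form a family with an
   ultrafilter along which every nontrivial element of A is eventually mapped to a
   nontrivial element. If t satisfies no relation over F then A = F * <t>.
   Otherwise the values of t in F solve a one-variable equation. Cancellation in
   the tree of F forces a value to be covered by overlaps of its translates, so its
   ends run along axes of fixed elements: up to bounded factors t = r1 r2^-1 or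
   t = p x p^-1. Ping-pong excludes these unless t = f r g with r in the
   centralizer <c> of some c in F. So either the values of t are bounded and A = F,
   or the same ping-pong applied to r gives A = F *_<c> (<c> x <r>). *)

(** Lengths are read in the Cayley tree of the free group. The ultrafilter replaces passing to
    subsequences: every alternative is decided along it, and a bounded family of elements is
    eventually constant because balls are finite. Each ping-pong shows that reduced words have
    unbounded values. Its obstacle is a coefficient in the centralizer of an axis: the unbounded
    factors on its two sides then merge instead of pushing apart. For ping-pong along axes the
    induction therefore carries a word in two letters that records what has been absorbed between
    two unbounded factors. Such words can be controlled because two noncommuting elements of F are
    free generators of the subgroup that they generate, which is why pairs of elements come first.
    Isomorphism types are reached through universal properties: once reduced words are known to be
    nontrivial, the pairs (generator, intended image) generate the graph of a homomorphism. *)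

Section Hom.
Variables (G K : groupType).

Definition mk_hom (f : G -> K) (fM : {morph f : x y / x * y}) :
  {multiplicative G -> K} := HB.pack f (isMultiplicative.Build G K f fM).

Variable f : {multiplicative G -> K}.

Lemma hom1 : f 1 = 1.
Proof. by apply: (mulIg (f 1)); rewrite -gmulfM !mul1g. Qed.

Lemma homV x : f x^-1 = (f x)^-1.
Proof. by apply/esym/mulg1_eq; rewrite -gmulfM mulgV hom1. Qed.

Lemma homX x n : f (x ^+ n) = f x ^+ n.
Proof. by elim: n => [|n IH]; rewrite ?hom1 // !expgS gmulfM IH. Qed.

Lemma hom_inj : (forall x, f x = 1 -> x = 1) -> injective f.
Proof. by move=> h x y e; apply/divg1_eq/h; rewrite gmulfM homV e mulgV. Qed.

End Hom.

Lemma hcompM (G H K : groupType) (f : {multiplicative H -> K})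
  (g : {multiplicative G -> H}) : {morph f \o g : x y / x * y}.
Proof. by move=> x y; rewrite /= !gmulfM. Qed.

Definition hcomp (G H K : groupType) (f : {multiplicative H -> K})
  (g : {multiplicative G -> H}) := mk_hom (hcompM f g).

Lemma hcompE (G H K : groupType) (f : {multiplicative H -> K})
  (g : {multiplicative G -> H}) x : hcomp f g x = f (g x).
Proof. by []. Qed.

Lemma hidM (G : groupType) : {morph (fun x : G => x) : x y / x * y}.
Proof. by []. Qed.

Definition hid (G : groupType) := mk_hom (@hidM G).

Lemma hidE (G : groupType) (x : G) : hid G x = x.
Proof. by []. Qed.

(** * Reduced words *)

Section FreeGroup.
Variable I : finType.
Notation letter := (I * bool)%type.

Definition linv (a : letter) : letter := (a.1, ~~ a.2).

Lemma linvK : involutive linv.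
Proof. by case=> i b; rewrite /linv /= negbK. Qed.

Lemma linv_neq a : a == linv a = false.
Proof. by case: a => i b; rewrite xpair_eqE; case: b; rewrite andbF. Qed.

Definition reduced : pred (seq letter) := sorted (fun a b => b != linv a).

(** Left multiplication by a letter permutes the reduced words, with inverse [push (linv a)].
    Products are compositions of such permutations, so confluence of rewriting never has to be
    proved. *)
Definition push (a : letter) (w : seq letter) :=
  if w is b :: w' then if b == linv a then w' else a :: w else [:: a].

Lemma push_reduced a w : reduced w -> reduced (push a w).
Proof.
case: w => [|b w] //= bw; case: ifP => [_|nb]; first exact: path_sorted bw.
by rewrite /= nb.
Qed.

Lemma pushK a w : reduced w -> push (linv a) (push a w) = w.
Proof.
case: w => [|b w] /=; first by rewrite linvK eqxx.
case: ifP => [/eqP-> | nb] /=; last by rewrite linvK eqxx.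
by case: w => [|c w] //= /andP[/negbTE->].
Qed.

Lemma pushVK a w : reduced w -> push a (push (linv a) w) = w.
Proof. by move=> rw; rewrite -{1}[a]linvK pushK. Qed.

Definition free_group := {w : seq letter | reduced w}.
HB.instance Definition _ := Choice.on free_group.

Lemma foldr_push_reduced u w : reduced w -> reduced (foldr push w u).
Proof. by move=> rw; elim: u => //= a u IH; apply: push_reduced. Qed.

Definition fg_mul (x y : free_group) : free_group :=
  exist reduced _ (foldr_push_reduced (val x) (valP y)).
Definition fg_one : free_group := exist reduced [::] isT.

Definition winv (w : seq letter) := rev (map linv w).

Lemma winv_reduced w : reduced w -> reduced (winv w).
Proof.
rewrite /winv /reduced rev_sorted sorted_map.
apply: sub_sorted => a b /=; rewrite linvK; by rewrite eq_sym.
Qed.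

Definition fg_inv (x : free_group) : free_group :=
  exist reduced _ (winv_reduced (valP x)).

(** Associativity for one letter: if [a] cancels the head of [v], then on the right [push a] undoes
    [push (linv a)]. *)
Lemma foldr_push a v z : reduced v -> reduced z ->
  foldr push z (push a v) = push a (foldr push z v).
Proof.
case: v => [|b v] //= rv rz; case: ifP => [/eqP -> | //] /=.
by rewrite pushVK // foldr_push_reduced.
Qed.

Lemma fg_mulA : associative fg_mul.
Proof.
move=> x y z; apply: val_inj => /=.
elim: (val x) => //= a u ->.
by rewrite foldr_push ?(foldr_push_reduced, valP).
Qed.

Lemma fg_mul1 : left_id fg_one fg_mul.
Proof. by move=> x; apply: val_inj. Qed.

Lemma foldr_push_nil w : reduced w -> foldr push [::] w = w.
Proof.
elim: w => //= a w IH rw; rewrite IH; last exact: path_sorted rw.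
by case: w rw {IH} => //= b w /andP[/negbTE->].
Qed.

Lemma fg_mulr1 : right_id fg_one fg_mul.
Proof. by move=> x; apply: val_inj; apply: foldr_push_nil; apply: valP. Qed.

Lemma fg_mulV : left_inverse fg_one fg_inv fg_mul.
Proof.
move=> x; apply: val_inj => /=; case: x => w /= rw.
elim: w rw => //= a w IH rw.
rewrite /winv /= rev_cons -cats1 foldr_cat /= linvK eqxx.
exact/IH/(path_sorted rw).
Qed.

Lemma fg_mulrV : right_inverse fg_one fg_inv fg_mul.
Proof.
move=> x; rewrite -(fg_mulV (fg_inv x)); congr fg_mul.
apply: val_inj; rewrite /= /winv map_rev revK -map_comp.
by rewrite (eq_map (g := id)) ?map_id // => a; rewrite /= linvK.
Qed.

HB.instance Definition _ :=
  isGroup.Build free_group fg_mulA fg_mul1 fg_mulr1 fg_mulV fg_mulrV.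

Lemma reduced1 (a : letter) : reduced [:: a]. Proof. by []. Qed.

Definition gen (a : letter) : free_group := exist reduced [:: a] (reduced1 a).

Lemma val_mul (x y : free_group) : val (x * y) = foldr push (val y) (val x).
Proof. by []. Qed.

Lemma genV a : (gen a)^-1 = gen (linv a).
Proof. exact: val_inj. Qed.

Lemma fg_ind (P : free_group -> Prop) :
  P 1 -> (forall a (x : free_group), push a (val x) = a :: val x -> P x -> P (gen a * x)) ->
  forall x, P x.
Proof.
move=> P1 PS [w rw]; elim: w rw => [|a w IH] raw.
  by rewrite (_ : exist reduced _ raw = (1 : free_group)) //; apply: val_inj.
have rw := path_sorted raw.
have e : push a w = a :: w.
  by case: w raw {IH rw} => //= b w /andP[/negbTE->].
suff <- : gen a * exist reduced w rw = exist reduced (a :: w) raw.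
  exact: (PS a (exist reduced w rw) e (IH rw)).
by apply: val_inj; rewrite /= e.
Qed.

Definition lift_letter (K : groupType) (f : I -> K) (a : letter) :=
  if a.2 then f a.1 else (f a.1)^-1.

Lemma lift_linv K f a : @lift_letter K f (linv a) = (lift_letter f a)^-1.
Proof. by case: a => i []; rewrite /lift_letter /= ?invgK. Qed.

Definition lift_fun (K : groupType) (f : I -> K) (x : free_group) : K :=
  foldr (fun a k => lift_letter f a * k) 1 (val x).

Lemma lift_funM K f : {morph @lift_fun K f : x y / x * y}.
Proof.
move=> [u ru] [v rv]; rewrite /lift_fun /=.
elim: u {ru} => [|a u IH] /=; first by rewrite mul1g.
rewrite -mulgA -IH; case: (foldr push v u) => //= b w.
by case: ifP => //= /eqP->; rewrite lift_linv mulVKg.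
Qed.

Definition lift (K : groupType) (f : I -> K) : {multiplicative free_group -> K} :=
  mk_hom (@lift_funM K f).

Lemma lift_gen K f a : @lift K f (gen a) = lift_letter f a.
Proof. exact: mulg1. Qed.

Lemma gen_free_basis : is_free_basis (fun i => gen (i, true)).
Proof.
move=> K f; split=> [|h h' hf h'f].
  by exists (lift f) => i; rewrite lift_gen.
apply: fg_ind => [|[i b] x _ IH]; first by rewrite !hom1.
rewrite !gmulfM IH; congr (_ * _).
have e : h (gen (i, true)) = h' (gen (i, true)) by rewrite [LHS]hf [RHS]h'f.
case: b => //; by rewrite -[gen (i, false)]invgK genV !homV e.
Qed.

Lemma foldr_push_cat u v : reduced (u ++ v) -> foldr push v u = u ++ v.
Proof.
elim: u => //= a u IH ruv; rewrite IH; last exact: path_sorted ruv.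
by case: (u ++ v) ruv => //= b w /andP[/negbTE->].
Qed.

Lemma reduced_cat_cons u a b v :
  reduced (rcons u a) -> reduced (b :: v) -> b != linv a ->
  reduced (rcons u a ++ b :: v).
Proof.
rewrite /reduced; case: u => [|c u] /=; first by move=> _ -> ->.
by rewrite cat_path last_rcons /= => -> -> ->.
Qed.

Definition fg_len (x : free_group) := size (val x).

Fixpoint wlcp (u v : seq letter) : nat :=
  match u, v with
  | a :: u', b :: v' => if a == b then (wlcp u' v').+1 else 0
  | _, _ => 0
  end.

Definition fg_lcp (x y : free_group) := wlcp (val x) (val y).

(** Exactly the common prefix cancels in [u^-1 v]: beyond it the next letters differ, so the
    junction is reduced. *)
Lemma wlcp_size u v : reduced u -> reduced v ->
  (size (foldr push v (winv u)) + 2 * wlcp u v = size u + size v)%N.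
Proof.
elim: u v => [|a u IH] [|b v] ru rv //=; first by rewrite addnC.
  rewrite foldr_push_nil ?(winv_reduced ru) // /winv size_rev size_map /=; lia.
have -> : winv (a :: u) = rcons (winv u) (linv a) by rewrite /winv /= rev_cons.
rewrite foldr_rcons /= linvK eq_sym; case: eqP => [_|/eqP nab].
  by have := IH v (path_sorted ru) (path_sorted rv); lia.
have e : winv (a :: u) = rcons (winv u) (linv a) by rewrite /winv /= rev_cons.
have R : reduced (winv u ++ linv a :: b :: v).
  rewrite -cat_rcons; apply: reduced_cat_cons; rewrite ?linvK ?(eq_sym b) //.
  by rewrite -e; apply: winv_reduced.
by rewrite foldr_push_cat // size_cat /winv size_rev size_map /=; lia.
Qed.

Implicit Types x y z : free_group.

Lemma fg_len_lcp x y : (fg_len (x^-1 * y)%g + 2 * fg_lcp x y = fg_len x + fg_len y)%N.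
Proof. by case: x y => [u ru] [v rv]; apply: wlcp_size. Qed.

Lemma fg_len1 : fg_len 1 = 0%N. Proof. by []. Qed.

Lemma fg_lenV x : fg_len x^-1 = fg_len x.
Proof. by rewrite /fg_len /= /winv size_rev size_map. Qed.

Lemma fg_len_eq0 x : fg_len x = 0%N -> x = 1.
Proof. by move/size0nil=> e; apply: val_inj. Qed.

Lemma fg_lcpC x y : fg_lcp x y = fg_lcp y x.
Proof.
rewrite /fg_lcp; elim: (val x) (val y) => [|a u IH] [|b v] //=.
by rewrite eq_sym IH.
Qed.

Lemma fg_lcp_min x y z : (minn (fg_lcp x y) (fg_lcp y z) <= fg_lcp x z)%N.
Proof.
rewrite /fg_lcp; elim: (val x) (val y) (val z) => [|a u IH] [|b v] [|c w] //=.
  by lia.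
case: (a =P b) => [ab|_]; case: (b =P c) => [bc|_]; rewrite ?ab ?bc ?eqxx; try lia.
by have := IH v w; lia.
Qed.

Lemma fg_lcp_lel x y : (fg_lcp x y <= fg_len x)%N.
Proof.
rewrite /fg_lcp /fg_len; elim: (val x) (val y) => [|a u IH] [|b v] //=.
by case: ifP => // _; apply: IH.
Qed.

Lemma fg_lcp_ler x y : (fg_lcp x y <= fg_len y)%N.
Proof. by rewrite fg_lcpC fg_lcp_lel. Qed.

Lemma fg_prefix_exists x n : (n <= fg_len x)%N ->
  exists z, fg_len z = n /\ fg_lcp z x = n.
Proof.
case: x => w rw; rewrite /fg_len /= => le.
have rt : reduced (take n w) by exact: take_sorted.
exists (exist reduced _ rt); rewrite /fg_lcp /fg_len /= size_takel //; split=> //.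
elim: w n le {rw rt} => [|a w IH] [|n] //= le; by rewrite eqxx IH.
Qed.

Lemma wlcp_nth d u v p : (p < wlcp u v)%N -> nth d u p = nth d v p.
Proof.
elim: u v p => [|a u IH] [|b v] p //=.
case: eqP => // ->; case: p => //= p; rewrite ltnS; exact: IH.
Qed.

(* The middle letter of x would be inverted by x -> x^-1. *)
Lemma fg_len_sqr x : x <> 1 -> (fg_len x < fg_len (x * x)%g)%N.
Proof.
move=> nx1; have := fg_len_lcp x^-1 x; rewrite invgK fg_lenV.
suff h : (2 * fg_lcp x^-1%g x < fg_len x)%N.
  move=> e.
  by have {}e : (fg_len (x * x)%g + 2 * fg_lcp x^-1%g x = fg_len x + fg_len x)%N := e; lia.
have nx : (0 < fg_len x)%N by case: (posnP (fg_len x)) => // /fg_len_eq0.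
have lx := fg_lcp_ler x^-1 x; move: nx lx; rewrite /fg_len /fg_lcp /=.
case: x {nx1} => w rw /=; case E : w (rw) => [//|d w'] rw' _; rewrite -E.
move=> lx; rewrite ltnNge; apply/negP => le.
pose n := size w; pose p := (n.-1)./2.
have hp : (p < wlcp (winv w) w)%N by rewrite /p /n; move: le lx; rewrite E /=; lia.
have hn : (p < n)%N by rewrite /n; lia.
have := wlcp_nth d hp; rewrite /winv nth_rev ?size_map //.
rewrite (nth_map d) ?subSn; try by rewrite /n in hn *; lia.
case: (boolP (odd n)) => on.
  have -> : (size w - p.+1 = p)%N by rewrite /p -/n; lia.
  by move/eqP; rewrite eq_sym linv_neq.
have -> : (size w - p.+1 = p.+1)%N by rewrite /p -/n; move: le lx hn; rewrite E /=; lia.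
move/(sortedP d): rw => /(_ p).
have -> : (p.+1 < size w)%N by rewrite /p -/n; move: le lx hn on; rewrite /n E /=; lia.
by move=> /(_ isT) h e; move: h; rewrite -e linvK eqxx.
Qed.

End FreeGroup.

(** The laws of a length function coming from a free action on a tree. [lcp] is the Gromov product
    seen from 1, [tl_min] the tree condition, [tl_prefix] provides group elements at all integer
    points of a segment, [tl_sqr] says that nontrivial elements are hyperbolic, and [tl_ball] is
    local finiteness. The theory of axes below sees F only through these laws. *)
Record tree_length (F : groupType) := TreeLength {
  len : F -> nat;
  lcp : F -> F -> nat;
  tl_len1 : len 1 = 0%N;
  tl_lenV : forall x, len x^-1 = len x;
  tl_eq0 : forall x, len x = 0%N -> x = 1;
  tl_lcpC : forall x y, lcp x y = lcp y x;
  tl_lcp : forall x y, (len (x^-1 * y)%g + 2 * lcp x y = len x + len y)%N;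
  tl_min : forall x y z, (minn (lcp x y) (lcp y z) <= lcp x z)%N;
  tl_lel : forall x y, (lcp x y <= len x)%N;
  tl_prefix : forall x n, (n <= len x)%N -> exists z, len z = n /\ lcp z x = n;
  tl_sqr : forall x, x <> 1 -> (len x < len (x * x)%g)%N;
  tl_ball : forall M, exists s : seq F, forall x, (len x <= M)%N -> x \in s
}.

Lemma fg_ball (I : finType) M :
  exists s : seq (free_group I), forall x, (fg_len x <= M)%N -> x \in s.
Proof.
elim: M => [|M [s IH]].
  by exists [:: 1] => x; rewrite leqn0 => /eqP/fg_len_eq0 ->; rewrite inE.
exists (1 :: [seq gen a * x | a <- enum {: I * bool}, x <- s]) => x.
elim/fg_ind: x => [|a x e _ le]; rewrite inE ?eqxx //; apply/orP; right.
apply/allpairsP; exists (a, x); split=> //=; first by rewrite mem_enum.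
by apply: IH; move: le; rewrite /fg_len /= e.
Qed.

Definition fg_tree (I : finType) : tree_length (free_group I) :=
  TreeLength (@fg_len1 I) (@fg_lenV I) (@fg_len_eq0 I) (@fg_lcpC I)
    (@fg_len_lcp I) (@fg_lcp_min I) (@fg_lcp_lel I) (@fg_prefix_exists I)
    (@fg_len_sqr I) (@fg_ball I).

Arguments len {F} t x%_g.
Arguments lcp {F} t (x y)%_g.

(** * Generated and cyclic subgroups *)

Inductive sg (G : groupType) (S : G -> Prop) : G -> Prop :=
| sg_in x of S x : sg S x
| sg1 : sg S 1
| sgM x y of sg S x & sg S y : sg S (x * y)
| sgV x of sg S x : sg S x^-1.

Definition cyc (G : groupType) (z : G) := sg (eq z).

Lemma expgV_mulC (G : groupType) (z : G) n m :
  z ^- n * z ^+ m = z ^+ m * z ^- n.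
Proof. by apply/esym/commuteV/commuteX2. Qed.

Lemma cycP (G : groupType) (z x : G) :
  cyc z x <-> exists n, x = z ^+ n \/ x = z ^- n.
Proof.
have D n m : z ^+ n * z ^- m = if (m <= n)%N then z ^+ (n - m) else z ^- (m - n).
  case: leqP => h; first by rewrite expgnFr.
  by rewrite -[RHS]/((_)^-1) expgnFr 1?ltnW // invgF.
split=> [|[n [->|->]]].
- elim=> {x} [x <-||x y _ [n xn] _ [m ym]|x _ [n xn]].
  + by exists 1%N; left.
  + by exists 0%N; left.
  + case: xn ym => -> [] ->.
    * by exists (n + m)%N; left; rewrite expgnDr.
    * by rewrite D; case: ifP => _; [exists (n - m)%N; left|exists (m - n)%N; right].
    * rewrite expgV_mulC D.
      by case: ifP => _; [exists (m - n)%N; left|exists (n - m)%N; right].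
    * by exists (m + n)%N; right; rewrite -invgM -expgnDr.
  + by exists n; case: xn => ->; rewrite ?invgK; [right|left].
- by elim: n => [|n IH]; [apply: sg1|rewrite expgS; apply: sgM => //; apply: sg_in].
- apply: sgV.
  by elim: n => [|n IH]; [apply: sg1|rewrite expgS; apply: sgM => //; apply: sg_in].
Qed.

Lemma cyc_commute (G : groupType) (z x y : G) : cyc z x -> cyc z y -> commute x y.
Proof.
case/cycP=> n [] -> /cycP[m [] ->]; try exact: commuteX2.
- exact/commuteV/commuteX2.
- exact/commute_sym/commuteV/commuteX2.
- exact/commuteV/commute_sym/commuteV/commuteX2.
Qed.

(* Puts all products and inverses under the same canonical instance, so that
   lia recognizes equal lengths as equal atoms. *)
Ltac same_instances F :=
  let m := constr:(@mul F) in let v := constr:(@inv F) in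
  let o := constr:(@monoid.one F) in let p := constr:(@natexp F) in
  repeat match goal with
  | H : context [@mul ?M] |- _ => lazymatch constr:(@mul M) with m => fail
      | _ => progress change (@mul M) with m in H end
  | |- context [@mul ?M] => lazymatch constr:(@mul M) with m => fail
      | _ => progress change (@mul M) with m end
  | H : context [@inv ?M] |- _ => lazymatch constr:(@inv M) with v => fail
      | _ => progress change (@inv M) with v in H end
  | |- context [@inv ?M] => lazymatch constr:(@inv M) with v => fail
      | _ => progress change (@inv M) with v end
  | H : context [@monoid.one ?M] |- _ => lazymatch constr:(@monoid.one M) with o => fail
      | _ => progress change (@monoid.one M) with o in H end
  | |- context [@monoid.one ?M] => lazymatch constr:(@monoid.one M) with o => fail
      | _ => progress change (@monoid.one M) with o end
  | H : context [@natexp ?M] |- _ => lazymatch constr:(@natexp M) with p => fail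
      | _ => progress change (@natexp M) with p in H end
  | |- context [@natexp ?M] => lazymatch constr:(@natexp M) with p => fail
      | _ => progress change (@natexp M) with p end
  end.
Ltac glia := intros; cbv beta in *;
  match goal with T : tree_length ?F |- _ => same_instances F end; lia.

(** * Cancellation in a tree *)

Section Tree.
Variables (F : groupType) (T : tree_length F).
Notation len := (len T).
Notation lcp := (lcp T).
Implicit Types x y z u v : F.

Lemma lenM x y : (len (x * y)%g + 2 * lcp x^-1%g y = len x + len y)%N.
Proof. by have := tl_lcp T x^-1 y; rewrite invgK tl_lenV; glia. Qed.

Lemma lcpxx x : lcp x x = len x.
Proof. by have := tl_lcp T x x; rewrite mulVg tl_len1; lia. Qed.

Lemma lcp_ler x y : (lcp x y <= len y)%N.
Proof. by rewrite tl_lcpC tl_lel. Qed.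

Lemma len_leM x y : (len (x * y)%g <= len x + len y)%N.
Proof. by have := lenM x y; lia. Qed.

Lemma len_leB x y : (len x <= len (x * y)%g + len y)%N.
Proof. by have := len_leM (x * y) y^-1; rewrite mulgK tl_lenV. Qed.

Lemma len_leBl x y : (len y <= len (x * y)%g + len x)%N.
Proof. by have := len_leM x^-1 (x * y); rewrite mulKg tl_lenV; glia. Qed.

(** Translating by [u] amounts to moving the base point of the Gromov product by [len u]. *)
Lemma lcp_mull u x y : (lcp x y <= lcp (u * x)%g (u * y)%g + len u)%N.
Proof.
have := tl_lcp T (u * x) (u * y); rewrite invgM -mulgA mulKg.
by have := tl_lcp T x y; have := len_leBl u x; have := len_leBl u y; glia.
Qed.

(** Of the three Gromov products of three vertices of a tree, the two smallest agree. *)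
Lemma lcp_tri x y z : (lcp x y < lcp y z)%N -> lcp x z = lcp x y.
Proof.
move=> h; have := tl_min T x y z; have := tl_min T x z y.
by rewrite (tl_lcpC T z y); lia.
Qed.

(** Less than half of [x] cancels in [x x], so a power of [x] begins with the surviving part of [x].
    That part is long enough to decide the next cancellation. *)
Lemma lcp_pow x n : x <> 1 ->
  lcp x^-1 (x ^+ n.+1) = lcp x^-1 x /\ (len x <= lcp x (x ^+ n.+1) + lcp x^-1%g x)%N.
Proof.
move=> nx1; have h2 := tl_sqr T nx1; have h3 := lenM x x.
elim: n => [|n [IH1 IH2]]; first by rewrite expg1 lcpxx; split=> //; lia.
have e : (len x <= lcp x (x ^+ n.+2) + lcp x^-1%g x)%N.
  have := lenM x (x ^+ n.+1); have := tl_lcp T x (x * x ^+ n.+1).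
  rewrite mulKg [x ^+ n.+2]expgS; glia.
split=> //; rewrite (@lcp_tri _ x) //; glia.
Qed.

Lemma len_pow_ltn x n : x <> 1 -> (len (x ^+ n.+1) < len (x ^+ n.+2))%N.
Proof.
move=> nx1; have [h1 _] := lcp_pow n nx1.
have h2 := tl_sqr T nx1; have h3 := lenM x x.
have := lenM x (x ^+ n.+1); rewrite [x ^+ n.+2]expgS; glia.
Qed.

Lemma len_pow x n : x <> 1 -> (len x + n <= len (x ^+ n.+1))%N.
Proof.
move=> nx1; elim: n => [|n IH]; first by rewrite expg1 addn0.
by have := len_pow_ltn n nx1; lia.
Qed.

Lemma torsion_free x n : x ^+ n.+1 = 1 -> x = 1.
Proof.
case: (x =P 1) => // nx e; have := len_pow n nx; rewrite e tl_len1.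
by case: (posnP (len x)) => [/(tl_eq0 (t := T))//|]; lia.
Qed.

(* Every letter of the list keeps at least K letters after cancellation with
   its two neighbours. *)
Fixpoint gap K o (g : F) (s : seq F) : Prop :=
  if s is h :: s' then
    (o + lcp g^-1%g h + K <= len g)%N /\ gap K (lcp g^-1%g h) h s'
  else (o + K <= len g)%N.

Definition gprod (s : seq F) := foldr (fun x y => x * y) 1 s.

(** The tail begins with more than [lcp g^-1 h] letters of [h], so by [lcp_tri] it cancels against
    [g] exactly as [h] alone does. *)
Lemma gap_lcp K o g s : (0 < K)%N -> gap K o g s ->
  (o + K <= lcp (gprod (g :: s)) g)%N.
Proof.
move=> K0; elim: s g o => [|h s IH] g o /=; first by rewrite mulg1 lcpxx.
case=> le /IH {IH} IH; set X := h * _.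
have e : lcp g^-1 X = lcp g^-1 h.
  have {}IH : (lcp g^-1%g h + K <= lcp X h)%N := IH.
  by apply: lcp_tri; rewrite (tl_lcpC T h X); glia.
have := lenM g X; have := tl_lcp T (g * X) g.
rewrite invgM mulgVK tl_lenV e; glia.
Qed.

Lemma gap_len K o g s : (0 < K)%N -> gap K o g s ->
  (o + K <= len (gprod (g :: s)))%N.
Proof.
move=> K0 h; apply: leq_trans (gap_lcp K0 h) _; exact: tl_lel.
Qed.

End Tree.

(** * Pairs of elements of a free group *)

Section Pairs.
Variables (F : groupType) (T : tree_length F).
Notation len := (len T).
Notation lcp := (lcp T).
Implicit Types x y z u v : F.

Notation F2 := (free_group bool).
Notation ga := (gen (true, true) : F2).
Notation gb := (gen (false, true) : F2).

Definition ev (K : groupType) (x y : K) : {multiplicative F2 -> K} :=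
  lift (fun b : bool => if b then x else y).

Lemma ev_a (K : groupType) (x y : K) : ev x y ga = x.
Proof. exact: lift_gen. Qed.

Lemma ev_b (K : groupType) (x y : K) : ev x y gb = y.
Proof. exact: lift_gen. Qed.

Lemma hom_ext (I : finType) (K : groupType) (h h' : {multiplicative free_group I -> K}) :
  (forall i, h (gen (i, true)) = h' (gen (i, true))) -> h =1 h'.
Proof.
move=> e; have [_ U] := gen_free_basis (fun i => h (gen (i, true))).
by apply: U => // i; rewrite e.
Qed.

Definition cyc_or_free x y :=
  (exists z, cyc z x /\ cyc z y) \/ injective (ev x y).

Lemma ev_in (z x y : F) w : cyc z x -> cyc z y -> cyc z (ev x y w).
Proof.
move=> zx zy; elim/fg_ind: w => [|[b s] w _ IH]; first by rewrite hom1; apply: sg1.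
rewrite gmulfM; apply: sgM => //.
have -> : ev x y (gen (b, s)) = lift_letter (fun b : bool => if b then x else y) (b, s).
  exact: lift_gen.
by case: b; case: s => //; apply: sgV.
Qed.

(** Invariance under a Nielsen transformation: [p], [q] express the new pair in the old one, and
    [p'], [q'] give the inverse substitution, which makes [ev p q] injective. *)
Lemma cyc_or_free_sub x y (p q p' q' : F2) :
  ev p' q' p = ga -> ev p' q' q = gb ->
  cyc_or_free x y -> cyc_or_free (ev x y p) (ev x y q).
Proof.
move=> ea eb [[z [zx zy]]|inj]; first by left; exists z; split; apply: ev_in.
right; have e : ev (ev x y p) (ev x y q) =1 hcomp (ev x y) (ev p q).
  by apply: hom_ext => -[]; rewrite hcompE ?ev_a ?ev_b.
have i : injective (ev p q).
  apply: (can_inj (g := ev p' q')) => w.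
  have : hcomp (ev p' q') (ev p q) =1 hid F2.
    by apply: hom_ext => -[]; rewrite hcompE hidE ?ev_a ?ev_b.
  by move/(_ w).
by move=> w w'; rewrite !e !hcompE => /inj/i.
Qed.

Lemma cyc_or_free_sym x y : cyc_or_free x y -> cyc_or_free y x.
Proof.
move/(@cyc_or_free_sub _ _ gb ga gb ga); rewrite ?ev_a ?ev_b; exact.
Qed.

Lemma cyc_or_freeV x y : cyc_or_free x^-1 y -> cyc_or_free x y.
Proof.
move/(@cyc_or_free_sub _ _ ga^-1 gb ga^-1 gb).
by rewrite ?homV ?ev_a ?ev_b !invgK; apply.
Qed.

Lemma cyc_or_freeM x y : cyc_or_free x (x * y) -> cyc_or_free x y.
Proof.
move/(@cyc_or_free_sub _ _ ga (ga^-1 * gb) ga (ga * gb)).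
by rewrite ?gmulfM ?homV ?ev_a ?ev_b !mulKg; apply.
Qed.

Lemma commute_cyc x y : cyc_or_free x y -> commute x y -> exists z, cyc z x /\ cyc z y.
Proof.
case=> // inj xy; have : ga * gb = gb * ga.
  by apply: inj; rewrite !gmulfM ev_a ev_b.
by move/(congr1 val).
Qed.

Definition lv x y (s : bool * bool) :=
  lift_letter (fun b : bool => if b then x else y) s.

(** No letter is consumed by its two neighbours, so [gap] holds with [K = 1] and a nonempty reduced
    word has positive length. *)
Lemma letters_free x y :
  (forall a b c : bool * bool, b != linv a -> c != linv b ->
     (lcp (lv x y a)^-1%g (lv x y b) + lcp (lv x y b)^-1%g (lv x y c)
       < len (lv x y b))%N) ->
  injective (ev x y).
Proof.
move=> H; apply: hom_inj => -[w rw] e; apply: val_inj => /=.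
have {}e : gprod (map (lv x y) w) = 1.
  by rewrite -e /gprod foldr_map.
case: w rw e => // b s rw e; exfalso.
have G (a c : bool * bool) t : c != linv a -> reduced (c :: t) ->
    gap T 1 (lcp (lv x y a)^-1 (lv x y c)) (lv x y c) (map (lv x y) t).
  elim: t a c => [|d t IH] a c ca /=.
    have := H a c c ca; rewrite linv_neq => /(_ isT); lia.
  case/andP=> dc rt; split; first by have := H a c d ca dc; lia.
  exact: IH.
(* The head serves as its own left neighbour, as the last letter served above as its own right
   neighbour. This is allowed because a letter is never its own inverse. *)
have := @gap_len _ T 1 _ _ _ isT (G b b s _ rw); rewrite linv_neq => /(_ isT).
rewrite (_ : gprod _ = 1) ?tl_len1; last exact: e.
by rewrite addn1.
Qed.

Definition half x y :=
  forall s t : bool, (2 * lcp (if s then x else x^-1)%g (if t then y else y^-1)%g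
     <= minn (len x) (len y))%N.

(** In [y x y] the middle letter loses exactly half on each side and disappears; together with
    [half], excluding this is Nielsen's condition. *)
Definition bad x y :=
  (2 * lcp x^-1%g y = len x)%N /\ (2 * lcp x y^-1%g = len x)%N.

Lemma lcp_inv x : x <> 1 -> (2 * lcp x^-1%g x < len x)%N.
Proof. by move=> nx; have := tl_sqr T nx; have := lenM T x x; glia. Qed.

Lemma half_sym x y : half x y -> half y x.
Proof. by move=> h s t; rewrite tl_lcpC minnC; apply: h. Qed.

(** With equal signs, [x] and [x^-1] would share half of [x] with the same element, hence with each
    other, against [lcp_inv]. *)
Lemma half_bad_eq x y s t : half x y -> x <> 1 ->
  (2 * lcp x^-1%g (if t then y else y^-1)%g = len x)%N ->
  (2 * lcp x (if s then y else y^-1)%g = len x)%N -> s = ~~ t.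
Proof.
move=> h nx e1 e2; case: (s =P ~~ t) => // st; have {}st : t = s by case: s t st {e1 e2} => [] [].
have := lcp_inv nx; rewrite st in e1.
have := tl_min T x^-1 (if s then y else y^-1) x.
rewrite (tl_lcpC T _ x) => m1 m2; exfalso; glia.
Qed.

Lemma halfV x y : half x y -> half x^-1 y.
Proof. by move=> h [] t; rewrite ?invgK tl_lenV; [apply: (h false)|apply: (h true)]. Qed.

Lemma half_triple z w s t : z <> 1 -> half z w ->
  ~ bad z w -> ~ bad z w^-1 ->
  (lcp (if s then w^-1 else w)%g z + lcp z^-1%g (if t then w else w^-1)%g < len z)%N.
Proof.
move=> nz h b1 b2.
have h1 := h true (~~ s); have h2 := h false t.
rewrite tl_lcpC; have es : (if s then w^-1 else w) = (if ~~ s then w else w^-1) by case: s {h1}.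
rewrite es.
case: (ltnP (lcp z (if ~~ s then w else w^-1) + lcp z^-1 (if t then w else w^-1)) (len z)) => // le.
have e1 : (2 * lcp z^-1%g (if t then w else w^-1)%g = len z)%N by glia.
have e2 : (2 * lcp z (if ~~ s then w else w^-1)%g = len z)%N by glia.
have est := half_bad_eq h nz e1 e2; rewrite est in e2.
case: t e1 e2 {h1 h2 le est} => e1 e2; exfalso; first exact: b1.
by apply: b2; split; rewrite ?invgK.
Qed.

(** A junction of equal letters loses less than half of the letter, a mixed junction at most half.
    So a letter can be lost only between two letters of the other kind, and then both losses are
    exactly half, which is [bad]. *)
Lemma half_free x y : x <> 1 -> y <> 1 -> half x y ->
  ~ bad x y -> ~ bad x y^-1 -> ~ bad y x -> ~ bad y x^-1 ->
  injective (ev x y).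
Proof.
move=> nx ny h b1 b2 b3 b4; apply: letters_free.
have badV z w : bad z^-1 w -> bad z w^-1.
  by rewrite /bad invgK tl_lenV => -[? ?]; split; rewrite ?invgK.
have sgV (b : bool) u : (if b then u else u^-1)^-1 = if b then u^-1 else u.
  by case: b; rewrite ?invgK.
have nV u : u <> 1 -> u^-1 <> 1 by move=> nu /(congr1 inv); rewrite invgK invg1.
have H z w s t r : z <> 1 -> half z w -> ~ bad z w -> ~ bad z w^-1 ->
  (lcp (if s then w^-1 else w)%g (if r then z else z^-1)%g
    + lcp (if r then z else z^-1)^-1%g (if t then w else w^-1)%g
   < len (if r then z else z^-1)%g)%N.
  move=> nz hz bz bz'; case: r; first exact: half_triple.
  apply: half_triple; [exact: nV | exact: halfV | by move/badV |].
  by move/badV; rewrite invgK.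
have S z (r : bool) : z <> 1 ->
    (2 * lcp (if r then z else z^-1)^-1%g (if r then z else z^-1)%g
      < len (if r then z else z^-1)%g)%N.
  by move=> nz; apply: lcp_inv; case: r => //; apply: nV.
have h' := half_sym h.
move=> [ia sa] [ib sb] [ic sc]; rewrite /lv /lift_letter /linv /= !xpair_eqE.
have L z w (s t r : bool) : half z w ->
    (2 * lcp (if r then z else z^-1)^-1%g (if t then w else w^-1)%g <= minn (len z) (len w))%N.
  by move=> hz; have := hz (~~ r) t; case: r; rewrite ?invgK.
have L' z w (s t r : bool) : half z w ->
    (2 * lcp (if t then w else w^-1)^-1%g (if r then z else z^-1)%g <= minn (len z) (len w))%N.
  by move=> hz; have := hz r (~~ t); rewrite tl_lcpC; case: t; rewrite ?invgK.
have lV z (r : bool) : len (if r then z else z^-1) = len z by case: r; rewrite ?tl_lenV.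
have nb (s t : bool) : ~~ (s == ~~ t) -> s = t by case: s t => [] [].
case: ia; case: ib; case: ic => /=; rewrite ?andTb => h1 h2.
- by rewrite -(nb _ _ h1) (nb _ _ h2); have := S x sb nx; rewrite (nb _ _ h1); lia.
- by rewrite -(nb _ _ h1); have := S x sb nx; have := L x y true sc sb h; rewrite lV; lia.
- by have := H y x sa sc sb ny h' b3 b4; rewrite !sgV.
- by rewrite (nb _ _ h2); have := S y sb ny; have := L' y x true sa sb h'; rewrite lV; lia.
- by rewrite (nb _ _ h2); have := S x sb nx; have := L' x y true sa sb h; rewrite lV; lia.
- by have := H x y sa sc sb nx h b1 b2; rewrite !sgV.
- by rewrite -(nb _ _ h1); have := S y sb ny; have := L y x true sc sb h'; rewrite lV; lia.
- by rewrite -(nb _ _ h1) (nb _ _ h2); have := S y sb ny; rewrite (nb _ _ h1); lia.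
Qed.

Section Induction.
Variable n : nat.
Hypothesis IH : forall x y, (len x + len y < n)%N -> cyc_or_free x y.

Lemma cyc_or_free_sgn (s t : bool) x y :
  cyc_or_free (if s then x else x^-1) (if t then y else y^-1) -> cyc_or_free x y.
Proof.
have W u v : cyc_or_free u v^-1 -> cyc_or_free u v.
  by move=> h; apply/cyc_or_free_sym/cyc_or_freeV/cyc_or_free_sym.
by case: s t => [] [] //; [move/W|move/cyc_or_freeV|move/cyc_or_freeV/W].
Qed.

(** After a choice of signs, multiplying the longer element by the inverse of the shorter one
    shortens it. *)
Lemma not_half_cof x y : (len x + len y <= n)%N -> ~ half x y -> cyc_or_free x y.
Proof.
have K x' y' : (len x' + len y' <= n)%N -> (len x' <= len y')%N ->
    (len x' < 2 * lcp x' y')%N -> cyc_or_free x' y'.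
  move=> le l1 l2; apply/cyc_or_freeV/cyc_or_freeM/IH.
  by have := tl_lcp T x' y'; rewrite tl_lenV; glia.
move=> le nh; have {nh} [s [t nst]] : exists s t : bool,
    ~~ (2 * lcp (if s then x else x^-1)%g (if t then y else y^-1)%g
     <= minn (len x) (len y))%N.
  have /existsP[s /existsP[t st]] : [exists s : bool, exists t : bool,
      ~~ (2 * lcp (if s then x else x^-1)%g (if t then y else y^-1)%g
     <= minn (len x) (len y))%N].
    rewrite -[[exists _, _]]negbK; apply/negP; rewrite negb_exists => /forallP h.
    apply: nh => s t; move/(_ s): h; rewrite negb_exists => /forallP/(_ t).
    by rewrite negbK.
  by exists s, t.
have lV z (r : bool) : len (if r then z else z^-1) = len z by case: r; rewrite ?tl_lenV.
apply: (@cyc_or_free_sgn s t); case: (leqP (len x) (len y)) => h.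
  by apply: K; rewrite ?lV //; lia.
by apply: cyc_or_free_sym; apply: K; rewrite ?lV // 1?tl_lcpC; lia.
Qed.

(** Replacing [y] by [x y] keeps the total length, so the induction hypothesis does not apply at
    once. But [x y] and its inverse both share at least half of [x] with [x]. Hence [x y] is longer
    than [x], and the new pair either violates [half], so that it can be shortened, or is not bad in
    any direction. *)
Lemma bad_cof x y : (len x + len y <= n)%N -> x <> 1 -> y <> 1 -> half x y ->
  bad x y -> cyc_or_free x y.
Proof.
move=> le nx ny h [e1 e2]; apply: cyc_or_freeM.
have hm := h true true; have := lenM T x y => lxy.
have {}lxy : len (x * y) = len y by glia.
have [exy|/eqP nxy] := eqVneq (x * y) 1.
  by left; exists x; rewrite exy; split; [apply: sg_in|apply: sg1].
have lx : (len x <= len y)%N by have := h false true; glia.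
have a1 : (2 * lcp x (x * y)%g = len x)%N.
  by have := tl_lcp T x (x * y); rewrite mulKg; glia.
have a2 : (len x <= 2 * lcp x (x * y)^-1%g)%N.
  have := tl_min T x y^-1 (x * y)^-1.
  have q : y^-1^-1 * (x * y)^-1 = x^-1 by rewrite !gnorm.
  by have := tl_lcp T y^-1 (x * y)^-1; rewrite q !tl_lenV; glia.
have a3 := tl_min T (x * y) x (x * y)^-1; have a4 := lcp_inv nxy.
have lt : (len x < len y)%N by move: a3 a4;
  rewrite (tl_lcpC T (x * y) x) (tl_lcpC T (x * y) (x * y)^-1); glia.
case: (boolP [forall s : bool, forall t : bool,
    (2 * lcp (if s then x else x^-1)%g (if t then x * y else (x * y)^-1)%g
     <= minn (len x) (len (x * y)%g))%N]) => [/forallP hh|nhh]; last first.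
  apply: not_half_cof; first by glia.
  by move=> hh; case/negP: nhh; apply/forallP => s; apply/forallP => t.
have {}hh : half x (x * y) by move=> s t; exact: (forallP (hh s) t).
right; apply: half_free => //.
- move=> [b1 b2]; have := tl_min T x^-1 (x * y) x; have := lcp_inv nx.
  by rewrite (tl_lcpC T (x * y) x); glia.
- move=> [b1 b2]; have := tl_min T x^-1 (x * y)^-1 x; have := lcp_inv nx.
  by rewrite (tl_lcpC T (x * y)^-1 x); glia.
- by move=> [b1 b2]; have := hh true false; rewrite tl_lcpC; glia.
- by move=> [b1 b2]; have := hh false false; rewrite tl_lcpC; glia.
Qed.

End Induction.

(** Nielsen reduction of a pair, by induction on the total length. *)
Theorem cyc_or_freeP x y : cyc_or_free x y.
Proof.
have [n le] := ubnP (len x + len y)%N; elim: n => // n IHn in x y le *.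
have IH x' y' : (len x' + len y' < n)%N -> cyc_or_free x' y' by exact: IHn.
rewrite ltnS in le.
have [->|/eqP nx] := eqVneq x 1; first by left; exists y; split; [apply: sg1|apply: sg_in].
have [->|/eqP ny] := eqVneq y 1; first by left; exists x; split; [apply: sg_in|apply: sg1].
have nV u : u <> 1 -> u^-1 <> 1 by move=> nu /(congr1 inv); rewrite invgK invg1.
case: (boolP [forall s : bool, forall t : bool,
    (2 * lcp (if s then x else x^-1)%g (if t then y else y^-1)%g
     <= minn (len x) (len y))%N]) => [/forallP hh|nhh]; last first.
  apply: (not_half_cof IH) => // hh.
  by case/negP: nhh; apply/forallP => s; apply/forallP => t.
have {}hh : half x y by move=> s t; exact: (forallP (hh s) t).
have hV := half_sym (halfV (half_sym hh)).
have dec (P Q : F) : {bad P Q} + {~ bad P Q}.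
  rewrite /bad; case: (eqVneq (2 * lcp P^-1 Q)%N (len P)) => [e1|/eqP e1]; last by right; case.
  by case: (eqVneq (2 * lcp P Q^-1)%N (len P)) => [e2|/eqP e2]; [left|right; case].
case: (dec x y) => [b|b1]; first exact: (bad_cof IH).
case: (dec x y^-1) => [b|b2].
  by apply: (@cyc_or_free_sgn true false); apply: (bad_cof IH); rewrite ?tl_lenV //; exact: nV.
case: (dec y x) => [b|b3].
  by apply/cyc_or_free_sym/(bad_cof IH) => //; [rewrite addnC|apply: half_sym].
case: (dec y x^-1) => [b|b4].
  apply: (@cyc_or_free_sgn false true); apply: cyc_or_free_sym.
  apply: (bad_cof IH); rewrite ?tl_lenV 1?addnC //; first exact: nV.
  exact/half_sym/halfV.
by right; apply: half_free.
Qed.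

Lemma commute_cyclic x y : commute x y -> exists z, cyc z x /\ cyc z y.
Proof. exact/commute_cyc/cyc_or_freeP. Qed.

Lemma noncommute_free x y : ~ commute x y -> injective (ev x y).
Proof.
move=> nxy; case: (cyc_or_freeP x y) => // -[z [zx zy]].
by case: nxy; apply: cyc_commute zx zy.
Qed.

End Pairs.

Lemma cyc_refl (G : groupType) (z : G) : cyc z z.
Proof. exact: sg_in. Qed.

Lemma cyc_trans (G : groupType) (z y x : G) : cyc z y -> cyc y x -> cyc z x.
Proof.
by move=> zy; elim=> {x} [x <-//||x1 x2 _ h1 _ h2|x _ h];
  [exact: sg1|exact: sgM|exact: sgV].
Qed.

Lemma cyc_hom (G K : groupType) (f : {multiplicative G -> K}) z x :
  cyc z x -> cyc (f z) (f x).
Proof.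
by elim=> {x} [x <-||x y _ h1 _ h2|x _ h];
  rewrite ?hom1 ?gmulfM ?homV; [exact: sg_in|exact: sg1|exact: sgM|exact: sgV].
Qed.

Lemma cyc_hom_ex (G K : groupType) (f : {multiplicative G -> K}) z x :
  cyc (f z) x -> exists2 a, cyc z a & f a = x.
Proof.
elim=> {x} [x <-||x y _ [a za <-] _ [b zb <-]|x _ [a za <-]].
- by exists z => //; exact: sg_in.
- by exists 1; [exact: sg1|exact: hom1].
- by exists (a * b); [exact: sgM|exact: gmulfM].
- by exists a^-1; [exact: sgV|exact: homV].
Qed.

(** * Roots and centralizers *)

Section Centralizers.
Variables (F : groupType) (T : tree_length F).
Notation len := (len T).
Implicit Types x y z u v : F.

Lemma cyc_len z x : cyc z x -> x <> 1 -> (len z <= len x)%N /\ ((len x <= len z)%N -> cyc x z).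
Proof.
move=> /cycP[n nx] x1.
have z1 : z <> 1 by move=> e; apply: x1; case: nx => ->; rewrite e expg1n ?invg1.
case: n nx => [|n] nx; first by case: x1; case: nx => ->; rewrite ?invg1.
have e : len x = len (z ^+ n.+1) by case: nx => ->; rewrite ?tl_lenV.
have H := len_pow T n z1; rewrite e; split; first by lia.
case: n nx {e} H => [|n] nx H.
  move=> _; case: nx => ->; first by rewrite expg1; exact: cyc_refl.
  by rewrite expg1 -[z in cyc _ z]invgK; apply: sgV; exact: sg_in.
by move: H => h1 h2; lia.
Qed.

Lemma common_root z y u : u <> 1 -> cyc z u -> cyc y u ->
  exists w, cyc w z /\ cyc w y.
Proof.
move=> u1 zu yu; case: (cyc_or_freeP T z y) => // inj.
have := zu; rewrite -{1}(ev_a z y) => /cyc_hom_ex[a ca ea].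
have := yu; rewrite -{1}(ev_b z y) => /cyc_hom_ex[b cb eb].
have eab : a = b by apply: inj; rewrite ea eb.
(* [ev z 1] kills the second generator: it does not change the value of [a], a power of the first
   generator, but it sends [b], which equals [a], to 1. *)
have := cyc_hom (ev z 1) cb; rewrite ev_b => /cycP[n nb].
case: u1; rewrite -ea.
have -> : ev z y a = ev z 1 a.
  by case/cycP: ca => m [] ->; rewrite ?homV !homX !ev_a.
by rewrite eab; case: nb => ->; rewrite expg1n ?invg1.
Qed.

(** If [c] does not generate the centralizer, a further commuting element gives by [common_root] a
    root of [c] that is not a power of [c]. It is strictly shorter by [cyc_len], so the descent
    stops. *)
Lemma centralizer u : u <> 1 ->
  exists2 c, c <> 1 & forall v, commute v u <-> cyc c v.
Proof.
move=> u1; have [n le] := ubnP (len u).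
have [c [lc cu]] : exists c, (len c < n)%N /\ cyc c u by exists u; split=> //; exact: cyc_refl.
elim: n c lc cu {le} => // n IH c; rewrite ltnS => lc cu.
have [h|/existsNP[v /not_implyP[vu ncv]]] := pselect (forall v, commute v u -> cyc c v).
  exists c => [c1|v]; last by split=> [|cv]; [exact: h|exact: cyc_commute cv cu].
  by case: u1; case/cycP: cu => m [] ->; rewrite c1 expg1n ?invg1.
have [z [zv zu]] := commute_cyclic T vu.
have [w [wc wz]] := common_root u1 cu zu.
have c1 : c <> 1 by move=> c1; case: u1; case/cycP: cu => m [] ->; rewrite c1 expg1n ?invg1.
have [l1 l2] := cyc_len wc c1.
case: (leqP (len c) (len w)) => l3.
  by case: ncv; apply: cyc_trans (l2 l3) (cyc_trans wz zv).
by apply: (IH w); [exact: leq_trans l3 lc|exact: cyc_trans wc cu].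
Qed.

Lemma commute_trans x y u : u <> 1 -> commute x u -> commute y u -> commute x y.
Proof.
by case/centralizer => c _ h /h cx /h cy; exact: cyc_commute cx cy.
Qed.

End Centralizers.

(** * First letters of words in two generators *)

Section Heads.
Notation F2 := (free_group bool).
Implicit Types (x y W : F2) (i : bool).

Definition starts (P : pred (bool * bool)) x := if val x is a :: _ then P a else false.

Notation starts_with i := (starts (fun a => a.1 == i)).

Lemma val_gen_mul a x : starts (fun b => b != linv a) x -> val (gen a * x) = a :: val x.
Proof. by case: x => [[|b w] rw] //= nb; rewrite (negbTE nb). Qed.

Lemma val_pow_mul a n x : starts (fun b => b.1 != a.1) x ->
  val (gen a ^+ n * x) = nseq n a ++ val x.
Proof.
move=> h; elim: n => [|n IH]; first by rewrite mul1g.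
rewrite expgS -mulgA val_gen_mul ?IH // /starts IH.
case: n {IH} => [|n] /=; last by rewrite linv_neq.
case: x h => [[|b w] rw] //= /negP h; apply/negP => /eqP e.
by case: h; rewrite e.
Qed.

Lemma val_gen_pow (a : bool * bool) n : val (gen a ^+ n) = nseq n a.
Proof.
by elim: n => // n IH; rewrite expgS val_mul IH /=; case: n {IH} => //= n; rewrite linv_neq.
Qed.

Lemma cyc_gen i x : cyc (gen (i, true)) x -> exists n (s : bool), x = gen (i, s) ^+ n.
Proof.
case/cycP=> n [] ->; exists n; first by exists true.
by exists false; rewrite -expVgn genV.
Qed.

Lemma val_cyc_mul i x W : cyc (gen (i, true)) x -> starts_with (~~ i) W ->
  val (x * W) = val x ++ val W.
Proof.
case/cyc_gen=> n [s ->] h; rewrite val_gen_pow val_pow_mul //.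
by move: h; rewrite /starts; case: (val W) => //= b w /eqP->; case: i.
Qed.

Lemma starts_cyc_mul i x W : cyc (gen (i, true)) x -> x <> 1 ->
  starts_with (~~ i) W -> starts_with i (x * W).
Proof.
move=> cx x1 h; rewrite /starts (val_cyc_mul cx h).
case/cyc_gen: cx x1 => n [s ->]; rewrite val_gen_pow.
by case: n => //= n _; rewrite eqxx.
Qed.

Lemma starts_invM P x W : val (x * W) = val x ++ val W ->
  starts P W^-1 -> starts P (x * W)^-1.
Proof.
have I (y : F2) : val y^-1 = winv (val y) by [].
by move=> e; rewrite /starts !I e /winv map_cat rev_cat; case: (rev (map _ (val W))).
Qed.

(** As [W] begins and ends with the other generator, nothing cancels on either side: one product
    begins with the other generator and one with generator [i]. *)
Lemma starts_not_commute i W : starts_with (~~ i) W -> starts_with (~~ i) W^-1 ->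
  ~ commute W (gen (i, true)).
Proof.
move=> h1 h2 /(congr1 val) e.
have c1 := cyc_refl (gen (i, true)).
have : starts_with i (gen (i, true) * W) by exact: starts_cyc_mul.
have : starts_with (~~ i) (W * gen (i, true)).
  rewrite -[W * _]invgK invgM; apply: starts_invM; last by rewrite invgK.
  by apply: val_cyc_mul h2; exact: sgV.
rewrite /starts e; case: (val _) => //= a _ /eqP ->; by case: i {h1 h2 e c1}.
Qed.

Lemma starts_conj i x W : cyc (gen (i, true)) x -> x <> 1 ->
  starts_with (~~ i) W -> starts_with (~~ i) W^-1 ->
  starts_with i (x * W * x^-1) /\ starts_with i (x * W * x^-1)^-1.
Proof.
move=> cx x1; suff K W' : starts_with (~~ i) W' -> starts_with (~~ i) W'^-1 ->
    starts_with i (x * W' * x^-1).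
  move=> h1 h2; split; first exact: K.
  have -> : (x * W * x^-1)^-1 = x * W^-1 * x^-1 by rewrite !gnorm.
  by apply: K; rewrite ?invgK.
move=> h1 h2; rewrite -mulgA; apply: starts_cyc_mul => //.
have -> : W' * x^-1 = (x * W'^-1)^-1 by rewrite !gnorm.
by apply: starts_invM; rewrite ?invgK //; exact: (val_cyc_mul cx h2).
Qed.

End Heads.

(** * Sequences along an ultrafilter *)

Section Ultra.
Variables (X : Type) (U : set_system X) (HU : UltraFilter U).
Implicit Types P Q R : X -> Prop.

Lemma ultra_mono P Q : (forall h, P h -> Q h) -> U P -> U Q.
Proof. exact: filterS. Qed.

Lemma ultra_and P Q : U P -> U Q -> U (fun h => P h /\ Q h).
Proof. exact: filterI. Qed.

Lemma ultra_em P : U P \/ U (fun h => ~ P h).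
Proof. exact: in_ultra_setVsetC. Qed.

Lemma ultra_false : ~ U (fun=> False).
Proof. exact: filter_not_empty. Qed.

Lemma ultra_all P : (forall h, P h) -> U P.
Proof.
move=> h; case: (ultra_em P) => // np; exfalso; apply: ultra_false.
by apply: ultra_mono np => k; apply; exact: h.
Qed.

Lemma ultra_ex P : U P -> exists h, P h.
Proof.
move=> up; apply: contrapT => /forallNP h; apply: ultra_false.
by apply: ultra_mono up => k /h.
Qed.

Lemma ultra_not P : ~ U P -> U (fun h => ~ P h).
Proof. by case: (ultra_em P). Qed.

Lemma ultra2 P Q R : (forall h, P h -> Q h -> R h) -> U P -> U Q -> U R.
Proof. by move=> h p q; apply: ultra_mono (ultra_and p q) => k []; exact: h. Qed.

Lemma ultra3 P1 P2 P3 R : (forall h, P1 h -> P2 h -> P3 h -> R h) ->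
  U P1 -> U P2 -> U P3 -> U R.
Proof. by move=> h p q; apply: ultra2 (ultra_and p q) => k []; exact: h. Qed.

Lemma ultra4 P1 P2 P3 P4 R : (forall h, P1 h -> P2 h -> P3 h -> P4 h -> R h) ->
  U P1 -> U P2 -> U P3 -> U P4 -> U R.
Proof. by move=> h p q; apply: ultra3 (ultra_and p q) => k []; exact: h. Qed.

Lemma ultra_mem (S : eqType) (s : seq S) (x : X -> S) :
  U (fun h => x h \in s) -> exists f, U (fun h => x h = f).
Proof.
elim: s => [|a s IH] h.
  by exfalso; apply: ultra_false; apply: ultra_mono h.
case: (ultra_em (fun h => x h = a)) => [e|ne]; first by exists a.
by apply: IH; apply: ultra2 h ne => k; rewrite inE => /orP[/eqP|].
Qed.

Definition ninf (n : X -> nat) := forall M, U (fun h => (M < n h)%N).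

Lemma not_ninf n : ~ ninf n -> exists M, U (fun h => (n h <= M)%N).
Proof.
move=> /existsNP[M /ultra_not h]; exists M.
by apply: ultra_mono h => k /negP; rewrite -leqNgt.
Qed.

Lemma ninf_le n m M : ninf n -> U (fun h => (n h <= m h + M)%N) -> ninf m.
Proof. by move=> hn hm K; apply: ultra2 (hn (M + K)%N) hm => h; lia. Qed.

End Ultra.

(** * Unbounded sequences along axes *)

Section Sequences.
Variables (X : Type) (U : set_system X) (HU : UltraFilter U).
Variables (F : groupType) (T : tree_length F).
Notation len := (len T).
Notation lcp := (lcp T).
Implicit Types (x y z r : X -> F) (f g u v w c d : F).

Definition inf x := ninf U (fun h => len (x h)).

Lemma not_inf x : ~ inf x -> exists f, U (fun h => x h = f).
Proof.
move/(not_ninf HU) => [M h]; have [s hs] := tl_ball T M.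
by apply: (ultra_mem HU (s := s)); apply: (ultra_mono HU) h => k; exact: hs.
Qed.

Lemma inf_not_const x f : inf x -> ~ U (fun h => x h = f).
Proof.
move=> h e; apply: (ultra_false HU).
by apply: (ultra2 HU) (h (len f)) e => k + ex; rewrite ex ltnn.
Qed.

Lemma inf_mulr x u : inf x -> inf (fun h => x h * u).
Proof.
by move=> h; apply: (ninf_le HU h (M := len u)); apply: (ultra_all HU) => k; exact: len_leB.
Qed.

Lemma inf_mull x u : inf x -> inf (fun h => u * x h).
Proof.
by move=> h; apply: (ninf_le HU h (M := len u)); apply: (ultra_all HU) => k; exact: len_leBl.
Qed.

Lemma inf_inv x : inf x -> inf (fun h => (x h)^-1).
Proof. by move=> h M; apply: (ultra_mono HU) (h M) => k; rewrite tl_lenV. Qed.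

Lemma bounded_const x M : U (fun h => (len (x h) <= M)%N) -> exists f, U (fun h => x h = f).
Proof.
move=> h; apply: not_inf => /(_ M) h'; apply: (ultra_false HU).
by apply: (ultra2 HU) h h' => k; lia.
Qed.

Lemma lcp_prod (g x : F) : (lcp (g * x)%g g + lcp g^-1%g x = len g)%N.
Proof.
have := tl_lcp T (g * x) g; have := lenM T g x.
have -> : (g * x)^-1 * g = x^-1 by rewrite !gnorm.
by rewrite tl_lenV; glia.
Qed.

(** [z] lies on the segment to [x], and [u x] follows [x] along [z] up to [K]. So [u] moves [z] by a
    bounded amount: [z] stays near the axis of [u]. *)
Lemma conj_bound (z x u : F) K : lcp z x = len z -> (len z <= lcp x (u * x)%g + K)%N ->
  (len (z^-1 * (u * z))%g <= 3 * len u + 2 * K)%N.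
Proof.
move=> e le; have := tl_lcp T z (u * z).
have := lcp_mull T u z x; have := tl_min T z x (u * x); have := tl_min T z (u * x) (u * z).
rewrite (tl_lcpC T (u * x) (u * z)); have := len_leM T u z; glia.
Qed.

(** The conjugate [z^-1 u z] is eventually constant, so the quotient of any two of these values of
    [z] commutes with [u]; [f] is the inverse of one fixed value. *)
Lemma axis u z M : U (fun h => (len ((z h)^-1 * (u * z h))%g <= M)%N) ->
  exists f, U (fun h => commute (z h * f) u).
Proof.
case/bounded_const => g hg; have [h0 e0] := ultra_ex HU hg.
exists (z h0)^-1; apply: (ultra_mono HU) hg => h; rewrite -e0 => e.
have {}e : u * z h = z h * ((z h0)^-1 * (u * z h0)) by rewrite -e mulVKg.
by rewrite /commute (mulgA u) e !gnorm.
Qed.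

Lemma commute_conj (g a b : F) : commute (g * a * g^-1) (g * b * g^-1) <-> commute a b.
Proof.
rewrite /commute; split=> [e|e].
  by apply: (mulgI g); apply: (mulIg g^-1); move: e; rewrite !gnorm.
by rewrite !gnorm -[g * a * b]mulgA e !gnorm.
Qed.

Lemma prefix_seq x (n : X -> nat) : (forall h, (n h <= len (x h))%N) ->
  exists z, forall h, len (z h) = n h /\ lcp (z h) (x h) = len (z h).
Proof.
move=> le; have [z hz] := choice (fun h => tl_prefix (le h)).
by exists z => h; case: (hz h) => e1 e2; split=> //; rewrite e1.
Qed.

(** The common prefixes [z] run along both axes. The quotient of two different values of [z]
    commutes with both elements, and commuting with a common nontrivial element forces
    commutation. *)
Lemma axes_overlap c1 c2 g r1 r2 : c1 <> 1 -> c2 <> 1 ->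
  U (fun h => commute (r1 h) c1) -> U (fun h => commute (r2 h) c2) ->
  ninf U (fun h => lcp (r1 h) (g * r2 h)) -> commute c1 (g * c2 * g^-1).
Proof.
move=> n1 n2 h1 h2 hi.
have [z hz] := prefix_seq (fun h => tl_lel T (r1 h) (g * r2 h)).
have [f1 hf1] : exists f, U (fun h => commute (z h * f) c1).
  apply: (@axis c1 z (3 * len c1 + 2 * len c1)); apply: (ultra_mono HU) h1 => h ch.
  have [e1 e2] := hz h; apply: (@conj_bound _ (r1 h)) => //.
  have := tl_lcp T (r1 h) (c1 * r1 h); rewrite -ch mulKg.
  have := tl_lel T (z h) (r1 h); have := lcp_ler T (z h) (r1 h).
  have := len_leM T (r1 h) c1; have := len_leB T (r1 h) c1; glia.
pose c' := g * c2 * g^-1.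
have [f2 hf2] : exists f, U (fun h => commute (z h * f) c').
  apply: (@axis c' z (3 * len c' + 2 * (len c2 + len c'))); apply: (ultra_mono HU) h2 => h ch.
  have [e1 e2] := hz h; apply: (@conj_bound _ (g * r2 h)).
    have := tl_min T (z h) (r1 h) (g * r2 h); rewrite e2 -e1.
    by have := tl_lel T (z h) (g * r2 h); lia.
  have := tl_lcp T (g * r2 h) (c' * (g * r2 h)).
  have -> : (g * r2 h)^-1 * (c' * (g * r2 h)) = c2.
    rewrite /c' !gnorm -[_ * c2 * _]mulgA -ch !gnorm //.
  rewrite e1; have := lcp_ler T (r1 h) (g * r2 h).
  by have := len_leBl T c' (g * r2 h); glia.
have zi : inf z by move=> M; apply: (ultra_mono HU) (hi M) => h; have [-> _] := hz h.
have [h0 [hf10 hf20]] := ultra_ex HU (ultra_and HU hf1 hf2).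
have [h3 [le [hf13 hf23]]] := ultra_ex HU (ultra_and HU (zi (len (z h0))) (ultra_and HU hf1 hf2)).
have q f : z h3 * (z h0)^-1 = (z h3 * f) * (z h0 * f)^-1 by rewrite !gnorm.
have nq : z h3 * (z h0)^-1 <> 1.
  by move/divg1_eq => e; move: le; rewrite e ltnn.
apply: (commute_trans T nq); apply: commute_sym.
  rewrite (q f1); apply: commute_sym; apply: commuteM; first exact: commute_sym.
  exact/commuteV/commute_sym.
rewrite (q f2); apply: commute_sym; apply: commuteM; first exact: commute_sym.
exact/commuteV/commute_sym.
Qed.

Lemma axes_overlap_bound c1 c2 g r1 r2 : c1 <> 1 -> c2 <> 1 ->
  U (fun h => commute (r1 h) c1) -> U (fun h => commute (r2 h) c2) ->
  ~ commute c1 (g * c2 * g^-1) ->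
  exists M, U (fun h => (lcp (r1 h) (g * r2 h) <= M)%N).
Proof.
move=> n1 n2 h1 h2 nc; apply: (not_ninf HU) => hi; apply: nc.
exact: axes_overlap hi.
Qed.

(* Products of unbounded elements of cyclic subgroups, such that consecutive
   cyclic subgroups have different axes. *)
Inductive chain : F -> (X -> F) -> Prop :=
| chain0 c r g x of c <> 1 & inf r & U (fun h => commute (r h) c) &
    U (fun h => x h = r h * g) : chain c x
| chainS c r g c' x' x of c <> 1 & inf r & U (fun h => commute (r h) c) &
    ~ commute c (g * c' * g^-1) & chain c' x' &
    U (fun h => x h = r h * g * x' h) : chain c x.

(** [r^-1] shares only a bounded segment with the next axis, while the tail follows that axis much
    further. So [lcp_tri] identifies the cancellation, and all but a bounded end of [r] survives. *)
Lemma chain_lcp c x : chain c x ->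
  c <> 1 /\ exists r M, [/\ inf r, U (fun h => commute (r h) c) &
    U (fun h => (len (r h) <= lcp (x h) (r h) + M)%N)].
Proof.
elim=> {c x} [c r g x c1 ri rc e|c r g c' x' x c1 ri rc nc _ [c'1 [r' [M [ri' rc' le]]]] e];
  split=> //; exists r.
  exists (len g); split=> //; apply: (ultra_mono HU) e => h ->.
  by have := lcp_prod (r h) g; have := lcp_ler T (r h)^-1 g; lia.
have rc2 : U (fun h => commute ((r h)^-1) c).
  by apply: (ultra_mono HU) rc => h /commute_sym/commuteV/commute_sym.
have [B hB] := axes_overlap_bound c1 c'1 rc2 rc' nc.
exists B; split=> //; apply: (ultra4 HU) e hB le (ri' (M + len g + B)%N) => h -> h1 h2 h3.
have := lcp_prod (r h) (g * x' h); rewrite mulgA.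
suff -> : lcp (r h)^-1 (g * x' h) = lcp (r h)^-1 (g * r' h) by glia.
apply: lcp_tri; rewrite (tl_lcpC T (g * r' h) (g * x' h)).
by have := lcp_mull T g (x' h) (r' h); glia.
Qed.

Lemma chain_inf c x : chain c x -> inf x.
Proof.
case/chain_lcp => _ [r [M [ri _ le]]]; apply: (ninf_le HU ri (M := M)).
by apply: (ultra_mono HU) le => h; have := tl_lel T (x h) (r h); lia.
Qed.

End Sequences.

Definition sgn (G : groupType) (e : bool) (t : G) := if e then t else t^-1.

(* A word [:: (e1, u1); ...; (en, un)] stands for t^e1 u1 ... t^en un. *)
Fixpoint wval (F G : groupType) (i : F -> G) (t : G) (w : seq (bool * F)) : G :=
  if w is p :: w' then sgn p.1 t * i p.2 * wval i t w' else 1.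

Definition wred (F : groupType) : pred (seq (bool * F)) :=
  sorted (fun p q => (p.2 != 1) || (p.1 == q.1)).

(** * One-variable equations *)

Section Relations.
Variables (X : Type) (U : set_system X) (HU : UltraFilter U).
Variables (F : groupType) (T : tree_length F).
Notation len := (len T).
Notation lcp := (lcp T).
Notation inf := (inf U T).
Notation chain := (chain U T).
Implicit Types (x y z r tau : X -> F) (f g u v c d : F).

(** The value is only required to be constant: [f] absorbs a leading coefficient. *)
Definition satisfies_relation tau :=
  exists p w f, wred (p :: w) /\ U (fun h => wval id (tau h) (p :: w) = f).

(** [S e] is an invariant of the values of reduced words with leading sign [e], which are built from
    the right. *)
Lemma ping_pong tau (S : bool -> (X -> F) -> Prop) :
  (forall e u, S e (fun h => sgn e (tau h) * u * 1)) ->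
  (forall e e' u x, (u <> 1 \/ e = e') -> S e' x ->
     S e (fun h => sgn e (tau h) * u * x h)) ->
  (forall e x, S e x -> inf x) -> ~ satisfies_relation tau.
Proof.
move=> S0 SS Si [p [w [f [rw h]]]].
suff : S p.1 (fun h => wval id (tau h) (p :: w)) by move/Si/(inf_not_const HU); apply; exact: h.
elim: w p rw {h} => [|q w IH] p; first by move=> _; exact: S0.
case/andP=> /orP pq rw; apply: SS (IH q rw).
by case: pq => [/eqP|/eqP]; [left|right].
Qed.

Lemma sgnV e (t : F) : (sgn e t)^-1 = sgn (~~ e) t.
Proof. by case: e; rewrite /= ?invgK. Qed.

Lemma len_sgn e (t : F) : len (sgn e t) = len t.
Proof. by case: e; rewrite /= ?tl_lenV. Qed.

(** Overlap of [t^e] with a translate of [t] or of its inverse; [nontriv] excludes only the overlap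
    of [t^e] with itself. *)
Definition ov e u e' (t : F) := lcp (sgn e t) (u * sgn e' t).

Definition nontriv (e : bool) u (e' : bool) := u <> 1 \/ e <> e'.

Lemma ov_rev e u e' (t : F) : (ov e u e' t <= ov e' u^-1 e t + len u)%N.
Proof.
rewrite /ov; have := lcp_mull T u^-1 (sgn e t) (u * sgn e' t).
by rewrite mulKg tl_lcpC tl_lenV; rewrite [in X in (_ <= X)%N -> _]tl_lcpC.
Qed.

(** If every two overlaps at opposite ends left an arbitrarily long gap, the first factor of each
    reduced word would keep a long middle part. The invariant says that [x] begins with [t^e] up to
    an end eaten by a single overlap. *)
Lemma relation_overlap tau : inf tau -> satisfies_relation tau ->
  exists u e1 v e2 K, [/\ nontriv true u e1, nontriv false v e2 &
    U (fun h => (len (tau h) < ov true u e1 (tau h) + ov false v e2 (tau h) + K)%N)].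
Proof.
move=> ti; apply: contraPP => nex.
have nocover e u e1 v e2 K : nontriv e u e1 -> nontriv (~~ e) v e2 ->
    U (fun h => (ov e u e1 (tau h) + ov (~~ e) v e2 (tau h) + K <= len (tau h))%N).
  move=> n1 n2; apply: contrapT => /(ultra_not HU) h; apply: nex.
  case: e n1 n2 h => n1 n2 h; [exists u, e1, v, e2, K|exists v, e2, u, e1, K]; split=> //;
    by apply: (ultra_mono HU) h => k; move/negP; rewrite -ltnNge //= (addnC (ov false _ _ _)).
pose S e x := exists v e2 M, nontriv (~~ e) v e2 /\
  U (fun h => (len (tau h) <= lcp (x h) (sgn e (tau h)) + ov (~~ e) v e2 (tau h) + M)%N).
apply: (@ping_pong tau S) => [e u|e e' u x ue [v [e2 [M [n2 h2]]]]|e x [v [e2 [M [n2 h2]]]] K].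
- exists 1, e, (len u); split; first by right; case: (e).
  apply: (ultra_all HU) => h; rewrite mulg1.
  have := lcp_prod T (sgn e (tau h)) u; rewrite len_sgn.
  by have := lcp_ler T (sgn e (tau h))^-1 u; lia.
- exists u, e', 0%N; split; first by case: ue => [|->]; [left|right; case: (e')].
  have n1 : nontriv e' u^-1 (~~ e).
    by case: ue => [nu|->]; [left=> /(congr1 inv); rewrite invgK invg1|right; case: (e')].
  apply: (ultra2 HU) h2 (nocover _ _ _ _ _ (M + 3 * len u + 1)%N n1 n2) => h h2 h3.
  have := ov_rev (~~ e) u e' (tau h).
  have := lcp_prod T (sgn e (tau h)) (u * x h); rewrite len_sgn mulgA sgnV.
  suff -> : lcp (sgn (~~ e) (tau h)) (u * x h) = ov (~~ e) u e' (tau h) by glia.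
  apply: lcp_tri; have := lcp_mull T u (x h) (sgn e' (tau h)).
  rewrite (tl_lcpC T (u * sgn _ _)) -/(ov (~~ e) u e' (tau h)).
  by have := ov_rev (~~ e) u e' (tau h); glia.
- have n1 : nontriv e 1 (~~ e) by right; case: (e).
  apply: (ultra2 HU) h2 (nocover e 1 (~~ e) v e2 (M + K + 1)%N n1 n2) => h h2 h3.
  by have := tl_lel T (x h) (sgn e (tau h)); lia.
Qed.

Definition shape1 tau := exists g c d r1 r2, [/\ c <> 1, d <> 1,
  U (fun h => commute (r1 h) c), U (fun h => commute (r2 h) d) &
  U (fun h => tau h * g = r1 h * (r2 h)^-1)].

Definition shape2 tau := exists u K,
  U (fun h => (len (tau h) <= 2 * lcp (tau h) (u * (tau h)^-1)%g + K)%N).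

(** The initial overlap [z] is shifted along itself by [u], the terminal one [y] by [v], so each
    follows an axis. They cover [tau] up to [K], which bounds the middle [z^-1 tau y]. *)
Lemma overlaps_shape1 tau u v K : u <> 1 -> v <> 1 ->
  U (fun h => (len (tau h) < ov true u true (tau h) + ov false v false (tau h) + K)%N) ->
  shape1 tau.
Proof.
move=> nu nv hK.
have le1 h : (lcp (tau h) (u * tau h) <= len (tau h))%N by exact: tl_lel.
have [z hz] := prefix_seq (T := T) le1.
(* The truncation keeps the terminal piece from running into [z]. *)
have le2 h : (minn (lcp (tau h)^-1 (v * (tau h)^-1)) (len (tau h) - len (z h)) <= len (tau h)^-1)%N.
  by apply: leq_trans (geq_minl _ _) _; exact: tl_lel.
have [y hy] := prefix_seq (T := T) le2.
have [f1 hf1] : exists f, U (fun h => commute (z h * f) u).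
  apply: (@axis _ _ HU _ T u z (3 * len u + 2 * 0)); apply: (ultra_all HU) => h.
  by have [e1 e2] := hz h; apply: conj_bound e2 _; rewrite e1 addn0.
have [f2 hf2] : exists f, U (fun h => commute (y h * f) v).
  apply: (@axis _ _ HU _ T v y (3 * len v + 2 * 0)); apply: (ultra_all HU) => h.
  by have [e1 e2] := hy h; apply: conj_bound e2 _; rewrite e1 addn0 geq_minl.
have [rho hrho] : exists f, U (fun h => (z h)^-1 * tau h * y h = f).
  apply: (bounded_const HU (T := T) (M := K)); apply: (ultra_mono HU) hK => h.
  rewrite /ov /= => hK; have [e1 e2] := hz h; have [e3 e4] := hy h.
  have q1 := tl_lcp T (z h) (tau h).
  have q2 := tl_lcp T ((z h)^-1 * tau h)^-1 (y h); rewrite invgK tl_lenV in q2.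
  have q3 := tl_lcp T ((z h)^-1 * tau h)^-1 (tau h)^-1; rewrite invgK mulgK !tl_lenV in q3.
  have q4 := tl_min T ((z h)^-1 * tau h)^-1 (tau h)^-1 (y h).
  rewrite (tl_lcpC T (tau h)^-1 (y h)) in q4.
  by have := le1 h; glia.
(* [tau = (z f1) w (y f2)^-1]; conjugating the second axis by [w] moves [w] to the right end, where
   it becomes the bounded factor. *)
pose w := f1^-1 * rho * f2.
exists w^-1, u, (w * v * w^-1), (fun h => z h * f1), (fun h => w * (y h * f2) * w^-1); split=> //.
- move=> e; apply: nv; apply: (mulgI w); apply: (mulIg w^-1); rewrite e; by rewrite !gnorm.
- by apply: (ultra_mono HU) hf2 => h e; apply/commute_conj.
- apply: (ultra_mono HU) hrho => h e.
  by rewrite /w -e !gnorm.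
Qed.

(** [a] follows [u b], which follows [u v b], the translate of [u b] by [u v u^-1], which follows
    the same translate of [a]. With [b] the inverse of [a], a reversing overlap becomes a
    direction-preserving one. *)
Lemma overlap_mid (a b u v : F) : (lcp a (u * b)%g <= lcp b (v * b)%g)%N ->
  (lcp a (u * b)%g <= lcp a (u * v * u^-1 * a)%g + (len u + len (u * v * u^-1)%g))%N.
Proof.
move=> le; have h1 := lcp_mull T u b (v * b).
have := lcp_mull T (u * v * u^-1) a (u * b).
have -> : u * v * u^-1 * (u * b) = u * (v * b) by rewrite !gnorm.
move=> h2; have := tl_min T a (u * b) (u * (v * b)).
have := tl_min T a (u * (v * b)) (u * v * u^-1 * a).
by rewrite (tl_lcpC T (u * v * u^-1 * a)) in h2; glia.
Qed.

Lemma conj_neq1 u v : v <> 1 -> u * v * u^-1 <> 1.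
Proof. by move=> nv e; apply: nv; apply: (mulgI u); apply: (mulIg u^-1); rewrite e !gnorm. Qed.

(** Two direction-preserving overlaps give two axes; of two reversing ones the longer covers half of
    [tau]. In the mixed cases a shorter reversing overlap is converted by [overlap_mid], and a
    longer one covers half. *)
Lemma relation_shape tau : inf tau -> satisfies_relation tau -> shape1 tau \/ shape2 tau.
Proof.
move=> ti /(relation_overlap ti) [u [e1 [v [e2 [K [n1 n2 hK]]]]]].
case: e1 n1 hK => n1 hK; case: e2 n2 hK => n2 hK.
- case: n1 => // nu.
  case: (ultra_em HU (fun h => (ov false v true (tau h) <= ov true u true (tau h))%N)) => hle.
    left; apply: (overlaps_shape1 (u := u) (v := v * u * v^-1)
      (K := K + (len v + len (v * u * v^-1)%g)) nu (@conj_neq1 v u nu)).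
    by apply: (ultra2 HU) hK hle => h h1 h2; have := overlap_mid h2; rewrite /ov /= in h1 *; glia.
  right; exists v^-1, (K + 2 * len v)%N; apply: (ultra2 HU) hK hle => h h1 h2.
  by have := ov_rev false v true (tau h); rewrite /ov /= in h1 h2 *; glia.
- by left; case: n1 n2 => // nu [] // nv; apply: overlaps_shape1 nu nv hK.
- right; case: (ultra_em HU
    (fun h => (ov false v true (tau h) <= ov true u false (tau h))%N)) => hle.
    by exists u, K; apply: (ultra2 HU) hK hle => h h1 h2; rewrite /ov /= in h1 h2 *; glia.
  exists v^-1, (K + 2 * len v)%N; apply: (ultra2 HU) hK hle => h h1 h2.
  by have := ov_rev false v true (tau h); rewrite /ov /= in h1 h2 *; glia.
- case: n2 => // nv.
  case: (ultra_em HU (fun h => (ov true u false (tau h) <= ov false v false (tau h))%N)) => hle.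
    left; apply: (overlaps_shape1 (u := u * v * u^-1) (v := v)
      (K := K + (len u + len (u * v * u^-1)%g)) (@conj_neq1 u v nv) nv).
    by apply: (ultra2 HU) hK hle => h h1 h2; have := overlap_mid h2; rewrite /ov /= in h1 *; glia.
  right; exists u, K%N; apply: (ultra2 HU) hK hle => h h1 h2.
  by rewrite /ov /= in h1 h2 *; glia.
Qed.

End Relations.

(** * Ping-pong along one axis and along two axes *)

Section OneVariable.
Variables (X : Type) (U : set_system X) (HU : UltraFilter U).
Variables (F : groupType) (T : tree_length F).
Notation len := (len T).
Notation lcp := (lcp T).
Notation inf := (inf U T).
Notation chain := (chain U T).
Implicit Types (x z r tau : X -> F) (f g u v c d y : F).
Notation F2 := (free_group bool).
Notation letter i := (gen (i, true) : F2).
Notation starts_with i := (starts (fun a : bool * bool => a.1 == i)).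

(** Substitute [t = (t g) g^-1] and [t^-1 = g (t g)^-1]. Between opposite signs a coefficient is
    unchanged or conjugated by [g], so it stays nontrivial; a leading [g] goes into the constant. *)
Lemma relation_mulr tau g : satisfies_relation U tau ->
  satisfies_relation U (fun h => tau h * g).
Proof.
pose pre (e : bool) : F := if e then 1 else g.
pose post (e : bool) : F := if e then g^-1 else 1.
pose next (w : seq (bool * F)) : F := if w is q :: _ then pre q.1 else 1.
pose tr := fix tr (w : seq (bool * F)) := if w is p :: w' then
  (p.1, post p.1 * p.2 * next w') :: tr w' else [::].
have V t w : wval id t w = next w * wval id (t * g) (tr w).
  elim: w => [|[e u] w IH] /=; first by rewrite mulg1.
  by rewrite IH /pre /post; case: e; rewrite /= !gnorm.
case=> p [w [f [rw h]]].
exists (p.1, post p.1 * p.2 * next w), (tr w), ((pre p.1)^-1 * f); split.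
  elim: w p rw {h} => //= q w IH p /andP[pq rq]; apply/andP; split=> /=; last exact: IH.
  case/orP: pq => [nu|->]; last by rewrite orbT.
  case: (boolP (p.1 == q.1)) => e; rewrite ?orbT //= orbF.
  apply: contra nu; move: e; rewrite /post /pre.
  case: (p.1) (q.1) => [] [] //= _; rewrite ?mulg1 ?mul1g // => /eqP e.
  by apply/eqP/(mulgI g^-1)/(mulIg g); rewrite e mulg1 mulVg.
apply: (ultra_mono HU) h => k <-; rewrite (V (tau k) (p :: w)) mulKg //.
Qed.

Lemma noncommute_conj f c : ~ commute f c -> ~ commute c (f * c * f^-1).
Proof.
move=> nc e; have inj := noncommute_free T nc.
have : commute (letter false) (letter true * letter false * (letter true)^-1).
  by apply: inj; rewrite !gmulfM !homV ev_a ev_b; exact: e.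
by move/(congr1 val).
Qed.

Lemma hom_commute (G K : groupType) (f : {multiplicative G -> K}) (a b : G) :
  injective f -> commute (f a) (f b) -> commute a b.
Proof. by move=> inj e; apply: inj; rewrite !gmulfM. Qed.

(* t = r y r^-1 with r running along the axis of c. *)
Lemma conjugate_no_relation c y r tau : c <> 1 ->
  (forall v, commute v c <-> cyc c v) -> ~ commute c y ->
  inf r -> U (fun h => commute (r h) c) -> U (fun h => tau h = r h * y * (r h)^-1) ->
  ~ satisfies_relation U tau.
Proof.
move=> c1 Cc ncy ri rc te; have inj := noncommute_free T ncy.
have riV := inf_inv HU ri.
have rcV : U (fun h => commute (r h)^-1 c).
  by apply: (ultra_mono HU) rc => h /commute_sym/commuteV/commute_sym.
pose y' e : F2 := gen (false, e).
have evy e : ev c y (y' e) = sgn e y.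
  case: e; first exact: ev_b.
  have -> : y' false = (letter false)^-1 by rewrite genV.
  by rewrite homV ev_b.
have te' e : U (fun h => sgn e (tau h) = r h * ev c y (y' e) * (r h)^-1).
  by apply: (ultra_mono HU) te => h ->; rewrite evy; case: e => //=; rewrite !gnorm.
have ncY (Y : F2) : starts_with false Y -> starts_with false Y^-1 -> ~ commute (ev c y Y) c.
  move=> h1 h2; rewrite -[c in commute _ c](ev_a c y) => /(hom_commute inj).
  exact: (@starts_not_commute true).
have head e (Y : F2) : starts (pred1 (false, e)) Y -> starts_with false Y.
  by rewrite /starts; case: (val Y) => // a s /eqP->.
(* [Y] is a word in [c] and [y] whose two ends are powers of [y], so its value does not commute with
   [c] and separates [r] from the tail. Coefficients in <c> commute with [r] and enter [Y]. *)
pose S e x := exists (Y : F2) x', [/\ starts (pred1 (false, e)) Y,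
  starts_with false Y^-1, chain c x' & U (fun h => x h = r h * ev c y Y * x' h)].
have Sc e x : S e x -> chain c x.
  case=> Y [x' [h1 h2 ch ex]]; apply: (chainS c1 ri rc _ ch ex).
  by apply: noncommute_conj; apply: ncY h2; exact: head h1.
apply: (ping_pong HU (S := S)) => [e u|e e' u x ue Sx|e x /Sc]; last exact: chain_inf.
  exists (y' e), (fun h => (r h)^-1 * u); split; rewrite /y' ?genV ?/starts //=.
    by apply: (chain0 (r := fun h => (r h)^-1) (g := u)) => //; exact: (ultra_all HU).
  by apply: (ultra_mono HU) (te' e) => h ->; rewrite mulg1 !gnorm.
(* A coefficient off the axis of [c] separates [r^-1] from the next [r]. One on the axis lets them
   cancel, and the next [Y] is absorbed. *)
have [/Cc cu|ncu] := pselect (commute u c); last first.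
  exists (y' e), (fun h => (r h)^-1 * u * x h); split; rewrite /y' ?genV ?/starts //=.
    apply: (chainS (r := fun h => (r h)^-1) (g := u) (c' := c) (x' := x)) => //.
    - exact: noncommute_conj.
    - exact: Sc Sx.
    - exact: (ultra_all HU).
  by apply: (ultra_mono HU) (te' e) => h ->; rewrite !gnorm.
case: Sx => Y [x' [h1 h2 ch ex]].
have [a ca ea] : exists2 a, cyc (letter true) a & ev c y a = u.
  by apply: cyc_hom_ex; rewrite ev_a.
have sY := head _ _ h1.
have vY := val_cyc_mul ca sY.
have hA : starts (fun b => b != linv (false, e)) (a * Y).
  case: (eqVneq a 1) => [a1|/eqP na]; last first.
    have := starts_cyc_mul ca na sY; rewrite /starts.
    by case: (val _) => // -[b s] w /= /eqP->; rewrite xpair_eqE.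
  have ee : e = e' by case: ue => // -[]; rewrite -ea a1 hom1.
  move: h1; rewrite a1 mul1g /starts -ee; case: (val Y) => // b s /eqP->.
  by rewrite linv_neq.
have vy := val_gen_mul hA.
exists (y' e * (a * Y)), x'; split=> //.
- by rewrite /starts vy /= eqxx.
- apply: starts_invM; first by rewrite vy.
  exact: starts_invM.
apply: (ultra3 HU) (te' e) ex rc => h -> -> cr.
rewrite !gmulfM ea !mulgA; congr (_ * _ * _).
have cru : commute (r h) u by apply: cyc_commute cu; apply/Cc.
by rewrite -[_ * u * r h]mulgA -cru !gnorm.
Qed.

(* t = r1 r2^-1 with r1, r2 running along the axes of c, d, unless u maps the
   first axis onto the second and r2 is u r1 u^-1 up to a bounded factor. *)
Lemma two_axes_no_relation (c : bool -> F) (r : bool -> X -> F) tau :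
  (forall e, c e <> 1) -> (forall e v, commute v (c e) <-> cyc (c e) v) ->
  ~ commute (c true) (c false) ->
  (forall e, inf (r e)) -> (forall e, U (fun h => commute (r e h) (c e))) ->
  (forall e u, commute (u * c e * u^-1) (c (~~ e)) ->
     inf (fun h => (r (~~ e) h)^-1 * (u * r e h * u^-1))) ->
  U (fun h => tau h = r true h * (r false h)^-1) ->
  ~ satisfies_relation U tau.
Proof.
move=> c1 Cc ncd ri rc unl te; have inj := noncommute_free T ncd.
have riV e := inf_inv HU (ri e).
have rcV e : U (fun h => commute (r e h)^-1 (c e)).
  by apply: (ultra_mono HU) (rc e) => h /commute_sym/commuteV/commute_sym.
pose E := ev (c true) (c false).
have El i : E (letter i) = c i by case: i; rewrite ?ev_a ?ev_b.
have te' e : U (fun h => sgn e (tau h) = r e h * (r (~~ e) h)^-1).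
  by apply: (ultra_mono HU) te => h ->; case: e => //=; rewrite !gnorm.
(* The word [Y c_i Y^-1] represents the axis of the tail. Since it begins and ends with the
   generator other than [c e], that axis differs from the axis of [c e]. *)
pose S e x := exists (Y : F2) i x', [/\ starts_with (~~ e) (Y * letter i * Y^-1),
  starts_with (~~ e) (Y * letter i * Y^-1)^-1, chain (c i) x' &
  U (fun h => x h = r e h * E Y * x' h)].
have ncW e Y i : starts_with (~~ e) (Y * letter i * Y^-1) ->
    starts_with (~~ e) (Y * letter i * Y^-1)^-1 ->
    ~ commute (c e) (E Y * c i * (E Y)^-1).
  move=> h1 h2; rewrite -El -El -homV -!gmulfM => /(hom_commute inj)/commute_sym.
  exact: starts_not_commute.
have Sc e x : S e x -> chain (c e) x.
  case=> Y [i [x' [h1 h2 ch ex]]]; apply: (chainS (c1 e) (ri e) (rc e) _ ch ex).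
  exact: ncW.
have S1 e x : chain (c (~~ e)) x -> forall x', U (fun h => x' h = r e h * x h) -> S e x'.
  move=> ch x' ex; exists 1, (~~ e), x; split; rewrite ?mul1g ?invg1 ?mulg1 //; try by case: (e).
  by apply: (ultra_mono HU) ex => h ->; rewrite hom1 mulg1.
apply: (ping_pong HU (S := S)) => [e u|e e' u x ue Sx|e x /Sc]; last exact: chain_inf.
  apply: (S1 _ (fun h => (r (~~ e) h)^-1 * u)).
    by apply: (chain0 (r := fun h => (r (~~ e) h)^-1) (g := u)) => //; exact: (ultra_all HU).
  by apply: (ultra_mono HU) (te' e) => h ->; rewrite mulg1 !gnorm.
have step : chain (c (~~ e)) (fun h => (r (~~ e) h)^-1 * u * x h) ->
    S e (fun h => sgn e (tau h) * u * x h).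
  by move/S1; apply; apply: (ultra_mono HU) (te' e) => h ->; rewrite !gnorm.
have gen_step : ~ commute (c (~~ e)) (u * c e' * u^-1) ->
    S e (fun h => sgn e (tau h) * u * x h).
  move=> nc; apply: step.
  apply: (chainS (r := fun h => (r (~~ e) h)^-1) (g := u) (c' := c e') (x' := x)) => //.
    exact: Sc Sx.
  exact: (ultra_all HU).
(* Opposite signs bring the same axis twice. A coefficient in its centralizer is nontrivial, because
   the word is reduced, and is absorbed into [Y]. *)
have [ee|/eqP ee] := eqVneq e' (~~ e).
  subst e'; have [/Cc cu|ncu] := pselect (commute u (c (~~ e))); last first.
    by apply: gen_step; apply: noncommute_conj.
  case: Sx => Y [i [x' [h1 h2 ch ex]]]; rewrite negbK in h1 h2.
  have [a ca ea] : exists2 a, cyc (letter (~~ e)) a & E a = u.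
    by apply: cyc_hom_ex; rewrite El.
  have na : a <> 1.
    move=> a1; case: ue => [|]; first by rewrite -ea a1 hom1.
    by case: (e).
  have [] := @starts_conj (~~ e) a (Y * letter i * Y^-1) ca na; rewrite ?negbK //.
  have -> : a * (Y * letter i * Y^-1) * a^-1 = a * Y * letter i * (a * Y)^-1 by rewrite !gnorm.
  move=> k1 k2; exists (a * Y), i, x'; split=> //.
  apply: (ultra3 HU) (te' e) ex (rc (~~ e)) => h -> -> cr.
  rewrite gmulfM ea !mulgA; congr (_ * _ * _).
  have cru : commute (r (~~ e) h) u by apply: cyc_commute cu; apply/Cc.
  by rewrite -[_ * u * r _ h]mulgA -cru !gnorm.
have {}ee : e' = e by case: (e) (e') ee => [] [].
subst e'; have [lk|ncu] := pselect (commute (u * c e * u^-1) (c (~~ e))); last first.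
  by apply: gen_step => /commute_sym.
(* Equal signs bring different axes. If [u] carries one onto the other, both factors fuse into a
   single factor along the axis of [c (~~ e)], still unbounded. *)
have rhoi := unl e u lk.
case: Sx => Y [i [x' [h1 h2 ch ex]]].
have nu : u * c e * u^-1 <> 1 by apply: conj_neq1.
apply: step; apply: (chainS (c := c (~~ e)) (g := u * E Y) (c' := c i) (x' := x') _ rhoi) => //.
- apply: (ultra2 HU) (rc e) (rcV (~~ e)) => h ce cne.
  apply: commute_sym; apply: commuteM; first exact: commute_sym.
  apply: (commute_trans T nu); first exact: commute_sym.
  exact/commute_conj.
- move=> cc; apply: (ncW e Y i h1 h2).
  have q : u * E Y * c i * (u * E Y)^-1 = u * (E Y * c i * (E Y)^-1) * u^-1 by rewrite !gnorm.
  rewrite q in cc; apply/(commute_conj u).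
  by apply: (commute_trans T (c1 (~~ e))); [exact: lk|exact: commute_sym].
- by apply: (ultra_mono HU) ex => h ->; rewrite !gnorm.
Qed.

End OneVariable.

(** * Solutions of a one-variable equation *)

Section Equation.
Variables (X : Type) (U : set_system X) (HU : UltraFilter U).
Variables (F : groupType) (T : tree_length F).
Notation len := (len T).
Notation lcp := (lcp T).
Notation inf := (inf U T).
Notation chain := (chain U T).
Implicit Types (z r tau p : X -> F) (f g u v c d y x : F).

(** [p] is the common prefix of [tau] and [u tau^-1], cut at half of [tau] so that [p] and [p^-1]
    barely cancel; conjugating [tau u^-1] by it leaves a bounded [x]. *)
Lemma shape2_conj tau : inf tau -> shape2 U T tau ->
  exists g x p K, [/\ inf p, U (fun h => tau h * g = p h * x * (p h)^-1) &
    U (fun h => (2 * len (p h) <= len (p h * x * (p h)^-1)%g + K)%N)].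
Proof.
move=> ti [u [K hK]].
have le h : (minn (lcp (tau h) (u * (tau h)^-1)) (len (tau h))./2 <= len (tau h))%N.
  by apply: leq_trans (geq_minl _ _) _; exact: tl_lel.
have [p hp] := prefix_seq (T := T) le.
have [x hx] : exists x, U (fun h => (p h)^-1 * (tau h * u^-1) * p h = x).
  apply: (bounded_const HU (T := T) (M := (K + 1 + 3 * len u)%N)).
  apply: (ultra_mono HU) hK => h hK; have [e1 e2] := hp h.
  rewrite -tl_lenV; pose w := u * (tau h)^-1.
  have -> : ((p h)^-1 * (tau h * u^-1) * p h)^-1 = (p h)^-1 * (w * p h).
    by rewrite /w !gnorm.
  have q1 := tl_lcp T (p h) (w * p h).
  have q2 := tl_lcp T (w * p h) w.
  have {}q2 : (len (p h) + 2 * lcp (w * p h)%g w = len (w * p h)%g + len w)%N.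
    have q : (w * p h)^-1 * w = (p h)^-1 by rewrite !gnorm.
    by move: q2; rewrite q tl_lenV.
  have q3 := tl_min T (p h) w (w * p h); rewrite (tl_lcpC T w (w * p h)) in q3.
  have q4 := tl_min T (p h) (tau h) w.
  have q5 := tl_lcp T (tau h) (p h); rewrite (tl_lcpC T (tau h) (p h)) in q5.
  have q6 := len_leM T u ((tau h)^-1 * p h).
  have q7 := len_leBl T u ((tau h)^-1 * p h).
  have q8 := len_leBl T u (tau h)^-1; rewrite tl_lenV in q8.
  have q9 : (len (w * p h)%g = len (u * ((tau h)^-1 * p h))%g)%N by rewrite mulgA.
  rewrite -/w in hK e1 q8; glia.
have pi : inf p.
  move=> M; apply: (ultra2 HU) hK (ti (K + 2 * M + 3)%N) => h h1 h2.
  by have [-> _] := hp h; lia.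
have e : U (fun h => tau h * u^-1 = p h * x * (p h)^-1).
  by apply: (ultra_mono HU) hx => h <-; rewrite !gnorm.
exists u^-1, x, p, (len u)%N; split=> //.
apply: (ultra_mono HU) e => h <-; have [-> _] := hp h.
by have := len_leB T (tau h) u^-1; rewrite tl_lenV; lia.
Qed.

(** A long common prefix of [p^-1] and [w p^-1] runs along the axis of [w], which is that of [x]. So
    [x] moves it boundedly as well, and [p] would cancel far into [x p^-1]. *)
Lemma powers_bounded p x K w : x <> 1 -> inf p ->
  U (fun h => (2 * len (p h) <= len (p h * x * (p h)^-1)%g + K)%N) ->
  cyc x w -> w <> 1 ->
  exists M, U (fun h => (lcp (p h)^-1 (w * (p h)^-1) <= M)%N).
Proof.
move=> x1 pi hK cw w1; apply: (not_ninf HU) => ni.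
have [z hz] := prefix_seq (fun h => tl_lel T (p h)^-1 (w * (p h)^-1)).
have [f hf] : exists f, U (fun h => commute (z h * f) w).
  apply: (@axis _ _ HU _ T w z (3 * len w + 2 * 0)); apply: (ultra_all HU) => h.
  by have [e1 e2] := hz h; apply: conj_bound e2 _; rewrite e1 addn0.
have hc : U (fun h => (z h)^-1 * (x * z h) = f * x * f^-1).
  apply: (ultra_mono HU) hf => h cf.
  have {}cf : commute (z h * f) x.
    by apply: (commute_trans T w1 cf); apply: cyc_commute cw; exact: cyc_refl.
  have q : x * (z h * f) * f^-1 = z h * f * x * f^-1 by rewrite -cf.
  by rewrite -[RHS](mulKg (z h)); congr (_ * _); move: q; rewrite !gnorm => ->.
apply: (ultra_false HU).
apply: (ultra3 HU) hc hK (ni (2 * len x + len (f * x * f^-1)%g + K + 1)%N) => h e1 h2 h3.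
have [e2 e3] := hz h.
have q1 := tl_lcp T (z h) (x * z h); rewrite e1 in q1.
have q2 := tl_min T (p h)^-1 (z h) (x * z h).
have q3 := tl_min T (p h)^-1 (x * z h) (x * (p h)^-1).
have q4 := lcp_mull T x (z h) (p h)^-1.
have q5 := len_leBl T x (z h).
rewrite -mulgA in h2.
have q6 := lenM T (p h) (x * (p h)^-1); have q7 := len_leM T x (p h)^-1.
rewrite tl_lenV in q7; rewrite (tl_lcpC T (p h)^-1 (z h)) in q2.
glia.
Qed.

(* t = p x p^-1 with x bounded and no cancellation: p runs along an axis. *)
Lemma conjugator_axis tau p x K : x <> 1 -> inf p ->
  U (fun h => tau h = p h * x * (p h)^-1) ->
  U (fun h => (2 * len (p h) <= len (p h * x * (p h)^-1)%g + K)%N) ->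
  satisfies_relation U tau ->
  exists u f, u <> 1 /\ U (fun h => commute (p h * f) u).
Proof.
move=> x1 pi te hK; apply: contraPP => nex.
(* If [p] does not follow an axis, [p] and [u p] separate far before the end of [p]. *)
have good u M : u <> 1 -> U (fun h => (lcp (p h) (u * p h)%g + M <= len (p h))%N).
  move=> nu; apply: contrapT => /(ultra_not HU) h; apply: nex; exists u.
  have [f hf] : exists f, U (fun h => commute (p h * f) u); last by exists f.
  apply: (@axis _ _ HU _ T u p (3 * len u + 2 * M)); apply: (ultra_mono HU) h => h.
  move/negP; rewrite -ltnNge => lt; apply: conj_bound (lcpxx T (p h)) _; lia.
have te' e : U (fun h => sgn e (tau h) = p h * sgn e x * (p h)^-1).
  by apply: (ultra_mono HU) te => h ->; case: e => //=; rewrite !gnorm.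
have sx e : cyc x (sgn e x) by case: e => /=; [exact: cyc_refl|apply: sgV; exact: cyc_refl].
have sx1 e : sgn e x <> 1.
  by case: e => //= /(congr1 inv); rewrite invgK invg1.
pose good_tail (z : X -> F) := forall M, U (fun h => (lcp (p h) (z h) + M <= len (p h))%N).
(* The power of [x] collects factors joined by trivial coefficients. A good tail leaves [p] far
   before its end, so [p^-1 z'] still begins with a long piece of [p^-1]. *)
pose S e (z : X -> F) := exists n z', good_tail z' /\
  U (fun h => z h = p h * sgn e x ^+ n.+1 * ((p h)^-1 * z' h)).
have Sp e z : S e z -> exists M, U (fun h => (len (p h) <= lcp (z h) (p h) + M)%N).
  case=> n [z' [gz ez]]; set w := sgn e x ^+ n.+1 in ez.
  have w1 : w <> 1 by move/(torsion_free T); exact: sx1.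
  have cw : cyc x w.
    apply: (cyc_trans (sx e)); apply/cycP; by exists n.+1; left.
  have [B hB] := powers_bounded x1 pi hK cw w1.
  exists B; apply: (ultra3 HU) ez hB (gz (B + len w + 1)%N) => h -> h1 h2.
  have := lcp_prod T (p h) (w * ((p h)^-1 * z' h)); rewrite mulgA.
  suff -> : lcp (p h)^-1 (w * ((p h)^-1 * z' h)) = lcp (p h)^-1 (w * (p h)^-1) by glia.
  apply: lcp_tri; rewrite (tl_lcpC T (w * (p h)^-1)).
  have := lcp_mull T w ((p h)^-1 * z' h) (p h)^-1.
  by have := lcp_prod T (p h)^-1 (z' h); rewrite invgK tl_lenV; glia.
apply: (ping_pong HU (T := T) (S := S)) => [e u|e e' u z ue Sz|e z /Sp[M hM]].
- exists 0%N, (fun=> u); split.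
    move=> M; apply: (ultra_mono HU) (pi (len u + M)%N) => h.
    by have := lcp_ler T (p h) u; lia.
  by apply: (ultra_mono HU) (te' e) => h ->; rewrite mulg1 expg1 !gnorm.
- have [u1|/eqP nu] := eqVneq u 1.
    have ee : e = e' by case: ue.
    rewrite -{e' ue}ee in Sz; case: Sz => n [z' [gz ez]]; exists n.+1, z'; split=> //.
    apply: (ultra2 HU) (te' e) ez => h -> ->.
    by rewrite u1 [_ ^+ n.+2]expgS !gnorm.
  have [M hM] := Sp _ _ Sz.
  exists 0%N, (fun h => u * z h); split; last first.
    by apply: (ultra_mono HU) (te' e) => h ->; rewrite expg1 !gnorm.
  move=> L; apply: (ultra2 HU) hM (good u (L + M + len u + 1)%N nu) => h h1 h2.
  rewrite (@lcp_tri _ T _ (u * p h)); first by glia.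
  rewrite (tl_lcpC T (u * p h) (u * z h)); have := lcp_mull T u (z h) (p h); glia.
- apply: (ninf_le HU pi (M := M)); apply: (ultra_mono HU) hM => h.
  by have := tl_lel T (z h) (p h); glia.
Qed.

(* Solutions of a one-variable equation over a free group, up to finitely many
   of them, run along the axis of a fixed element. *)
Theorem one_variable tau : inf tau -> satisfies_relation U tau ->
  exists f g c, c <> 1 /\ U (fun h => commute (f * tau h * g) c).
Proof.
move=> ti rel.
(* If [y] does not commute with the axis, the one-axis ping-pong excludes a relation; if it does,
   [tau g] is the constant [y]. *)
have conj_case c y r g : c <> 1 -> U (fun h => commute (r h) c) ->
    U (fun h => tau h * g = r h * y * (r h)^-1) -> False.
  move=> c1 rc te.
  have relg := relation_mulr HU g rel.
  have tgi := inf_mulr HU g ti.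
  have [c' c'1 Cc] := centralizer T c1.
  have ri : inf r.
    apply: contrapT => /(not_inf HU) [f hf].
    apply: (inf_not_const HU (f := f * y * f^-1) tgi).
    by apply: (ultra2 HU) hf te => h <-.
  have cc' : cyc c' c by apply/Cc.
  have CC v : commute v c' <-> cyc c' v.
    split=> [vc'|vc']; last by apply: cyc_commute vc' _; exact: cyc_refl.
    apply/Cc; case/cycP: cc' => n [] ->; first exact: commuteX.
    exact/commuteV/commuteX.
  have rc' : U (fun h => commute (r h) c').
    by apply: (ultra_mono HU) rc => h /Cc/CC.
  have [ncy|cy] := pselect (~ commute c' y).
    exact: (conjugate_no_relation HU c'1 CC ncy ri rc' te).
  apply: (inf_not_const HU (f := y) tgi); apply: (ultra2 HU) rc' te => h cr ->.
  have : commute (r h) y.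
    by apply: (commute_trans T c'1 cr); apply/commute_sym; exact: contrapT.
  by move=> ->; rewrite mulgK.
have [] := relation_shape HU ti rel; last first.
  move=> sh2; exfalso.
  have [g [x [p [K [pi te hK]]]]] := shape2_conj ti sh2.
  have [x1|/eqP x1] := eqVneq x 1.
    apply: (inf_not_const HU (f := 1) (inf_mulr HU g ti)).
    by apply: (ultra_mono HU) te => h ->; rewrite x1 mulg1 mulgV.
  have [u [f [u1 pc]]] := conjugator_axis x1 pi te hK (relation_mulr HU g rel).
  apply: (conj_case u (f^-1 * x * f) (fun h => p h * f) g u1 pc).
  by apply: (ultra_mono HU) te => h ->; rewrite !gnorm.
case=> g [c [d [r1 [r2 [c1 d1 r1c r2d te]]]]].
(* A bounded end is absorbed into [f] or [g], and commuting axes are the same: in these three cases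
   a single axis remains. *)
have [r1i|/(not_inf HU)[a ha]] := pselect (inf r1); last first.
  exists a^-1, g, d; split=> //; apply: (ultra3 HU) ha te r2d => h h1 h2 h3.
  by rewrite -mulgA h2 h1 mulKg; apply/commute_sym/commuteV/commute_sym.
have [r2i|/(not_inf HU)[a ha]] := pselect (inf r2); last first.
  exists 1, (g * a), c; split=> //; apply: (ultra3 HU) ha te r1c => h h1 h2 h3.
  by rewrite mul1g mulgA h2 h1 mulgVK.
have [cd|ncd] := pselect (commute c d).
  exists 1, g, c; split=> //; apply: (ultra3 HU) te r1c r2d => h h2 h3 h4.
  rewrite mul1g h2; apply: commute_sym; apply: commuteM; first exact: commute_sym.
  apply/commuteV; exact: (commute_trans T d1).
exfalso.
have [c' c'1 Cc] := centralizer T c1; have [d' d'1 Cd] := centralizer T d1.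
have C' (a a' : F) : (forall v, commute v a <-> cyc a' v) -> forall v, commute v a' <-> cyc a' v.
  move=> Ca v; split=> [va'|va']; last by apply: cyc_commute va' _; exact: cyc_refl.
  apply/Ca; have /cycP[n [] ->] : cyc a' a by apply/Ca.
    exact: commuteX.
  exact/commuteV/commuteX.
pose cl (e : bool) := if e then c' else d'.
pose r (e : bool) := if e then r1 else r2.
have Ccl e v : commute v (cl e) <-> cyc (cl e) v by case: e; [exact: C' Cc v|exact: C' Cd v].
have cl1 e : cl e <> 1 by case: e.
have rcl e : U (fun h => commute (r e h) (cl e)).
  by case: e; [apply: (ultra_mono HU) r1c => h /Cc/(Ccl true)|
    apply: (ultra_mono HU) r2d => h /Cd/(Ccl false)].
have ncl : ~ commute (cl true) (cl false).
  move=> e; apply: ncd.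
  have c'c : commute c c' by apply/(Ccl true)/Cc.
  have d'd : commute d d' by apply/(Ccl false)/Cd.
  apply: (commute_trans T c'1 c'c); apply: (commute_trans T d'1 d'd); exact: e.
apply: (@two_axes_no_relation _ _ HU _ T cl r _ cl1 Ccl ncl _ rcl _ te (relation_mulr HU g rel)).
  by case.
(* If the fused factor were a constant [f], then [r2^-1 = f u r1^-1 u^-1], and [tau (g u)] would be
   the conjugate of [f u] by [r1]. The other orientation follows by inversion and conjugation. *)
suff K u : commute (u * cl true * u^-1) (cl false) ->
    inf (fun h => (r2 h)^-1 * (u * r1 h * u^-1)).
  case=> u cu; first exact: K.
  have {}cu : commute (u^-1 * cl true * u^-1^-1) (cl false).
    apply/commute_sym/(commute_conj u); rewrite !gnorm; exact: cu.
  have := inf_inv HU (inf_mulr HU u^-1 (inf_mull HU u (K _ cu))).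
  move=> h M; apply: (ultra_mono HU) (h M) => k; rewrite /r /=.
  by congr (_ < len _)%N; rewrite !gnorm.
move=> cu; apply: contrapT => /(not_inf HU) [f hf].
apply: (conj_case c' (f * u) r1 (g * u) c'1 (rcl true)).
apply: (ultra2 HU) te hf => h h1 <-.
by rewrite mulgA h1 !gnorm.
Qed.

End Equation.

(** * Normal forms in free products *)

Section FreeProduct.
Variables A B : groupType.
Notation letter := (A + B)%type.

Definition side (l : letter) := if l is inl _ then true else false.
Definition trivial_letter (l : letter) :=
  match l with inl a => a == 1 | inr b => b == 1 end.

Definition alternating : pred (seq letter) := fun w =>
  all (fun l => ~~ trivial_letter l) w && sorted (fun l l' => side l != side l') w.

Definition act (l : letter) (w : seq letter) : seq letter :=
  match l, w with
  | inl a, inl a' :: w' => if a * a' == 1 then w' else inl (a * a') :: w'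
  | inr b, inr b' :: w' => if b * b' == 1 then w' else inr (b * b') :: w'
  | _, _ => if trivial_letter l then w else l :: w
  end.

Arguments act l w : simpl nomatch.

Lemma alternating_cons l w : alternating (l :: w) -> alternating w.
Proof.
by rewrite /alternating /= => /andP[/andP[_ ->] /path_sorted ->].
Qed.

Lemma act_alternating l w : alternating w -> alternating (act l w).
Proof.
case: l => x; case: w => [|[y|y] w] rw; rewrite /act //=; case: ifP => // nx;
  rewrite ?(alternating_cons rw) //; move: rw; rewrite /alternating /= ?nx ?andbT //.
- by case/andP=> /andP[_ ->] h; case: w h.
- by case/andP=> /andP[_ ->] h; case: w h.
Qed.

Lemma act_inlM a a' w : alternating w ->
  act (inl a) (act (inl a') w) = act (inl (a * a')) w.
Proof.
case: w => [|[y|y] w] rw; rewrite /act /=.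
- case: eqP => [->|na] /=; first by rewrite mulg1.
  by case: eqP.
- case: eqP => [e|na] /=; last by rewrite mulgA.
  have -> : a * a' * y = a by rewrite -mulgA e mulg1.
  move: rw; rewrite /alternating /=; case: w => [|[z|z] w] //=.
  by rewrite !andbF.
- case: eqP => [->|na] /=; first by rewrite mulg1.
  by case: eqP.
Qed.

Lemma act_inrM a a' w : alternating w ->
  act (inr a) (act (inr a') w) = act (inr (a * a')) w.
Proof.
case: w => [|[y|y] w] rw; rewrite /act /=.
- case: eqP => [->|na] /=; first by rewrite mulg1.
  by case: eqP.
- case: eqP => [->|na] /=; first by rewrite mulg1.
  by case: eqP.
- case: eqP => [e|na] /=; last by rewrite mulgA.
  have -> : a * a' * y = a by rewrite -mulgA e mulg1.
  move: rw; rewrite /alternating /=; case: w => [|[z|z] w] //=.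
  by rewrite !andbF.
Qed.

Lemma act_trivial l w : alternating w -> trivial_letter l -> act l w = w.
Proof.
move=> rw; case: l => x /= /eqP ->; case: w rw => [|[y|y] w] rw;
  rewrite /act /= ?eqxx ?mul1g //; by case: ifP => // h; move: rw; rewrite /alternating /= h.
Qed.

Definition free_product := {w : seq letter | alternating w}.
HB.instance Definition _ := Choice.on free_product.

Lemma foldr_act_alternating u w : alternating w -> alternating (foldr act w u).
Proof. by move=> rw; elim: u => //= a u IH; apply: act_alternating. Qed.

Definition fp_mul (x y : free_product) : free_product :=
  exist alternating _ (foldr_act_alternating (val x) (valP y)).
Definition fp_one : free_product := exist alternating [::] isT.

Definition letter_inv (l : letter) : letter :=
  match l with inl a => inl a^-1 | inr b => inr b^-1 end.

Definition word_inv (w : seq letter) := rev (map letter_inv w).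

Lemma word_inv_alternating w : alternating w -> alternating (word_inv w).
Proof.
rewrite /word_inv /alternating all_rev rev_sorted sorted_map all_map.
case/andP => h1 h2; apply/andP; split.
  by apply: sub_all h1 => -[a|b] /=; rewrite invg_eq1.
by apply: sub_sorted h2 => -[a|b] [c|d].
Qed.

Definition fp_inv (x : free_product) : free_product :=
  exist alternating _ (word_inv_alternating (valP x)).

Lemma foldr_act l v z : alternating v -> alternating z ->
  foldr act z (act l v) = act l (foldr act z v).
Proof.
move=> rv rz; have R u : alternating (foldr act z u) by exact: foldr_act_alternating.
case: l => x; case: v rv => [|[y|y] v] rv; rewrite ?[foldr act z (_ :: _)]/= ?[foldr act z [::]]/=.
- by rewrite [act (inl x) [::]]/act; case: ifP => //= x1; rewrite act_trivial.
- rewrite act_inlM // [act (inl x) _]/act; case: ifP => //= xy.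
  by rewrite (act_trivial (l := inl _)).
- rewrite [act (inl x) (inr y :: v)]/act; case: ifP => //= x1.
  by rewrite (act_trivial (l := inl _)) //; exact: (R (_ :: _)).
- by rewrite [act (inr x) [::]]/act; case: ifP => //= x1; rewrite act_trivial.
- rewrite [act (inr x) (inl y :: v)]/act; case: ifP => //= x1.
  by rewrite (act_trivial (l := inr _)) //; exact: (R (_ :: _)).
- rewrite act_inrM // [act (inr x) _]/act; case: ifP => //= xy.
  by rewrite (act_trivial (l := inr _)).
Qed.

Lemma fp_mulA : associative fp_mul.
Proof.
move=> x y z; apply: val_inj => /=.
elim: (val x) => //= a u ->.
by rewrite foldr_act ?(foldr_act_alternating, valP).
Qed.

Lemma fp_mul1 : left_id fp_one fp_mul.
Proof. by move=> x; apply: val_inj. Qed.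

Lemma act_cons l w : alternating (l :: w) -> act l w = l :: w.
Proof.
rewrite /alternating; case: l => x; case: w => [|[y|y] w] /=;
  by rewrite /act /= ?andbF //; case: (x == 1).
Qed.

Lemma foldr_act_nil w : alternating w -> foldr act [::] w = w.
Proof.
elim: w => //= a w IH rw; rewrite IH; first exact: act_cons.
exact: alternating_cons rw.
Qed.

Lemma fp_mulr1 : right_id fp_one fp_mul.
Proof. by move=> x; apply: val_inj; apply: foldr_act_nil; apply: valP. Qed.

Lemma fp_mulV : left_inverse fp_one fp_inv fp_mul.
Proof.
move=> x; apply: val_inj => /=; case: x => w /= rw.
elim: w rw => //= a w IH rw.
rewrite /word_inv /= rev_cons -cats1 foldr_cat /=.
have -> : act (letter_inv a) (a :: w) = w by case: a {rw IH} => x; rewrite /act /= mulVg eqxx.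
exact/IH/(alternating_cons rw).
Qed.

Lemma fp_mulrV : right_inverse fp_one fp_inv fp_mul.
Proof.
move=> x; rewrite -(fp_mulV (fp_inv x)); congr fp_mul.
apply: val_inj; rewrite /= /word_inv map_rev revK -map_comp.
by rewrite (eq_map (g := id)) ?map_id // => -[a|b]; rewrite /= invgK.
Qed.

HB.instance Definition _ :=
  isGroup.Build free_product fp_mulA fp_mul1 fp_mulr1 fp_mulV fp_mulrV.

Lemma act1_alternating l : alternating (act l [::]).
Proof. exact: act_alternating. Qed.

Definition fp_letter l : free_product := exist alternating _ (act1_alternating l).

Lemma val_letter_mul l (x : free_product) : val (fp_letter l * x) = act l (val x).
Proof.
have -> : val (fp_letter l * x) = foldr act (val x) (act l [::]) by [].
have -> : act l [::] = if trivial_letter l then [::] else [:: l] by case: l.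
by case: ifP => h //=; rewrite (act_trivial (valP x) h).
Qed.

Lemma fp_inlM : {morph (fun a => fp_letter (inl a)) : x y / x * y}.
Proof.
move=> a b; apply: val_inj; rewrite val_letter_mul [val (fp_letter (inl b))]/=.
by rewrite -[RHS]/(act (inl a) (act (inl b) [::])) act_inlM.
Qed.

Lemma fp_inrM : {morph (fun a => fp_letter (inr a)) : x y / x * y}.
Proof.
move=> a b; apply: val_inj; rewrite val_letter_mul [val (fp_letter (inr b))]/=.
by rewrite -[RHS]/(act (inr a) (act (inr b) [::])) act_inrM.
Qed.

Definition fp_inl : {multiplicative A -> free_product} := mk_hom fp_inlM.
Definition fp_inr : {multiplicative B -> free_product} := mk_hom fp_inrM.

End FreeProduct.

Section NormalForm.
Variables (A B G : groupType) (iA : {multiplicative A -> G}) (iB : {multiplicative B -> G}).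
Hypothesis AB : is_free_product iA iB.

Lemma free_product_words : exists th : {multiplicative G -> free_product A B},
  (forall a, th (iA a) = fp_letter (inl a)) /\ (forall b, th (iB b) = fp_letter (inr b)).
Proof. by have [[th h] _] := AB (fp_inl A B) (fp_inr A B); exists th. Qed.

Definition factor (s : bool) (g : G) :=
  if s then exists a, iA a = g else exists b, iB b = g.

(** The side of the first syllable, read in the concrete free product; this is all that folding sees
    of normal forms. *)
Lemma free_product_nf : exists nf : bool -> G -> Prop,
  [/\ forall s g, factor s g -> g <> 1 -> nf s g,
      forall s g x, factor s g -> g <> 1 -> nf (~~ s) x -> nf s (g * x) &
      forall s g, nf s g -> ~ factor (~~ s) g].
Proof.
have [th [thA thB]] := free_product_words.
exists (fun s g => if val (th g) is l :: _ then side l == s else false).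
have nA a : iA a <> 1 -> (a == 1) = false by move=> h; apply/eqP => e; apply: h; rewrite e hom1.
have nB b : iB b <> 1 -> (b == 1) = false by move=> h; apply/eqP => e; apply: h; rewrite e hom1.
split.
- by case=> g [a <-] /= h; rewrite ?thA ?thB /= ?(nA _ h) ?(nB _ h).
- case=> g x [a <-] h; rewrite gmulfM ?thA ?thB val_letter_mul;
  case: (val (th x)) => [|[y|y] w] //= _; by rewrite ?(nA _ h) ?(nB _ h).
- case=> g h [a e]; move: h; rewrite -e ?thA ?thB /=; by case: eqP.
Qed.

Lemma free_product_injl : injective iA.
Proof.
apply: hom_inj => a e; have [th [thA _]] := free_product_words.
have := thA a; rewrite e hom1 => /(congr1 val) /=.
by case: eqP.
Qed.

Lemma free_product_injr : injective iB.
Proof.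
apply: hom_inj => a e; have [th [_ thB]] := free_product_words.
have := thB a; rewrite e hom1 => /(congr1 val) /=.
by case: eqP.
Qed.

End NormalForm.

(** * Grushko's theorem *)

Section Grushko.
Variables (G : groupType).

(* Vertices carry the name of a factor; the two factors are true and false. *)
Notation vertex := (bool * nat)%type.
Notation edge := (vertex * G * vertex)%type.
Notation tie := (vertex * vertex)%type.

Implicit Types (r i j k v w : vertex) (g a b f : G) (E : seq edge) (V : seq vertex) (Q : seq tie).

(** Elements of [B] are loops at [r] rather than edges, so they do not count towards the rank. *)
Inductive loc (r : vertex) (B : G -> Prop) (E : seq edge) : vertex -> G -> vertex -> Prop :=
| loc_refl i : loc r B E i 1 i
| loc_base f of B f : loc r B E r f r
| loc_edge i g j of (i, g, j) \in E : loc r B E i g j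
| loc_sym i g j of loc r B E i g j : loc r B E j g^-1 i
| loc_trans i g j h k of loc r B E i g j & loc r B E j h k : loc r B E i (g * h) k.

Definition labels (B : G -> Prop) (s : seq G) : G -> Prop := fun g => B g \/ g \in s.

(* Contract the edge e, whose label becomes a change of base point at k. *)
Lemma loc_contract r B E e k b : e \in E -> k != r ->
  (e = (r, b, k) \/ e = (k, b^-1, r)) ->
  let si i := if i == k then r else i in
  let ga i := if i == k then b else 1 in
  let E' := [seq (si d.1.1, ga d.1.1 * d.1.2 * (ga d.2)^-1, si d.2) | d <- rem e E] in
  forall i g j, loc r B E i g j -> loc r B E' (si i) (ga i * g * (ga j)^-1) (si j).
Proof.
move=> eE kr he si ga E'.
have rk : (r == k) = false by rewrite eq_sym (negbTE kr).
have sr : si r = r by rewrite /si rk.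
have gr : ga r = 1 by rewrite /ga rk.
have sk : si k = r by rewrite /si eqxx.
have gk : ga k = b by rewrite /ga eqxx.
move=> i g j; elim=> {i g j} [i|f Bf|i g j dE|i g j _ IH|i g j h l _ IH1 _ IH2].
- by rewrite mulg1 mulgV; exact: loc_refl.
- by rewrite sr gr invg1 mul1g mulg1; exact: loc_base.
- have [de|nde] := eqVneq (i, g, j) e.
    rewrite -de in he; case: he => -[-> -> ->]; rewrite sr sk gr gk ?invg1 ?mul1g ?mulg1 mulgV;
      exact: loc_refl.
  apply: loc_edge; apply/mapP; exists (i, g, j) => //.
  by move: dE; rewrite (perm_mem (perm_to_rem eE)) inE (negbTE nde).
- have -> : ga j * g^-1 * (ga i)^-1 = (ga i * g * (ga j)^-1)^-1 by rewrite !gnorm.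
  exact: loc_sym.
- have -> : ga i * (g * h) * (ga l)^-1 = (ga i * g * (ga j)^-1) * (ga j * h * (ga l)^-1).
    by rewrite !gnorm.
  exact: loc_trans IH1 IH2.
Qed.

(** Contracting a spanning tree leaves at most [size E - size V + 1] loops, whose labels generate
    together with [B]. *)
Lemma loc_rank r B E V (P : G -> Prop) : uniq V -> r \in V ->
  (forall g h, P g -> P h -> P (g * h)) -> (forall g, P g -> P g^-1) -> P 1 ->
  (forall d, d \in E -> [/\ d.1.1 \in V, d.2 \in V & P d.1.2]) ->
  (forall v, v \in V -> exists g, loc r B E r g v) ->
  exists s, [/\ (size s + size V <= size E + 1)%N, forall g, g \in s -> P g &
    forall g, loc r B E r g r -> sg (labels B s) g].
Proof.
move=> uV rV PM PV P1.
have [n le] := ubnP (size V); elim: n E V le uV rV => // n IHn E V le uV rV.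
rewrite ltnS in le; move=> wf con.
(* An edge with exactly one end at [r] is contracted; without one, connectivity leaves [r] as the
   only vertex. *)
have [/hasP[e eE he]|nhe] := boolP (has (fun d : edge => (d.1.1 == r) (+) (d.2 == r)) E).
  have [k [b [kr kV Pb hk]]] : exists k b, [/\ k != r, k \in V, P b &
      (e = (r, b, k) \/ e = (k, b^-1, r))].
    have [w1 w2 w3] := wf e eE; move: he w1 w2 w3 {eE}; case: e => [[i g] j] /=.
    case: (eqVneq i r) => [->|ni]; case: (eqVneq j r) => [->|nj] //= _ w1 w2 w3.
      by exists j, g; split=> //; left.
    by exists i, g^-1; split=> //; [exact: PV|right; rewrite invgK].
  have C := loc_contract (B := B) eE kr hk; move: C => /=.
  set si := (fun i => if i == k then r else i); set ga := (fun i => if i == k then b else 1).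
  set E' := map _ _ => C.
  have rk : (r == k) = false by rewrite eq_sym (negbTE kr).
  have [|||||s [les Ps hs]] := IHn E' (rem k V).
  - by rewrite size_rem //; case: (V) kV le => //= _ l _; lia.
  - exact: rem_uniq.
  - by rewrite mem_rem_uniq // inE rk rV.
  - move=> d /mapP[d' /mem_rem d'E ->] /=; have [w1 w2 w3] := wf d' d'E.
    rewrite !mem_rem_uniq // !inE.
    have Pga i : P (ga i) by rewrite /ga; case: ifP.
    split; [| |exact: PM (PM _ _ (Pga _) w3) (PV _ (Pga _))];
      by case: ifP => [_|->] //=; rewrite rk.
  - move=> v; rewrite mem_rem_uniq // inE => /andP[/= vk vV].
    have [g hg] := con v vV; exists g; move: (C _ _ _ hg).
    by rewrite /= rk (negbTE vk) invg1 mul1g mulg1.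
  exists s; split=> //.
    by move: les; rewrite size_map !size_rem //; case: (V) kV => // ? ? _;
      case: (E) eE => //= ? ? _; lia.
  by move=> g hg; apply: hs; move: (C _ _ _ hg); rewrite /= rk invg1 mul1g mulg1.
exists [seq d.1.2 | d <- E].
have K i g j : loc r B E i g j -> (i == r) = (j == r) /\
      (i == r -> sg (labels B [seq d.1.2 | d <- E]) g).
  elim=> {i g j} [i|f Bf|i g j dE|i g j _ [IH1 IH2]|i g j h l _ [IH1 IH2] _ [IH3 IH4]].
  - by split=> // _; apply: sg1.
  - by split=> // _; apply: sg_in; left.
  - move/hasPn: nhe => /(_ _ dE) /= h; split; first by case: (_ == _) h; case: (_ == _).
    by move=> _; apply: sg_in; right; apply/mapP; exists (i, g, j).
  - by split=> // jr; apply: sgV; apply: IH2; rewrite IH1.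
  - split; first by rewrite IH1.
    by move=> ir; apply: sgM; [exact: IH2|apply: IH4; rewrite -IH1].
split; last by move=> g /K[_]; apply.
  rewrite size_map addnC [(_ + 1)%N]addnC leq_add2r.
have sub : {subset V <= [:: r]}.
  by move=> v /con[g /K[]]; rewrite eqxx inE => <-.
exact: uniq_leq_size uV sub.
by move=> g /mapP[d /wf[_ _ Pd] ->].
Qed.

Variables (H : bool -> G -> Prop) (nf : bool -> G -> Prop) (B : G -> Prop).
Hypothesis H1 : forall s, H s 1.
Hypothesis HM : forall s g h, H s g -> H s h -> H s (g * h).
Hypothesis HV : forall s g, H s g -> H s g^-1.
Hypothesis nf1 : forall s g, H s g -> g <> 1 -> nf s g.
Hypothesis nfM : forall s g x, H s g -> g <> 1 -> nf (~~ s) x -> nf s (g * x).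
Hypothesis nfN : forall s g, nf s g -> ~ H (~~ s) g.
Hypothesis BH : forall g, B g -> H true g.

Definition base : vertex := (true, 0%N).

Notation lo := (loc base B).

Inductive glob E Q : vertex -> G -> vertex -> Prop :=
| glob_loc i g j of lo E i g j : glob E Q i g j
| glob_tie i j of (i, j) \in Q : glob E Q i 1 j
| glob_sym i g j of glob E Q i g j : glob E Q j g^-1 i
| glob_trans i g j h k of glob E Q i g j & glob E Q j h k : glob E Q i (g * h) k.

Lemma glob_sub E Q E' Q' :
  (forall i g j, (i, g, j) \in E -> glob E' Q' i g j) ->
  (forall i j, (i, j) \in Q -> glob E' Q' i 1 j) ->
  forall i g j, glob E Q i g j -> glob E' Q' i g j.
Proof.
move=> hE hQ i g j; elim=> {i g j} [i g j|i j /hQ//|i g j _ /glob_sym//|i g j h k _ h1 _ h2].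
  elim=> {i g j} [i|f Bf|i g j /hE//|i g j _ /glob_sym//|i g j h k _ h1 _ h2].
  - exact/glob_loc/loc_refl.
  - exact/glob_loc/loc_base.
  - exact: glob_trans h1 h2.
exact: glob_trans h1 h2.
Qed.

(** Stallings' graphs with binding ties: an edge carries an element of the factor named by its ends,
    a tie has trivial label and changes the factor. [g_count] bounds the first Betti number by [c];
    a fold trades a tie for an edge and keeps the bound. *)
Record graph (c : nat) V E Q : Prop := Graph {
  g_uniq : uniq V;
  g_base : base \in V;
  g_edge : forall i g j, (i, g, j) \in E -> [/\ i \in V, j \in V, i.1 = j.1 & H i.1 g];
  g_tie : forall i j, (i, j) \in Q -> [/\ i \in V, j \in V, i.1 = true & j.1 = false];
  g_con : forall v, v \in V -> exists g, glob E Q base g v;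
  g_count : (size E + size Q + 1 <= size V + c)%N
}.

Lemma loc_side c V E Q i g j : graph c V E Q -> lo E i g j -> i.1 = j.1 /\ H i.1 g.
Proof.
move=> gr; elim=> {i g j} [i|f Bf|i g j dE|i g j _ [e h]|i g j h l _ [e1 h1] _ [e2 h2]].
- by split.
- by split=> //; exact: BH.
- by have [] := g_edge gr dE.
- by rewrite -e; split=> //; exact: HV.
- by rewrite -e2 -e1; split=> //; apply: HM => //; rewrite e1.
Qed.

Definition tend (s : bool) (t : tie) := if s then t.1 else t.2.

Definition folded E Q := forall s t t', t \in Q -> t' \in Q ->
  lo E (tend s t) 1 (tend s t') -> t = t'.

(* Two ties with equivalent ends on one side are merged: one of them becomes an
   edge on the other side. *)
Lemma fold_step c V E Q : graph c V E Q -> (forall g, glob E Q base g base) ->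
  ~ folded E Q -> exists E' Q', [/\ graph c V E' Q',
    (forall g, glob E' Q' base g base) & (size Q' < size Q)%N].
Proof.
move=> gr all nf0.
have [s [t [t' [tQ t'Q lt nt]]]] : exists s t t', [/\ t \in Q, t' \in Q,
    lo E (tend s t) 1 (tend s t') & t <> t'].
  apply: contrapT => h; apply: nf0 => s t t' tQ t'Q lt; apply: contrapT => nt.
  by apply: h; exists s, t, t'.
pose E' := (tend (~~ s) t, 1, tend (~~ s) t') :: E; pose Q' := rem t' Q.
have tQ' : t \in Q'.
  by move: tQ; rewrite (perm_mem (perm_to_rem t'Q)) inE => /orP[/eqP|//].
have inc i g j : lo E i g j -> glob E' Q' i g j.
  elim=> {i g j} [i|f Bf|i g j dE|i g j _ /glob_sym//|i g j h k _ h1 _ h2].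
  - exact/glob_loc/loc_refl.
  - exact/glob_loc/loc_base.
  - by apply/glob_loc/loc_edge; rewrite inE dE orbT.
  - exact: glob_trans h1 h2.
have tend_tie u (q : tie) : q \in Q' -> glob E' Q' (tend u q) 1 (tend (~~ u) q).
  case: q => a b qQ; have h : glob E' Q' a 1 b by exact: glob_tie.
  by case: u => //=; rewrite -invg1; exact: glob_sym.
have new u : glob E' Q' (tend u t') 1 (tend (~~ u) t').
  have h : glob E' Q' (tend s t') 1 (tend (~~ s) t').
    rewrite -(mulg1 1) -{1}(mulg1 1) -{1}invg1.
    apply: glob_trans (glob_trans (glob_sym (inc _ _ _ lt)) (tend_tie s t tQ')) _.
    by apply/glob_loc/loc_edge; rewrite inE eqxx.
  have [->//|us] := eqVneq u s.
  have -> : u = ~~ s by case: u s us {lt E' inc tend_tie h} => [] [].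
  by rewrite negbK -invg1; exact: glob_sym.
have sub i g j : glob E Q i g j -> glob E' Q' i g j.
  apply: glob_sub => [{}i {}g {}j dE|{}i {}j q]; first exact/inc/loc_edge.
  have [e|ne] := eqVneq t' (i, j); first by have := new true; rewrite e.
  apply: glob_tie; move: q; rewrite (perm_mem (perm_to_rem t'Q)) inE => /orP[/eqP e|//].
  by rewrite e eqxx in ne.
have sQ : (size Q' < size Q)%N by rewrite /Q' size_rem //; case: (Q) tQ.
exists E', Q'; split=> //; last by move=> g; exact: sub.
have vt (u : bool) (q : tie) : q \in Q -> tend u q \in V /\ (tend u q).1 = u.
  by case: q => a b /(g_tie gr)[? ? ? ?]; case: u.
split.
- exact: g_uniq gr.
- exact: g_base gr.
- move=> i g j; rewrite inE => /orP[/eqP[-> -> ->]|/(g_edge gr)//].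
  by have [? e] := vt (~~ s) t tQ; have [? e'] := vt (~~ s) t' t'Q; rewrite e e'.
- by move=> i j /mem_rem/(g_tie gr).
- by move=> v /(g_con gr)[g /sub]; exists g.
- have := g_count gr; have : (size Q = (size Q').+1)%N.
    by rewrite /Q' size_rem //; case: (Q) tQ.
  by rewrite /=; lia.
Qed.

Lemma fold_all c V E Q : graph c V E Q -> (forall g, glob E Q base g base) ->
  exists E' Q', [/\ graph c V E' Q',
    (forall g, glob E' Q' base g base) & folded E' Q'].
Proof.
have [n le] := ubnP (size Q); elim: n => // n IHn in E Q le *.
rewrite ltnS in le => gr all.
have [f|nf0] := pselect (folded E Q); first by exists E, Q.
have [E' [Q' [gr' all' lt]]] := fold_step gr all nf0.
by apply: (IHn E' Q') => //; exact: leq_trans lt le.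
Qed.

(* The option records the tie just crossed, so that paths do not backtrack. *)
Inductive red E Q : option tie -> vertex -> G -> vertex -> Prop :=
| red0 o i g j of lo E i g j : red E Q o i g j
| redS o i g t h k of t \in Q & lo E i g (tend i.1 t) & (o = Some t -> g <> 1) &
    red E Q (Some t) (tend (~~ i.1) t) h k : red E Q o i (g * h) k.

Lemma red_weaken E Q o i g k : red E Q o i g k -> red E Q None i g k.
Proof.
by case=> {o i g k} [o i g j l|o i g t h k tQ l _ r]; [exact: red0|exact: redS r].
Qed.

Lemma red_loc E Q i g j h k : lo E i g j -> i.1 = j.1 ->
  red E Q None j h k -> red E Q None i (g * h) k.
Proof.
move=> l e; move eo : None => o r.
case: r eo l e => {o j h k} [o j h k l'|o j h t h' k tQ l' _ r] eo l e.
  by apply: red0; exact: loc_trans l l'.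
rewrite mulgA; apply: (redS (t := t)); rewrite ?e // -?eo //.
exact: loc_trans l l'.
Qed.

Lemma red_tie c V E Q s t h k : graph c V E Q -> t \in Q ->
  red E Q None (tend s t) h k -> red E Q None (tend (~~ s) t) h k.
Proof.
move=> gr tQ.
have side (u : bool) (q : tie) : q \in Q -> (tend u q).1 = u.
  by case: q => a b /(g_tie gr)[? ? ? ?]; case: u.
move ej : (tend s t) => j; move eo : None => o r.
case: r ej eo => {o j h k} [o j h k l|o j h t' h' k t'Q l _ r] ej eo; subst o.
  rewrite -[h]mul1g; apply: (redS (t := t)) => //; rewrite side //.
    exact: loc_refl.
  by rewrite negbK; apply: red0; rewrite ej.
have js : j.1 = s by rewrite -ej side.
have [[e1 e2]|ne] := pselect (t' = t /\ h = 1).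
  by rewrite e2 mul1g; apply: red_weaken; rewrite e1 js in r; exact: r.
rewrite -[h * h']mul1g; apply: (redS (t := t)) => //; rewrite side //.
  exact: loc_refl.
rewrite negbK ej; apply: (redS (t := t')) => // -[e1] e2; apply: ne; by split.
Qed.

(** Paths without backtracking survive composition on the left with any step. As [glob] also inverts
    whole paths, the induction treats [g] and [g^-1] together. *)
Lemma glob_red c V E Q i g k : graph c V E Q -> glob E Q i g k -> red E Q None i g k.
Proof.
move=> gr glia; rewrite -[g]mulg1.
suff [K _] : (forall h l, red E Q None k h l -> red E Q None i (g * h) l) /\
             (forall h l, red E Q None i h l -> red E Q None k (g^-1 * h) l).
  by apply: K; apply: red0; exact: loc_refl.
elim: glia => {i g k} [i g j l|i j q|i g j _ [h1 h2]|i g j h k _ [h1 h2] _ [h3 h4]].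
- have [e _] := loc_side gr l; split=> h m; first exact: red_loc.
  by apply: red_loc => //; exact: loc_sym.
- split=> h m; rewrite ?invg1 mul1g.
    exact: (@red_tie c V E Q false (i, j)).
  exact: (@red_tie c V E Q true (i, j)).
- by split=> //; move=> h m; rewrite invgK; exact: h1.
- split=> x m; first by rewrite -mulgA => /h3/h1.
  by rewrite invgM -mulgA => /h2/h4.
Qed.

(** A trivial local label between two ties would identify them by folding, which is backtracking. So
    these labels are nontrivial and spell a normal form. *)
Lemma red_nf c V E Q o i g k : graph c V E Q -> folded E Q -> red E Q o i g k ->
  forall t, o = Some t -> t \in Q -> i = tend i.1 t -> lo E i g k \/ nf i.1 g.
Proof.
move=> gr fo; elim=> {o i g k} [o i g j l|o i g t' h k t'Q l ng r IH] t eo tQ ei.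
  by left.
right; have [_ Hg] := loc_side gr l.
have side (u : bool) (q : tie) : q \in Q -> (tend u q).1 = u.
  by case: q => a b /(g_tie gr)[? ? ? ?]; case: u.
have g1 : g <> 1.
  move=> g1; have tt : t = t' by apply: (fo i.1) => //; rewrite -ei -g1.
  by apply: ng g1; rewrite -tt.
have es := side (~~ i.1) t' t'Q.
have := IH t' erefl t'Q; rewrite es => /(_ erefl) [l'|nfh]; last exact: nfM.
have [_] := loc_side gr l'; rewrite es => Hh.
have [->|/eqP h1] := eqVneq h 1; first by rewrite mulg1; exact: nf1.
by apply: nfM => //; exact: nf1.
Qed.

(** If a tie were crossed, what remains of the label would lie in the factor of [i] and yet have a
    normal form that begins in the other factor. *)
Lemma glob_loc_side c V E Q i a k : graph c V E Q -> folded E Q ->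
  glob E Q i a k -> H i.1 a -> k.1 = i.1 -> lo E i a k.
Proof.
move=> gr fo /(glob_red gr) r; move eo : None r => o r.
case: r eo => {o i a k} [o i g j l|o i g t h k tQ l _ r] _ Ha ek //.
have side (u : bool) (q : tie) : q \in Q -> (tend u q).1 = u.
  by case: q => ? ? /(g_tie gr)[? ? ? ?]; case: u.
have [_ Hg] := loc_side gr l; exfalso.
case: (red_nf gr fo r erefl tQ) => [|l'|]; first by rewrite side.
  by have [e _] := loc_side gr l'; rewrite side // ek in e; case: (i.1) e.
rewrite side // => /nfN; rewrite negbK; apply.
by rewrite -[h](mulKg g); apply: HM => //; exact: HV.
Qed.

(** By [red_nf] a second crossing is impossible. The two local labels are mutually inverse, so each
    lies in both factors and is trivial. *)
Lemma glob_loc_other c V E Q i k : graph c V E Q -> folded E Q ->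
  glob E Q i 1 k -> k.1 <> i.1 ->
  exists2 t, t \in Q & lo E i 1 (tend i.1 t) /\ lo E (tend (~~ i.1) t) 1 k.
Proof.
move=> gr fo /(glob_red gr); move eo : None => o; move eg : {1}1 => g1 r.
case: r eo eg => {o i g1 k} [o i g j l|o i g t h k tQ l _ r] _ e1 ek.
  by case: ek; have [] := loc_side gr l.
have side (u : bool) (q : tie) : q \in Q -> (tend u q).1 = u.
  by case: q => ? ? /(g_tie gr)[? ? ? ?]; case: u.
have [_ Hg] := loc_side gr l.
have hg : h = g^-1 by apply/esym/mulg1_eq; rewrite e1.
have Hh : H i.1 h by rewrite hg; exact: HV.
case: (red_nf gr fo r erefl tQ) => [|l'|]; first by rewrite side.
  have [_] := loc_side gr l'; rewrite side // => Hh'.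
  have h1 : h = 1.
    by apply: contrapT => h1; apply: (nfN (nf1 Hh' h1)); rewrite negbK.
  have g1 : g = 1 by rewrite -[g]invgK -hg h1 invg1.
  by exists t => //; rewrite g1 in l; rewrite h1 in l'.
by rewrite side // => /nfN; rewrite negbK; case.
Qed.

Lemma loc_color c V E Q q i g j : graph c V E Q -> lo E i g j ->
  if i.1 then loc base B [seq d <- E | d.1.1.1] i g j
  else loc q (fun=> False) [seq d <- E | ~~ d.1.1.1] i g j.
Proof.
move=> gr; elim=> {i g j} [i|f Bf|i g j dE|i g j l IH|i g j h k l1 IH1 l2 IH2].
- by case: (i.1); exact: loc_refl.
- exact: loc_base.
- by case: ifP => ei; apply: loc_edge; rewrite mem_filter /= ei.
- by have [e _] := loc_side gr l; rewrite e in IH *; case: (j.1) IH => IH; exact: loc_sym.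
- have [e _] := loc_side gr l1; rewrite e in IH1 *.
  by case: (j.1) IH1 IH2 => IH1 IH2; exact: loc_trans IH1 IH2.
Qed.

(** Each side is connected by paths with trivial labels, so its loops at one vertex carry the whole
    factor. The two ranks add up to at most [size E + 2 - size V], and a tie must exist to reach the
    second factor, so the sum is at most [c]. *)
Lemma folded_conclusion c V E Q : graph c V E Q -> (forall g, glob E Q base g base) ->
  folded E Q -> (exists2 b, H false b & b <> 1) ->
  exists sa sb, [/\ (size sa + size sb <= c)%N,
    forall g, g \in sa -> H true g, forall g, g \in sb -> H false g,
    forall g, H true g -> sg (labels B sa) g &
    forall g, H false g -> sg (fun x => x \in sb) g].
Proof.
move=> gr all fo [b Hb b1].
have side (u : bool) (q : tie) : q \in Q -> (tend u q).1 = u.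
  by case: q => ? ? /(g_tie gr)[? ? ? ?]; case: u.
have one v : v \in V -> glob E Q base 1 v.
  by case/(g_con gr) => g hg; rewrite -[1](mulVg g); apply: glob_trans (all _) hg.
have [t tQ] : exists t, t \in Q.
  suff K o i g k : red E Q o i g k -> i.1 -> H false g -> g <> 1 -> exists t, t \in Q.
    exact: K (glob_red gr (all b)) _ Hb b1.
  case=> {o i g k} [o i g j l|o i g t h k tQ _ _ _] i1 Hg g1; last by exists t.
  have [_] := loc_side gr l; rewrite i1 => Hg'; exfalso.
  exact: (nfN (nf1 Hg g1) Hg').
have [tV1 tV2] : tend true t \in V /\ tend false t \in V.
  by case: (t) tQ => x y /(g_tie gr)[].
(* The true ends of all ties are joined by trivial labels, so folding makes [t] the only tie, and
   every vertex of the false side is reached through [q]. *)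
pose q := tend false t.
have loT v : v \in V -> v.1 -> lo E base 1 v.
  by move=> vV v1; apply: (glob_loc_side gr fo) => //; exact: one.
have loF v : v \in V -> ~~ v.1 -> lo E q 1 v.
  move=> vV v1; have [|t' t'Q [/= l1 l2]] := glob_loc_other gr fo (one v vV).
    by move=> /= e; rewrite e in v1.
  suff tt : t = t' by rewrite /q tt.
  apply: (fo true) => //; rewrite -(mulg1 1) -{1}invg1.
  by apply: loc_trans l1; apply: loc_sym; apply: loT; rewrite // side.
pose VT := [seq v <- V | v.1]; pose VF := [seq v <- V | ~~ v.1].
pose ET := [seq d <- E | d.1.1.1]; pose EF := [seq d <- E | ~~ d.1.1.1].
have qF : q.1 = false by rewrite side.
have [||||sa [la Pa ha]] := @loc_rank base B ET VT (H true) _ _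
    (@HM true) (@HV true) (@H1 true).
- by rewrite filter_uniq // (g_uniq gr).
- by rewrite mem_filter /= (g_base gr).
- move=> [[i g] j]; rewrite !mem_filter /= => /andP[i1 /(g_edge gr)[-> -> <-]].
  by rewrite i1.
- move=> v; rewrite mem_filter => /andP[v1 vV]; exists 1.
  exact: (loc_color q gr (loT v vV v1)).
have [||||sb [lb Pb hb]] := @loc_rank q (fun=> False) EF VF (H false) _ _
    (@HM false) (@HV false) (@H1 false).
- by rewrite filter_uniq // (g_uniq gr).
- by rewrite mem_filter qF.
- move=> [[i g] j]; rewrite !mem_filter /= => /andP[i1 /(g_edge gr)[-> -> <-]].
  by rewrite (negbTE i1).
- move=> v; rewrite mem_filter => /andP[v1 vV]; exists 1.
  by have := loc_color q gr (loF v vV v1); rewrite qF.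
have sz : (size sa + size sb <= c)%N.
  have := g_count gr; have : (0 < size Q)%N by case: (Q) tQ.
  have : (size ET + size EF = size E)%N by rewrite !size_filter count_predC.
  have : (size VT + size VF = size V)%N by rewrite !size_filter count_predC.
  by lia.
exists sa, sb; split=> //.
- move=> g Hg; apply: ha; apply: (loc_color q gr (i := base)).
  exact: (glob_loc_side gr fo).
- move=> g Hg.
  have {hb} := hb g; have -> : labels (fun=> False) sb = (fun x => x \in sb).
    by apply/funext => x; apply/propext; rewrite /labels; split=> [[]//|h]; right.
  apply.
  have l : lo E q g q.
    apply: (glob_loc_side gr fo); rewrite ?qF //.
    rewrite -[g]mul1g -{1}invg1 -[_ * g]mulg1.
    apply: glob_trans (one _ tV2); apply: glob_trans (all g); exact/glob_sym/one.
  by have := loc_color q gr l; rewrite qF.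
Qed.

Definition extends V E Q V' E' Q' :=
  {subset V <= V'} /\ forall i g j, glob E Q i g j -> glob E' Q' i g j.

Lemma extends_trans V E Q V1 E1 Q1 V2 E2 Q2 : extends V E Q V1 E1 Q1 ->
  extends V1 E1 Q1 V2 E2 Q2 -> extends V E Q V2 E2 Q2.
Proof. by move=> [s1 h1] [s2 h2]; split=> [v /s1/s2|i g j /h1/h2]. Qed.

Lemma fresh V : exists n, forall b : bool, (b, n) \notin V.
Proof.
exists (sumn (map snd V)).+1 => b; apply/negP.
suff K v : v \in V -> (v.2 <= sumn (map snd V))%N by move/K; rewrite ltnn.
elim: V => //= u V IH; rewrite inE => /orP[/eqP->|/IH]; lia.
Qed.

Lemma grow_tie c V E Q i : graph c V E Q -> i \in V ->
  exists V' E' Q' j, [/\ graph c V' E' Q', extends V E Q V' E' Q', j \in V',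
    j.1 = ~~ i.1 & glob E' Q' i 1 j].
Proof.
move=> gr iV; have [n hn] := fresh V.
pose j : vertex := (~~ i.1, n); pose t : tie := if i.1 then (i, j) else (j, i).
have ext : extends V E Q (j :: V) E (t :: Q).
  split=> [v vV|]; first by rewrite inE vV orbT.
  apply: glob_sub => [i' g k dE|k l q]; first exact/glob_loc/loc_edge.
  by apply: glob_tie; rewrite inE q orbT.
have ij : glob E (t :: Q) i 1 j.
  have tQ : t \in t :: Q by rewrite inE eqxx.
  move: tQ; rewrite {1}/t; case: (i.1); first exact: glob_tie.
  by move/glob_tie/glob_sym; rewrite invg1.
exists (j :: V), E, (t :: Q), j; split; rewrite ?inE ?eqxx //; split.
- by rewrite /= hn (g_uniq gr).
- by rewrite inE (g_base gr) orbT.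
- by move=> k g l /(g_edge gr)[h1 h2 h3 h4]; rewrite !inE h1 h2 !orbT.
- move=> k l; rewrite inE => /orP[|/(g_tie gr)[h1 h2 h3 h4]]; last by rewrite !inE h1 h2 !orbT.
  rewrite /t; case ei : (i.1) => /eqP[-> ->]; rewrite !inE eqxx iV ?orbT; split=> //.
    by rewrite /j ei.
  by rewrite /j ei.
- move=> v; rewrite inE => /orP[/eqP->|/(g_con gr)[g /(ext.2)]]; last by exists g.
  have [g /(ext.2) hg] := g_con gr iV; exists (g * 1); exact: glob_trans hg ij.
- by have := g_count gr; rewrite /=; lia.
Qed.

Lemma grow_edge c V E Q i g : graph c V E Q -> i \in V -> H i.1 g ->
  exists V' E' Q' j, [/\ graph c V' E' Q', extends V E Q V' E' Q', j \in V' &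
    glob E' Q' i g j].
Proof.
move=> gr iV Hg; have [n hn] := fresh V.
pose j : vertex := (i.1, n).
have ext : extends V E Q (j :: V) ((i, g, j) :: E) Q.
  split=> [v vV|]; first by rewrite inE vV orbT.
  apply: glob_sub => [k h l dE|k l q]; last exact: glob_tie.
  by apply/glob_loc/loc_edge; rewrite inE dE orbT.
have ij : glob ((i, g, j) :: E) Q i g j by apply/glob_loc/loc_edge; rewrite inE eqxx.
exists (j :: V), ((i, g, j) :: E), Q, j; split; rewrite ?inE ?eqxx //; split.
- by rewrite /= hn (g_uniq gr).
- by rewrite inE (g_base gr) orbT.
- move=> k h l; rewrite inE => /orP[/eqP[-> -> ->]|/(g_edge gr)[h1 h2 h3 h4]].
    by rewrite !inE eqxx iV orbT.
  by rewrite !inE h1 h2 !orbT.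
- by move=> k l /(g_tie gr)[h1 h2 h3 h4]; rewrite !inE h1 h2 !orbT.
- move=> v; rewrite inE => /orP[/eqP->|/(g_con gr)[h /(ext.2)]]; last by exists h.
  have [h /(ext.2) hh] := g_con gr iV; exists (h * g); exact: glob_trans hh ij.
- by have := g_count gr; rewrite /=; lia.
Qed.

Lemma grow_path c V E Q i (l : seq (bool * G)) : graph c V E Q -> i \in V ->
  (forall p, p \in l -> H p.1 p.2) ->
  exists V' E' Q' j, [/\ graph c V' E' Q', extends V E Q V' E' Q', j \in V' &
    glob E' Q' i (gprod (map snd l)) j].
Proof.
elim: l V E Q i => [|p l IH] V E Q i gr iV hl.
  by exists V, E, Q, i; split=> //; [split|exact/glob_loc/loc_refl].
have [V1 [E1 [Q1 [j1 [gr1 ex1 j1V s1 ij1]]]]] :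
    exists V' E' Q' j, [/\ graph c V' E' Q', extends V E Q V' E' Q', j \in V',
    j.1 = p.1 & glob E' Q' i 1 j].
  have [e|ne] := eqVneq i.1 p.1.
    by exists V, E, Q, i; split=> //; [split|exact/glob_loc/loc_refl].
  have [V1 [E1 [Q1 [j1 [gr1 ex1 j1V s1 ij1]]]]] := grow_tie gr iV.
  exists V1, E1, Q1, j1; split=> //; rewrite s1.
  by case: (i.1) (p.1) ne => [] [].
have Hp : H j1.1 p.2 by rewrite s1; apply: hl; rewrite inE eqxx.
have [V2 [E2 [Q2 [j2 [gr2 ex2 j2V ij2]]]]] := grow_edge gr1 j1V Hp.
have [|V3 [E3 [Q3 [j3 [gr3 ex3 j3V ij3]]]]] := IH _ _ _ _ gr2 j2V.
  by move=> q ql; apply: hl; rewrite inE ql orbT.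
exists V3, E3, Q3, j3; split=> //; first exact: extends_trans (extends_trans ex1 ex2) ex3.
rewrite /= -[p.2]mul1g; apply: glob_trans ij3.
apply: glob_trans (ex3.2 _ _ _ ij2); exact/ex3.2/ex2.2.
Qed.

(** Growing a path adds a vertex with each edge or tie; only closing it costs one unit of Betti
    number. *)
Lemma grow_loop c V E Q (l : seq (bool * G)) : graph c V E Q ->
  (forall p, p \in l -> H p.1 p.2) ->
  exists V' E' Q', [/\ graph c.+1 V' E' Q', extends V E Q V' E' Q' &
    glob E' Q' base (gprod (map snd l)) base].
Proof.
move=> gr hl; have [V1 [E1 [Q1 [j [gr1 ex1 jV lj]]]]] := grow_path gr (g_base gr) hl.
have cnt := g_count gr1.
case ej : (j.1).
  have ext : extends V1 E1 Q1 V1 ((j, 1, base) :: E1) Q1.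
    split=> //; apply: glob_sub => [k h m dE|k m q]; last exact: glob_tie.
    by apply/glob_loc/loc_edge; rewrite inE dE orbT.
  exists V1, ((j, 1, base) :: E1), Q1; split; last first.
  - rewrite -[gprod _]mulg1; apply: glob_trans (ext.2 _ _ _ lj) _.
    by apply/glob_loc/loc_edge; rewrite inE eqxx.
  - exact: extends_trans ex1 ext.
  split; [exact: g_uniq gr1|exact: g_base gr1| |exact: g_tie gr1| |].
  - move=> k h m; rewrite inE => /orP[/eqP[-> -> ->]|/(g_edge gr1)//].
    by rewrite jV (g_base gr1) ej; split.
  - by move=> v /(g_con gr1)[h /ext.2]; exists h.
  - by rewrite /=; lia.
have ext : extends V1 E1 Q1 V1 E1 ((base, j) :: Q1).
  split=> //; apply: glob_sub => [k h m dE|k m q]; first exact/glob_loc/loc_edge.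
  by apply: glob_tie; rewrite inE q orbT.
exists V1, E1, ((base, j) :: Q1); split; last first.
- rewrite -[gprod _]mulg1 -invg1; apply: glob_trans (ext.2 _ _ _ lj) _.
  by apply: glob_sym; apply: glob_tie; rewrite inE eqxx.
- exact: extends_trans ex1 ext.
split; [exact: g_uniq gr1|exact: g_base gr1|exact: g_edge gr1| | |].
- move=> k m; rewrite inE => /orP[/eqP[-> ->]|/(g_tie gr1)//].
  by rewrite jV (g_base gr1) ej; split.
- by move=> v /(g_con gr1)[h /ext.2]; exists h.
- by rewrite /=; lia.
Qed.

Hypothesis Hgen : forall g, exists l : seq (bool * G),
  (forall p, p \in l -> H p.1 p.2) /\ g = gprod (map snd l).

Lemma initial_graph (xs : seq G) : exists V E Q, graph (size xs) V E Q /\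
  forall x, x \in xs -> glob E Q base x base.
Proof.
elim: xs => [|x xs [V [E [Q [gr h]]]]].
  exists [:: base], [::], [::]; split=> //; split=> //.
  by move=> v; rewrite inE => /eqP->; exists 1; exact/glob_loc/loc_refl.
have [l [hl ex]] := Hgen x.
have [V' [E' [Q' [gr' ext lx]]]] := grow_loop gr hl.
exists V', E', Q'; split=> // y; rewrite inE => /orP[/eqP->|/h/ext.2//].
by rewrite ex.
Qed.

Theorem grushko (xs : seq G) : (forall g, sg (labels B xs) g) ->
  (exists2 b, H false b & b <> 1) ->
  exists sa sb, [/\ (size sa + size sb <= size xs)%N,
    forall g, g \in sa -> H true g, forall g, g \in sb -> H false g,
    forall g, H true g -> sg (labels B sa) g &
    forall g, H false g -> sg (fun x => x \in sb) g].
Proof.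
move=> gen nb; have [V [E [Q [gr hx]]]] := initial_graph xs.
have all g : glob E Q base g base.
  elim: (gen g) => {g} [g [Bg|/hx//]||g h _ h1 _ h2|g _ /glob_sym//].
  - exact/glob_loc/loc_base.
  - exact/glob_loc/loc_refl.
  - exact: glob_trans h1 h2.
have [E' [Q' [gr' all' fo]]] := fold_all gr all.
exact: folded_conclusion gr' all' fo nb.
Qed.

End Grushko.

(** * Homomorphisms given on generators *)

Definition image (F G : groupType) (i : F -> G) : G -> Prop := fun g => exists x, g = i x.

Lemma sg_sub (G : groupType) (S S' : G -> Prop) g :
  (forall x, S x -> sg S' x) -> sg S g -> sg S' g.
Proof.
by move=> h; elim=> {g} [x /h//||x y _ h1 _ h2|x _ h1];
  [exact: sg1|exact: sgM|exact: sgV].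
Qed.

Lemma sg_hom_ex (G K : groupType) (f : {multiplicative G -> K}) (S : G -> Prop)
  (S' : K -> Prop) y : (forall x, S' x -> exists2 a, S a & f a = x) ->
  sg S' y -> exists2 a, sg S a & f a = y.
Proof.
move=> h; elim=> {y} [x /h[a Sa <-]||x y _ [a sa <-] _ [b sb <-]|x _ [a sa <-]].
- by exists a => //; exact: sg_in.
- by exists 1; [exact: sg1|exact: hom1].
- by exists (a * b); [exact: sgM|exact: gmulfM].
- by exists a^-1; [exact: sgV|exact: homV].
Qed.

Lemma sg_eq_hom (G K : groupType) (f f' : {multiplicative G -> K}) (S : G -> Prop) g :
  (forall x, S x -> f x = f' x) -> sg S g -> f g = f' g.
Proof.
move=> h; elim=> {g} [x /h//||x y _ h1 _ h2|x _ h1].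
- by rewrite !hom1.
- by rewrite !gmulfM h1 h2.
- by rewrite !homV h1.
Qed.

Lemma sg_image (F G : groupType) (i : {multiplicative F -> G}) g :
  sg (image i) g -> image i g.
Proof.
elim=> {g} [x //||x y _ [a ->] _ [b ->]|x _ [a ->]].
- by exists 1; rewrite hom1.
- by exists (a * b); rewrite gmulfM.
- by exists a^-1; rewrite homV.
Qed.

Lemma generates_sg (G : groupType) (s : seq G) :
  generates s <-> forall g, sg (fun x => x \in s) g.
Proof.
split=> [gen g|gen K K1 KM KV Ks g].
  by apply: (gen (sg _)) => [|x y|x|x]; [exact: sg1|exact: sgM|exact: sgV|exact: sg_in].
by elim: (gen g) => {g} [x /Ks//||x y _ h1 _ h2|x _ h1]; [|exact: KM|exact: KV].
Qed.

Lemma hom_inverse (G K : groupType) (f : {multiplicative G -> K}) :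
  injective f -> (forall y, exists x, f x = y) ->
  exists g : {multiplicative K -> G}, cancel f g /\ cancel g f.
Proof.
move=> inj /choice[g fg].
have gM : {morph g : x y / x * y}.
  by move=> x y; apply: inj; rewrite gmulfM !fg.
exists (mk_hom gM); split=> x; last exact: fg.
by apply: inj; exact: fg.
Qed.

(* A homomorphism out of G is given by a subgroup of G x K meeting 1 x K
   trivially. *)
Lemma hom_of_graph (G K : groupType) (S : (G * K)%type -> Prop) :
  (forall g, exists k, sg S (g, k)) -> (forall k, sg S (1, k) -> k = 1) ->
  exists h : {multiplicative G -> K}, forall g k, S (g, k) -> h g = k.
Proof.
move=> /choice[h hS] S1.
have U g k k' : sg S (g, k) -> sg S (g, k') -> k = k'.
  move=> h1 /sgV h2; apply/divg1_eq/S1.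
  rewrite -(mulgV g) -[(g / g, k / k')]/((g, k) * (g, k')^-1 : (G * K)%type).
  exact: sgM.
have hM : {morph h : x y / x * y}.
  move=> x y; apply: (U (x * y)); first exact: hS.
  exact: (sgM (hS x) (hS y)).
exists (mk_hom hM) => g k Sgk; apply: (U g); [exact: hS|exact: sg_in].
Qed.

(** * Words in a free product *)

Section FreeProductGenerated.
Variables (A B G : groupType) (iA : {multiplicative A -> G}) (iB : {multiplicative B -> G}).
Hypothesis AB : is_free_product iA iB.

Definition letter_val (l : A + B) : G := match l with inl a => iA a | inr b => iB b end.

Lemma act_val l w : gprod (map letter_val (act l w)) = letter_val l * gprod (map letter_val w).
Proof.
case: l => x; case: w => [|[y|y] w]; rewrite /act /=; case: eqP => [e|_] //=;
  rewrite ?e ?hom1 ?mul1g // ?gmulfM ?mulgA //.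
- by rewrite -gmulfM e hom1 mul1g.
- by rewrite -gmulfM e hom1 mul1g.
Qed.

Lemma word_valM :
  {morph (fun x : free_product A B => gprod (map letter_val (val x))) : x y / x * y}.
Proof.
move=> x y /=; elim: (val x) => [|l w IH] /=; first by rewrite mul1g.
by rewrite act_val IH mulgA.
Qed.

(** Evaluation of concrete words composed with [th] fixes both factors, so it is the identity by
    uniqueness. *)
Lemma free_product_word g : exists l : seq (bool * G),
  (forall p, p \in l -> factor iA iB p.1 p.2) /\ g = gprod (map snd l).
Proof.
have [th [thA thB]] := free_product_words AB.
pose e := mk_hom word_valM.
have eA a : e (fp_letter (inl a)) = iA a.
  rewrite -[LHS]/(gprod (map letter_val (act (inl a) [::]))) act_val /= mulg1 //.
have eB b : e (fp_letter (inr b)) = iB b.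
  rewrite -[LHS]/(gprod (map letter_val (act (inr b) [::]))) act_val /= mulg1 //.
have [_ U] := AB iA iB.
have -> : g = hcomp e th g.
  by apply: (U (hid G)) => x; rewrite ?hidE // hcompE ?thA ?thB ?eA ?eB.
exists [seq (side l, letter_val l) | l <- val (th g)]; split.
  by move=> p /mapP[[x|x] _ ->] /=; exists x.
by rewrite hcompE -[LHS]/(gprod (map letter_val (val (th g)))) -map_comp.
Qed.

Lemma free_product_sg g : sg (fun x => image iA x \/ image iB x) g.
Proof.
have [l [hl ->]] := free_product_word g; elim: l hl => [|p l IH] hl; first exact: sg1.
apply: sgM.
  have := hl p; rewrite inE eqxx => /(_ isT); case: (p.1) => -[x <-]; apply: sg_in.
    by left; exists x.
  by right; exists x.
by apply: IH => q ql; apply: hl; rewrite inE ql orbT.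
Qed.

Lemma free_product_bijl (F : groupType) (i : {multiplicative F -> A}) :
  injective i -> (forall a, exists x, i x = a) -> is_free_product (hcomp iA i) iB.
Proof.
move=> inj /(hom_inverse inj)[j [ij ji]] K f g.
have [[h [hA hB]] U] := AB (hcomp f j) g; split.
  by exists h; split=> // x; rewrite hcompE hA hcompE ij.
move=> h1 h2 e1 e2 e3 e4; apply: U => // a; rewrite hcompE.
  by rewrite -e1 hcompE ji.
by rewrite -e3 hcompE ji.
Qed.

End FreeProductGenerated.

(** * Free groups given by a basis *)

Section FreeBasis.
Variables (I : finType) (L : groupType) (b : I -> L).
Hypothesis bL : is_free_basis b.

Lemma free_basis_iso : exists (f : {multiplicative L -> free_group I})
  (g : {multiplicative free_group I -> L}),
  [/\ cancel f g, cancel g f & forall i, g (gen (i, true)) = b i].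
Proof.
have [[f fb] _] := bL (fun i => gen (i, true)).
have gb i : lift b (gen (i, true)) = b i by rewrite lift_gen.
exists f, (lift b); split=> // x.
  have [_ U] := bL b.
  by apply: (U (hcomp (lift b) f) (hid L)) => // i; rewrite ?hidE // hcompE fb gb.
have := @hom_ext I _ (hcomp f (lift b)) (hid _); apply=> i.
by rewrite hcompE gb fb hidE.
Qed.

Lemma free_group_sg (x : free_group I) : sg (fun y => exists i, y = gen (i, true)) x.
Proof.
elim/fg_ind: x => [|[i s] x _ IH]; first exact: sg1.
apply: sgM => //; case: s; first by apply: sg_in; exists i.
by rewrite -[gen _]invgK genV; apply: sgV; apply: sg_in; exists i.
Qed.

Lemma free_basis_sg x : sg (fun y => exists i, y = b i) x.
Proof.
have [f [g [fg _ gb]]] := free_basis_iso; rewrite -(fg x).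
elim: (free_group_sg (f x)) => {x} [_ [i ->]||x y _ h1 _ h2|x _ h1].
- by rewrite gb; apply: sg_in; exists i.
- by rewrite hom1; exact: sg1.
- by rewrite gmulfM; exact: sgM.
- by rewrite homV; exact: sgV.
Qed.

End FreeBasis.

(** * Discriminating retractions *)

Section Discriminating.
Variables (F A : groupType) (iota : {multiplicative F -> A}).
Hypothesis res : fully_residually iota.

(** The retractions injective on a finite [s] form a filter base, since those for [s ++ t] serve
    both [s] and [t]. *)
Lemma discriminating_ultrafilter : exists U : set_system {multiplicative A -> F},
  UltraFilter U /\ forall s : seq A,
    U (fun h => (forall x, h (iota x) = x) /\ {in s &, injective h}).
Proof.
pose Y (s : seq A) (h : {multiplicative A -> F}) :=
  (forall x, h (iota x) = x) /\ {in s &, injective h}.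
pose B : set_system {multiplicative A -> F} := fun P => exists s, forall h, Y s h -> P h.
have pB : ProperFilter B.
  split.
    by case=> s h; have [k [k1 k2]] := res s; apply: (h k).
  split.
  - by exists [::].
  - move=> P Q [s hs] [t ht]; exists (s ++ t) => h [h1 h2]; split.
      by apply: hs; split=> // x y xs ys; apply: h2; rewrite mem_cat ?xs ?ys.
    by apply: ht; split=> // x y xs ys; apply: h2; rewrite mem_cat ?xs ?ys orbT.
  - by move=> P Q PQ [s hs]; exists s => h /hs; exact: PQ.
have [U [UU BU]] := ultraFilterLemma pB.
by exists U; split=> // s; apply: BU; exists s.
Qed.

Lemma discriminating_iota_inj : injective iota.
Proof. by have [h [h1 _]] := res [::]; exact: can_inj h1. Qed.

End Discriminating.

(** * Reduced words over F and one more element *)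

Definition adjoin (F G : groupType) (i : F -> G) (t : G) : G -> Prop :=
  fun x => image i x \/ x = t.

Section Words.
Variables (F G K : groupType) (i : F -> G) (h : {multiplicative G -> K}).

Lemma wval_hom t w : h (wval i t w) = wval (h \o i) (h t) w.
Proof.
elim: w => [|[e u] w IH] /=; first exact: hom1.
by rewrite !gmulfM IH; case: e; rewrite /= ?homV.
Qed.

End Words.

Lemma eq_wval (F G : groupType) (i j : F -> G) t w : i =1 j -> wval i t w = wval j t w.
Proof. by move=> e; elim: w => //= p w ->; rewrite e. Qed.

(** Left multiplication by each generator and its inverse preserves the reduced shape. This property
    passes to products but not visibly to inverses, so it is proved for [g] and [g^-1] together. *)
Lemma wval_nf (F M : groupType) (i : {multiplicative F -> M}) (t g : M) :
  sg (adjoin i t) g -> exists u w, wred w /\ g = i u * wval i t w.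
Proof.
pose P g := forall u w, wred w -> exists u' w', wred w' /\
  g * (i u * wval i t w) = i u' * wval i t w'.
have Pt e : P (sgn e t).
  move=> u [|[e' u'] w] rw.
    by exists 1, [:: (e, u)]; rewrite hom1 /= !gnorm.
  have [->|nu] := eqVneq u 1; last first.
    by exists 1, [:: (e, u), (e', u') & w]; rewrite hom1 /= nu !gnorm.
  have [ee|ne] := eqVneq e e'.
    exists 1, [:: (e, 1), (e', u') & w]; rewrite ee; split.
      by rewrite /wred /= eqxx orbT.
    by rewrite /= !hom1 !gnorm.
  exists u', w; rewrite hom1 /= mul1g; split; first exact: path_sorted rw.
  by case: e e' ne {rw} => [] [] //= _; rewrite !gnorm.
have Pi f : P (i f).
  by move=> u w rw; exists (f * u), w; rewrite gmulfM mulgA.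
have PM x y : P x -> P y -> P (x * y).
  move=> px py u w rw; have [u1 [w1 [r1 e1]]] := py u w rw.
  by have [ultra2 [w2 [r2 e2]]] := px u1 w1 r1; exists ultra2, w2; rewrite -mulgA e1.
suff K : sg (adjoin i t) g -> P g /\ P g^-1.
  move=> /K[Pg _]; have [//|u [w [rw e]]] := Pg 1 [::].
  by exists u, w; split=> //; rewrite -e hom1 !mulg1.
elim=> {g} [_ [[f ->]| ->]||x y _ [h1 h2] _ [h3 h4]|x _ [h1 h2]].
- by rewrite -homV; split; exact: Pi.
- by split; [exact: (Pt true)|exact: (Pt false)].
- by rewrite invg1 -(hom1 i); split; exact: Pi.
- by rewrite invgM; split; exact: PM.
- by rewrite invgK.
Qed.

Section AmalgamWords.
Notation Z := (free_group unit).
Notation z0 := (gen (tt, true) : Z).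

(** Exponents live in the free group on one generator, so powers of either sign are treated
    alike. *)
Definition pw (G : groupType) (x : G) : {multiplicative Z -> G} := lift (fun _ : unit => x).

Lemma pw_gen (G : groupType) (x : G) : pw x z0 = x.
Proof. exact: lift_gen. Qed.

Lemma pw_hom (G K : groupType) (h : {multiplicative G -> K}) x z : h (pw x z) = pw (h x) z.
Proof.
by have := @hom_ext unit K (hcomp h (pw x)) (pw (h x)); apply=> -[]; rewrite hcompE !pw_gen.
Qed.

Lemma pw_cyc (G : groupType) (x : G) z : cyc x (pw x z).
Proof.
rewrite -{1}(pw_gen x); apply: cyc_hom.
by elim: (free_group_sg z) => {z} [_ [[] ->]||y z _ h1 _ h2|y _ h1];
  [exact: cyc_refl|exact: sg1|exact: sgM|exact: sgV].
Qed.

Lemma Z_cyc z : cyc z0 z.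
Proof.
by elim: (free_group_sg z) => {z} [_ [[] ->]||y z _ h1 _ h2|y _ h1];
  [exact: cyc_refl|exact: sg1|exact: sgM|exact: sgV].
Qed.

Lemma pw_len (F : groupType) (T : tree_length F) (x : F) z : z <> 1 ->
  (len T x <= len T (pw x z))%N.
Proof.
move=> z1; have [->|/eqP x1] := eqVneq x 1; first by rewrite tl_len1.
case/cycP: (Z_cyc z) => n ez.
have -> : len T (pw x z) = len T (x ^+ n).
  by case: ez => ->; rewrite ?homV ?homX pw_gen ?tl_lenV.
case: n ez => [|n] ez; last by have := len_pow T n x1; lia.
by case: z1; case: ez => ->; rewrite ?invg1.
Qed.

Definition aval (F G : groupType) (i : F -> G) (r : G) (w : seq (Z * F)) : G :=
  foldr (fun p x => pw r p.1 * i p.2 * x) 1 w.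

Definition ared (F : groupType) (c : F) (w : seq (Z * F)) :=
  all (fun p => p.1 != 1) w && sorted (fun p q => p.2 * c != c * p.2) w.

Lemma aval_hom (F G K : groupType) (i : F -> G) (h : {multiplicative G -> K}) r w :
  h (aval i r w) = aval (h \o i) (h r) w.
Proof.
by elim: w => [|p w IH] /=; rewrite ?hom1 // !gmulfM IH pw_hom.
Qed.

Lemma eq_aval (F G : groupType) (i j : F -> G) t w : i =1 j -> aval i t w = aval j t w.
Proof. by move=> e; elim: w => //= p w ->; rewrite e. Qed.

(** These are the normal forms of the amalgam of F and <c> x <r>: a coefficient that commutes with
    [c] is a power of [c], moves left past [r], and lets two powers of [r] merge. *)
Lemma aval_nf (F M : groupType) (i : {multiplicative F -> M}) (r g : M) (c : F) :
  commute r (i c) -> (forall v, commute v c -> cyc c v) ->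
  sg (adjoin i r) g -> exists u w, ared c w /\ g = i u * aval i r w.
Proof.
move=> rc Cc.
pose P g := forall u w, ared c w -> exists u' w', ared c w' /\
  g * (i u * aval i r w) = i u' * aval i r w'.
have Pt z : P (pw r z).
  move=> u w rw; have [->|z1] := eqVneq z 1.
    by exists u, w; rewrite hom1 mul1g.
  case: w rw => [|[z' u'] w] rw.
    by exists 1, [:: (z, u)]; rewrite hom1 /ared /= z1 !gnorm.
  have [cu|ncu] := eqVneq (u * c) (c * u); last first.
    exists 1, [:: (z, u), (z', u') & w]; rewrite hom1 /= !gnorm; split=> //.
    by move: rw; rewrite /ared /= z1 ncu.
  have com : pw r z * i u = i u * pw r z.
    have /cycP[n en] := Cc _ cu.
    apply: commute_sym; suff ui : commute (i u) r.
      by case/cycP: (pw_cyc r z) => m [] ->; [exact: commuteX|exact/commuteV/commuteX].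
    by apply: commute_sym; case: en => ->; rewrite ?homV homX;
      [exact: commuteX|exact/commuteV/commuteX].
  have e : pw r z * (i u * aval i r ((z', u') :: w)) = i u * (pw r (z * z') * i u' * aval i r w).
    rewrite -[aval i r (_ :: _)]/(pw r z' * i u' * aval i r w).
    by rewrite gmulfM !mulgA com.
  rewrite e; have rw' : ared c w.
    by move: rw; rewrite /ared /= => /andP[/andP[_ ->] /path_sorted ->].
  have [->|zz] := eqVneq (z * z') 1.
    by exists (u * u'), w; rewrite hom1 gmulfM !gnorm.
  exists u, ((z * z', u') :: w); split=> //.
  by move: rw; rewrite /ared /= zz => /andP[/andP[_ ->]]; case: (w).
have Pi f : P (i f).
  by move=> u w rw; exists (f * u), w; rewrite gmulfM mulgA.
have PM x y : P x -> P y -> P (x * y).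
  move=> px py u w rw; have [u1 [w1 [r1 e1]]] := py u w rw.
  by have [ultra2 [w2 [r2 e2]]] := px u1 w1 r1; exists ultra2, w2; rewrite -mulgA e1.
suff K : sg (adjoin i r) g -> P g /\ P g^-1.
  move=> /K[Pg _]; have [//|u [w [rw e]]] := Pg 1 [::].
  by exists u, w; split=> //; rewrite -e hom1 !mulg1.
elim=> {g} [_ [[f ->]| ->]||x y _ [h1 h2] _ [h3 h4]|x _ [h1 h2]].
- by rewrite -homV; split; exact: Pi.
- by rewrite -{1 2}(pw_gen r) -homV; split; exact: Pt.
- by rewrite invg1 -(hom1 i); split; exact: Pi.
- by rewrite invgM; split; exact: PM.
- by rewrite invgK.
Qed.

End AmalgamWords.

Section Extension.
Variables (F A K : groupType) (iota : {multiplicative F -> A}) (t : A).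
Variables (f : {multiplicative F -> K}) (k : K).

Lemma pair_homM : {morph (fun x => (iota x, f x)) : x y / x * y}.
Proof. by move=> x y; rewrite !gmulfM. Qed.

Definition pair_hom : {multiplicative F -> (A * K)%type} := mk_hom pair_homM.

Lemma fst_homM : {morph (fun x : (A * K)%type => x.1) : x y / x * y}.
Proof. by []. Qed.

Definition fst_hom : {multiplicative (A * K)%type -> A} := mk_hom fst_homM.

Lemma extend_hom : (forall g, sg (adjoin iota t) g) ->
  (forall p, sg (adjoin pair_hom (t, k)) p -> p.1 = 1 -> p.2 = 1) ->
  exists h : {multiplicative A -> K}, (forall x, h (iota x) = f x) /\ h t = k.
Proof.
move=> gen triv.
have [||h hS] := @hom_of_graph A K (adjoin pair_hom (t, k)).
- move=> g; elim: (gen g) => {g} [_ [[x ->]| ->]||x y _ [a ha] _ [b hb]|x _ [a ha]].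
  + by exists (f x); apply: sg_in; left; exists x.
  + by exists k; apply: sg_in; right.
  + by exists 1; exact: sg1.
  + by exists (a * b); exact: (sgM ha hb).
  + by exists a^-1; exact: (sgV ha).
- by move=> a /triv; apply.
by exists h; split=> [x|]; apply: hS; [left; exists x|right].
Qed.

End Extension.

(** * Extensions by one generator *)

Section Classify.
Variables (I : finType) (A : groupType).
Notation F := (free_group I).
Notation T := (fg_tree I).
Variables (iota : {multiplicative F -> A}).
Hypothesis res : fully_residually iota.

Definition no_relation (t : A) := forall p w f, wred (p :: w) -> wval iota t (p :: w) <> iota f.

(* c generates its own centralizer, r commutes with c, and products
   r^n1 u1 ... r^nk uk with nj <> 0 and uj outside <c> are nontrivial. *)
Definition axis_extension (r : A) (c : F) :=
  [/\ c <> 1, forall v, commute v c <-> cyc c v, commute r (iota c) &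
    forall p w f, ared c (p :: w) -> aval iota r (p :: w) <> iota f].

(** Bounded values put [t] into F. Otherwise a relation puts [f t g] on an axis;
    [r = iota f * t * iota g] replaces [t] as generator, and its reduced words are chains, hence
    unbounded. *)
Lemma one_generator_cases t : (forall g, sg (adjoin iota t) g) ->
  [\/ forall g, exists f, iota f = g, no_relation t |
    exists r c, (forall g, sg (adjoin iota r) g) /\ axis_extension r c].
Proof.
move=> gen; have [nr|rel] := pselect (no_relation t); first by apply: Or32.
have [U [UU hU]] := discriminating_ultrafilter res.
have retr : U (fun h : {multiplicative A -> F} => forall x, h (iota x) = x).
  by apply: (ultra_mono UU) (hU [::]) => h [].
(* Distinct elements are eventually separated, so identities that hold along [U] descend to [A]. *)
have eqU (a b : A) : U (fun h : {multiplicative A -> F} => h a = h b) -> a = b.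
  move=> e; have [h [e1 [_ inj]]] := ultra_ex UU (ultra_and UU e (hU [:: a; b])).
  by apply: inj e1; rewrite !inE eqxx ?orbT.
pose tau (h : {multiplicative A -> F}) := h t.
have [ti|/(not_inf UU (T := T))[f hf]] := pselect (inf U T tau); last first.
  apply: Or31 => g.
  have et : t = iota f by apply: eqU; apply: (ultra2 UU) hf retr => h e hr; rewrite hr; exact: e.
  have [f' ->] : image iota g.
    apply: sg_image; apply: sg_sub (gen g) => x [h| ->]; first exact: sg_in.
    by apply: sg_in; exists f.
  by exists f'.
apply: Or33.
have rel' : satisfies_relation U tau.
  move/existsNP: rel => [p /existsNP[w /existsNP[f /not_implyP[rw /contrapT e]]]].
  exists p, w, f; split=> //; apply: (ultra_mono UU) retr => h hr.
  transitivity (h (wval iota t (p :: w))); last by rewrite e hr.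
  by rewrite wval_hom; apply: eq_wval => x; rewrite /= hr.
have [f [g [c0 [c01 hc0]]]] := one_variable UU ti rel'.
(* Passing to the generator of the centralizer of [c0] makes every element commuting with [c] a
   power of [c], as the normal form requires. *)
have [c c1 Cc] := centralizer T c01.
have CC v : commute v c <-> cyc c v.
  split=> [vc|vc]; last by apply: cyc_commute vc _; exact: cyc_refl.
  apply/Cc; have /cycP[n [] ->] : cyc c c0 by apply/Cc.
    exact: commuteX.
  exact/commuteV/commuteX.
pose r := iota f * t * iota g.
have hrE : U (fun h : {multiplicative A -> F} => h r = f * tau h * g).
  by apply: (ultra_mono UU) retr => h hr; rewrite !gmulfM !hr.
have rc : U (fun h : {multiplicative A -> F} => commute (h r) c).
  by apply: (ultra2 UU) hc0 hrE => h + -> => /Cc/CC.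
have ri : inf U T (fun h : {multiplicative A -> F} => h r).
  have := inf_mulr UU g (inf_mull UU f ti).
  by move=> hi M; apply: (ultra2 UU) (hi M) hrE => h + ->.
exists r, c; split.
  move=> a; apply: sg_sub (gen a) => x [h| ->]; first by apply: sg_in; left.
  have -> : t = (iota f)^-1 * r * (iota g)^-1 by rewrite /r !gnorm.
  by apply: sgM; [apply: sgM; [apply: sgV|]|apply: sgV]; apply: sg_in;
    [left; exists f|right|left; exists g].
split=> //.
  apply: eqU; apply: (ultra2 UU) retr rc => h hr e.
  by rewrite [LHS]gmulfM [RHS]gmulfM hr; exact: e.
move=> p w u rw e.
suff ch : chain U T c (fun h : {multiplicative A -> F} => aval id (h r) (p :: w)).
  apply: (inf_not_const UU (f := u) (chain_inf UU ch)).
  apply: (ultra_mono UU) retr => h hr; rewrite -[u in RHS]hr -e aval_hom.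
  by apply: eq_aval => x; rewrite /= hr.
have pi z : z != 1 -> inf U T (fun h : {multiplicative A -> F} => pw (h r) z).
  move=> /eqP z1 M; apply: (ultra_mono UU) (ri M) => h lt.
  exact: leq_trans lt (pw_len T (h r) z1).
have pc z : U (fun h : {multiplicative A -> F} => commute (pw (h r) z) c).
  apply: (ultra_mono UU) rc => h hc; apply: commute_sym.
  by case/cycP: (pw_cyc (h r) z) => m [] ->;
    [|apply: commuteV]; apply: commuteX; exact: commute_sym.
elim: w p rw {e} => [|q w IH] [z v] rw.
  apply: (chain0 c1 (pi z _) (pc z) (g := v)); first by case/andP: rw => /andP[].
  by apply: (ultra_all UU) => h; rewrite /= mulg1.
move: rw; rewrite /ared /= => /andP[/andP[z1 al] /andP[ncv so]].
apply: (chainS c1 (pi z z1) (pc z) (g := v) (c' := c) _ (IH q _)).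
- by apply: (noncommute_conj T) => /eqP; apply/negP.
- by rewrite /ared /= al.
- exact: (ultra_all UU).
Qed.

(** This yields the universal property of F * <t>. In the direct product an element with trivial
    first component has an empty reduced word, so the generated subgroup is a graph. *)
Lemma no_relation_extend t (K : groupType) (f : {multiplicative F -> K}) (k : K) :
  (forall g, sg (adjoin iota t) g) -> no_relation t ->
  exists h : {multiplicative A -> K}, (forall x, h (iota x) = f x) /\ h t = k.
Proof.
move=> gen nr; apply: extend_hom => // p /wval_nf[u [w [rw ->]]].
case: w rw => [|q w] rw.
  rewrite /= !mulg1 => e; have -> : u = 1.
    by apply: (discriminating_iota_inj res); rewrite e hom1.
  by rewrite hom1.
move=> e; case: (nr q w u^-1 rw); rewrite homV; apply/esym/mulg1_eq.
have := e; rewrite -[(_ * _).1]/(fst_hom _ _ (_ * _)) gmulfM wval_hom => <-.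
by congr (_ * _).
Qed.

Lemma axis_extend r c (K : groupType) (f : {multiplicative F -> K}) (k : K) :
  (forall g, sg (adjoin iota r) g) -> axis_extension r c -> commute k (f c) ->
  exists h : {multiplicative A -> K}, (forall x, h (iota x) = f x) /\ h r = k.
Proof.
move=> gen [c1 Cc rc nr] kc; apply: extend_hom => // p.
have rkc : commute ((r, k) : (A * K)%type) (pair_hom iota f c).
  by rewrite /commute /mul /= /mul_pair /= rc kc.
move=> /(aval_nf rkc (fun v => (Cc v).1)) [u [w [rw ->]]].
case: w rw => [|q w] rw.
  rewrite /= !mulg1 => e; have -> : u = 1.
    by apply: (discriminating_iota_inj res); rewrite e hom1.
  by rewrite hom1.
move=> e; case: (nr q w u^-1 rw); rewrite homV; apply/esym/mulg1_eq.
have := e; rewrite -[(_ * _).1]/(fst_hom _ _ (_ * _)) gmulfM aval_hom => <-.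
by congr (_ * _).
Qed.

End Classify.

(** * Infinite cyclic and free abelian groups *)

Notation Z := (free_group unit).
Notation z0 := (gen (tt, true) : Z).

Lemma Z_infinite_cyclic : is_infinite_cyclic z0.
Proof.
split=> [g|n]; first exact/cycP/Z_cyc.
by move/(torsion_free (fg_tree _))/(congr1 val).
Qed.

Lemma Z_abelian : is_abelian Z.
Proof. by move=> x y; apply: cyc_commute (Z_cyc x) (Z_cyc y). Qed.

Lemma pw_inj (G : groupType) (z : G) : (forall n, z ^+ n.+1 <> 1) -> injective (pw z).
Proof.
move=> tf; apply: hom_inj => x; case/cycP: (Z_cyc x) => -[|n] [] ->;
  rewrite ?invg1 // ?homV homX pw_gen; first by move/tf.
by move/(congr1 inv); rewrite invgK invg1 => /tf.
Qed.

Lemma infinite_cyclic_extend (B K : groupType) (z : B) (k : K) : is_infinite_cyclic z ->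
  exists h : {multiplicative B -> K}, h z = k.
Proof.
case=> gen tf; have [|j [ij ji]] := hom_inverse (pw_inj tf).
  by move=> y; have := gen y => /cycP; rewrite -{1}(pw_gen z) => /cyc_hom_ex[x _ <-]; exists x.
by exists (hcomp (pw k) j); rewrite hcompE -{1}(pw_gen z) ij pw_gen.
Qed.

Lemma pairM (Z1 Z2 K : groupType) (f : {multiplicative Z1 -> K}) (g : {multiplicative Z2 -> K}) :
  (forall x y, commute (f x) (g y)) ->
  {morph (fun p : (Z1 * Z2)%type => f p.1 * g p.2) : x y / x * y}.
Proof.
move=> com [x1 x2] [y1 y2] /=; rewrite !gmulfM !mulgA.
by rewrite -[f x1 * g x2 * f y1]mulgA -com mulgA.
Qed.

Lemma pair_inlM (Z1 Z2 : groupType) : {morph (fun x : Z1 => (x, 1 : Z2)) : x y / x * y}.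
Proof. by move=> x y; rewrite [RHS]/mul /= /mul_pair /= mulg1. Qed.

Lemma pair_inrM (Z1 Z2 : groupType) : {morph (fun x : Z2 => (1 : Z1, x)) : x y / x * y}.
Proof. by move=> x y; rewrite [RHS]/mul /= /mul_pair /= mulg1. Qed.

Definition pair_inl (Z1 Z2 : groupType) : {multiplicative Z1 -> (Z1 * Z2)%type} :=
  mk_hom (@pair_inlM Z1 Z2).

Definition pair_inr (Z1 Z2 : groupType) : {multiplicative Z2 -> (Z1 * Z2)%type} :=
  mk_hom (@pair_inrM Z1 Z2).

Lemma pairE (Z1 Z2 : groupType) (p : (Z1 * Z2)%type) : p = pair_inl Z1 Z2 p.1 * pair_inr Z1 Z2 p.2.
Proof. by case: p => x y; rewrite [RHS]/mul /= /mul_pair /= mulg1 mul1g. Qed.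

Definition ab_basis (i : 'I_2) : (Z * Z)%type :=
  if i == ord0 then pair_inl Z Z z0 else pair_inr Z Z z0.

Lemma Z_hom_ext (K : groupType) (h h' : {multiplicative Z -> K}) : h z0 = h' z0 -> h =1 h'.
Proof. by move=> e; apply: hom_ext => -[]. Qed.

Lemma ab_basisP : is_free_abelian_basis ab_basis.
Proof.
split=> [[x1 x2] [y1 y2]|K f abK].
  by rewrite /mul /= /mul_pair /= (Z_abelian x1) (Z_abelian x2).
split=> [|h h' e e' p].
  have com x y : commute (pw (f ord0) x) (pw (f ord_max) y) by exact: abK.
  exists (mk_hom (pairM com)) => i; rewrite /ab_basis.
  have [->|ni] := eqVneq i ord0.
    by rewrite -[LHS]/(pw _ z0 * pw _ 1) hom1 mulg1 pw_gen.
  rewrite -[LHS]/(pw _ 1 * pw _ z0) hom1 mul1g pw_gen.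
  by congr f; apply: val_inj; case: i ni => [[|[|]]].
rewrite (pairE p) [LHS]gmulfM [RHS]gmulfM; congr (_ * _).
  apply: (@Z_hom_ext _ (hcomp h (pair_inl Z Z)) (hcomp h' (pair_inl Z Z))).
  by rewrite !hcompE; rewrite (_ : pair_inl Z Z z0 = ab_basis ord0) // e e'.
apply: (@Z_hom_ext _ (hcomp h (pair_inr Z Z)) (hcomp h' (pair_inr Z Z))).
by rewrite !hcompE; rewrite (_ : pair_inr Z Z z0 = ab_basis ord_max) // e e'.
Qed.

Lemma free_product_eq (A A' B G : groupType) (iA : {multiplicative A -> G})
  (iA' : {multiplicative A' -> G}) (iB : {multiplicative B -> G})
  (j : {multiplicative A' -> A}) :
  is_free_product iA iB -> injective j -> (forall a, exists x, j x = a) ->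
  (forall x, iA (j x) = iA' x) -> is_free_product iA' iB.
Proof.
move=> AB inj sur e K f g; have [[h [h1 h2]] U] := free_product_bijl AB inj sur f g.
split; first by exists h; split=> // x; rewrite -e -h1 hcompE.
by move=> k k' e1 e2 e3 e4; apply: U => // x; rewrite hcompE e.
Qed.

Lemma bool_free_group_rank2 : has_rank (free_group bool) 2.
Proof.
split.
  exists [:: gen (true, true); gen (false, true)]; split=> //.
  apply/generates_sg => g; apply: sg_sub (free_group_sg g) => _ [[] ->]; apply: sg_in;
    by rewrite !inE eqxx ?orbT.
move=> s us /generates_sg gs.
case: s us gs => [|x [|y s]] // _ gs.
  have : gen (true, true) = 1 :> free_group bool; last by move/(congr1 val).
  by elim: (gs (gen (true, true))) => // [a b _ -> _ ->|a _ ->]; rewrite ?mulg1 ?invg1.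
have c g : cyc x g.
  by apply: sg_sub (gs g) => y; rewrite inE => /eqP->; exact: cyc_refl.
by have /(congr1 val) := cyc_commute (c (gen (true, true))) (c (gen (false, true))).
Qed.

Lemma rank2 (B : groupType) (s : seq B) : size s = 2 -> (forall b, sg (fun x => x \in s) b) ->
  ~ (exists z, forall b : B, cyc z b) -> has_rank B 2.
Proof.
move=> ss gs nc; split.
  exists s; split=> //; last exact/generates_sg.
  case: s ss gs => [|x [|y []]] //= _ gs; rewrite andbT inE.
  apply/eqP => xy; apply: nc; exists x => b; apply: sg_sub (gs b) => c.
  by rewrite !inE -xy orbb => /eqP->; exact: cyc_refl.
move=> [|x [|y t]] // _ /generates_sg gt; exfalso; apply: nc.
  by exists 1 => b; apply: sg_sub (gt b).
exists x => b; apply: sg_sub (gt b) => y; rewrite inE => /eqP->; exact: cyc_refl.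
Qed.

(** * The three forms of G *)

Section Assembly.
Variables (I : finType) (A B G : groupType).
Notation F := (free_group I).
Variables (iota : {multiplicative F -> G}) (iA : {multiplicative A -> G})
  (iB : {multiplicative B -> G}) (iotaA : {multiplicative F -> A}).
Hypothesis res : fully_residually iota.
Hypothesis AB : is_free_product iA iB.
Hypothesis iotaAE : forall x, iA (iotaA x) = iota x.

Lemma factor_residually : fully_residually iotaA.
Proof.
move=> s; have [h [h1 h2]] := res (map iA s).
exists (hcomp h iA); split=> [a|a b sa sb e]; first by rewrite hcompE iotaAE.
by apply: (free_product_injl AB); apply: h2; rewrite ?map_f.
Qed.

Lemma second_factor_residually_free : fully_residually_free B.
Proof.
move=> s; have [h [h1 h2]] := res (map iB s).
exists I, F, (fun i => gen (i, true)), (hcomp h iB); split; first exact: gen_free_basis.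
by move=> a b sa sb e; apply: (free_product_injr AB); apply: h2; rewrite ?map_f.
Qed.

Lemma second_factor_infinite_cyclic (z : B) : (forall b : B, cyc z b) -> (exists b : B, b <> 1) ->
  is_infinite_cyclic z.
Proof.
move=> gen [b b1]; split=> [g|n zn]; first exact/cycP.
have [h [_ h2]] := res [:: 1; iB z].
have : h (iB z) = h 1.
  by rewrite hom1; apply: (torsion_free (fg_tree I) (n := n)); rewrite -!homX zn !hom1.
move/h2; rewrite !inE !eqxx ?orbT => /(_ isT isT); rewrite -(hom1 iB) => /(free_product_injr AB) z1.
by case/cycP: (gen b) b1 => m [] ->; rewrite z1 expg1n ?invg1.
Qed.

Lemma base_onto_case (z : B) : is_infinite_cyclic z -> (forall a, exists x, iotaA x = a) ->
  is_F_free_Z iota.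
Proof.
move=> zc sur; exists B, z, iB; split=> //.
by apply: free_product_eq AB _ sur iotaAE; exact: discriminating_iota_inj factor_residually.
Qed.

(** Here A = F * <t>, so the complement H of F is free on [t] and [z]. *)
Lemma free_case (t : A) (z : B) : is_infinite_cyclic z -> (forall g, sg (adjoin iotaA t) g) ->
  no_relation iotaA t -> is_F_free_limit2 iota.
Proof.
move=> zc genA nr; exists (free_group bool), (ev (iA t) (iB z)); split.
- move=> s; exists bool, (free_group bool), (fun i => gen (i, true)), (hid _).
  by split; [exact: gen_free_basis|move=> x y _ _].
- exact: bool_free_group_rank2.
move=> K f g; split.
  have [hA [hA1 hA2]] := no_relation_extend factor_residually f (g (gen (true, true))) genA nr.
  have [hB hB1] := infinite_cyclic_extend (g (gen (false, true))) zc.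
  have [[h [h1 h2]] _] := AB hA hB; exists h; split=> [x|w].
    by rewrite -iotaAE h1 hA1.
  apply: (@hom_ext _ _ (hcomp h (ev (iA t) (iB z))) g) => -[]; rewrite hcompE ?ev_a ?ev_b.
    by rewrite h1.
  by rewrite h2.
move=> h h' e1 e2 e1' e2'; have [_ U] := AB (hcomp h iA) (hcomp h iB).
apply: U => // [a|b].
  apply: (sg_eq_hom (f := hcomp h' iA) (f' := hcomp h iA) _ (genA a)) => x [[y ->]| ->].
    by rewrite !hcompE iotaAE e1 e1'.
  by have := e2 (gen (true, true)); have := e2' (gen (true, true)); rewrite ev_a !hcompE => -> ->.
apply: (sg_eq_hom (f := hcomp h' iB) (f' := hcomp h iB) _ (S := eq z)) =>
    [_ <-|]; last exact/cycP/zc.1.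
by have := e2 (gen (false, true)); have := e2' (gen (false, true)); rewrite ev_b !hcompE => -> ->.
Qed.

(** [A] itself is the amalgam, the abelian factor being mapped by [(x, y)] to [c^x r^y]. *)
Lemma centralizer_case (r : A) (c : F) (z : B) : is_infinite_cyclic z ->
  (forall g, sg (adjoin iotaA r) g) ->
  axis_extension iotaA r c -> is_F_centralizer_ext_free_Z iota.
Proof.
move=> zc gen ax; have [c1 Cc rc nr] := ax.
have tf n : c ^+ n.+1 <> 1 by move/(torsion_free (fg_tree I)).
have com x y : commute (hcomp iotaA (pw c) x) (pw r y).
  have h : commute (hcomp iotaA (pw c) x) r.
    rewrite hcompE; case/cycP: (pw_cyc c x) => n [] ->; rewrite ?homV homX; apply: commute_sym.
      exact: commuteX.
    exact/commuteV/commuteX.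
  by case/cycP: (pw_cyc r y) => n [] ->; [|apply: commuteV]; exact: commuteX.
pose v := mk_hom (pairM com).
exists c, Z, z0, (Z * Z)%type, ab_basis, (pw c), (pair_inl Z Z), A, iotaA, v, B, z, iA, iB.
have vr : v (ab_basis ord_max) = r.
  by rewrite -[LHS]/(hcomp iotaA (pw c) 1 * pw r z0) hom1 mul1g pw_gen.
have vc x : v (pair_inl Z Z x) = iotaA (pw c x).
  by rewrite -[LHS]/(hcomp iotaA (pw c) x * pw r 1) hom1 mulg1.
split; split=> //; [exact: Z_infinite_cyclic|exact: pw_gen|split=> //; exact: ab_basisP|].
split=> [||x|K f g fg]; [exact: pw_inj|by move=> x y []|by rewrite vc|].
have gab x : g x = f (pw c x.1) * pw (g (ab_basis ord_max)) x.2.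
  rewrite {1}(pairE x) gmulfM fg; congr (_ * _).
  apply: (@Z_hom_ext _ (hcomp g (pair_inr Z Z)) (pw (g (ab_basis ord_max)))).
  by rewrite hcompE pw_gen.
split.
  have kc : commute (g (ab_basis ord_max)) (f c).
    have -> : f c = g (pair_inl Z Z z0) by rewrite -fg pw_gen.
    by rewrite /commute -!gmulfM ab_basisP.1.
  have [h [h1 h2]] := axis_extend factor_residually gen ax kc.
  exists h; split=> // x; rewrite -[v x]/(hcomp iotaA (pw c) x.1 * pw r x.2).
  by rewrite gmulfM hcompE h1 pw_hom h2 -gab.
move=> h h' e1 e2 e1' e2' a.
apply: (sg_eq_hom _ (gen a)) => x [[y ->]| ->]; first by rewrite e1 e1'.
by rewrite -vr e2 e2'.
Qed.

Lemma onto_rank2_case : (forall a, exists x, iotaA x = a) -> has_rank B 2 ->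
  is_F_free_limit2 iota.
Proof.
move=> sur rk; exists B, iB; split=> //; first exact: second_factor_residually_free.
by apply: free_product_eq AB _ sur iotaAE; exact: discriminating_iota_inj factor_residually.
Qed.

End Assembly.

Lemma seq_preimage (A G : eqType) (f : A -> G) (s : seq G) :
  (forall g, g \in s -> exists a, f a = g) -> exists s', s = map f s'.
Proof.
elim: s => [|g s IH] h; first by exists [::].
have [|a ea] := h g; first by rewrite inE eqxx.
have [|s' ->] := IH; first by move=> x xs; apply: h; rewrite inE xs orbT.
by exists (a :: s'); rewrite /= ea.
Qed.

Theorem concrete_free_group_case (I : finType) (G : groupType)
    (iota : {multiplicative free_group I -> G}) (x y : G) :
  fully_residually iota -> (forall g, sg (labels (image iota) [:: x; y]) g) ->
  freely_decomposable_mod iota ->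
  [\/ is_F_free_Z iota, is_F_free_limit2 iota | is_F_centralizer_ext_free_Z iota].
Proof.
move=> res gen [A [B [iA [iB [AB hF nB]]]]].
have [j hj] := choice hF.
have jM : {morph j : a b / a * b}.
  by move=> a b; apply: (free_product_injl AB); rewrite gmulfM !hj gmulfM.
pose iotaA : {multiplicative free_group I -> A} := mk_hom jM.
have iotaAE f : iA (iotaA f) = iota f by exact: hj.
have [nf [N1 N2 N3]] := free_product_nf AB.
have [||||||sa [sb [sz Ha Hb gA gB]]] :=
  @grushko G (factor iA iB) nf (image iota) _ _ _ N1 N2 N3 _ _ [:: x; y] gen.
- by case; exists 1; rewrite hom1.
- by case=> g h [a <-] [b <-]; exists (a * b); rewrite gmulfM.
- by case=> g [a <-]; exists a^-1; rewrite homV.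
- by move=> g [f ->]; exists (iotaA f).
- exact: free_product_word AB.
- have [b b1] := nB; exists (iB b); first by exists b.
  by rewrite -(hom1 iB) => /(free_product_injr AB).
have [sa' ea] := seq_preimage Ha; have [sb' eb] := seq_preimage Hb.
have genA a : sg (labels (image iotaA) sa') a.
  have Sa : factor iA iB true (iA a) by exists a.
  suff L g : labels (image iota) sa g -> exists2 a', labels (image iotaA) sa' a' & iA a' = g.
    by have [a' sa'a' /(free_product_injl AB) <-] := sg_hom_ex L (gA _ Sa).
  case=> [[f ->]|]; first by exists (iotaA f) => //; left; exists f.
  by rewrite ea => /mapP[a' a'sa' ->]; exists a' => //; right.
have genB b : sg (fun c => c \in sb') b.
  have Sb : factor iA iB false (iB b) by exists b.
  suff L g : g \in sb -> exists2 b', b' \in sb' & iB b' = g.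
    by have [b' sb'b' /(free_product_injr AB) <-] := sg_hom_ex L (gB _ Sb).
  by rewrite eb => /mapP[b' b'sb' ->]; exists b'.
have {sz} sz : (size sa' + size sb' <= 2)%N by move: sz; rewrite ea eb !size_map.
have onto : size sa' = 0 -> forall a, exists f, iotaA f = a.
  move=> /size0nil s0 a; have [f ->] : image iotaA a; last by exists f.
  by apply: sg_image; apply: sg_sub (genA a) => b [h|]; [exact: sg_in|rewrite s0].
(* A noncyclic [B] uses both generators, which leaves none for [A]. *)
have [[z zB]|nc] := pselect (exists z, forall b : B, cyc z b); last first.
  apply: Or32; have szb : (1 < size sb')%N.
    case: sb' genB {eb sz} => [|b [|b' s]] genB //; exfalso; apply: nc.
      by exists 1 => b; apply: sg_sub (genB b).
    by exists b => b'; apply: sg_sub (genB b') => c; rewrite inE => /eqP->; exact: cyc_refl.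
  apply: (onto_rank2_case res AB iotaAE); first by apply: onto; lia.
  have sz2 : size sb' = 2 by lia.
  exact: rank2 sz2 genB nc.
have zc := second_factor_infinite_cyclic res AB zB nB.
have szb : (0 < size sb')%N.
  case: sb' genB {eb sz} => // genB; have [b b1] := nB; case: b1.
  by elim: (genB b) => // [c d _ -> _ ->|c _ ->]; rewrite ?mulg1 ?invg1.
have [t tA] : exists t, forall a, sg (adjoin iotaA t) a.
  (* The default 1 serves when [A] is already the image of F. *)
  exists (head 1 sa') => a; apply: sg_sub (genA a) => b [h|]; first by apply: sg_in; left.
  have sz1 : (size sa' <= 1)%N by lia.
  case: sa' sz1 {sz ea genA onto} => // a' [|a'' s] // _.
  by rewrite inE => /eqP->; apply: sg_in; right.
have [sur|nr|[r [c [rA ax]]]] := one_generator_cases (factor_residually res AB iotaAE) tA.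
- by apply: Or31; exact: (base_onto_case res AB iotaAE zc sur).
- by apply: Or32; exact: (free_case res AB iotaAE zc tA nr).
- by apply: Or33; exact: (centralizer_case res AB iotaAE zc rA ax).
Qed.

Theorem proposition2p4 (N : nat) (F G : groupType)
    (iota : {multiplicative F -> G}) :
  is_free_of_rank F N ->
  injective iota ->
  fully_residually iota ->
  quotient_of_two_generator_extension iota ->
  freely_decomposable_mod iota ->
  [\/ is_F_free_Z iota,
      is_F_free_limit2 iota
    | is_F_centralizer_ext_free_Z iota].
Proof.
move=> [b bF] _ res [L [P [bL [i [j [p [bLP FL pi sp]]]]]]] dec.
(* The hypotheses move to the concrete free group along [psi], and each of the three descriptions
   moves back along [phi]. *)
have [phi [psi [phiK psiK _]]] := free_basis_iso bF.
pose iota' := hcomp iota psi.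
have res' : fully_residually iota'.
  move=> s; have [h [h1 h2]] := res s; exists (hcomp phi h); split=> [x|x y xs ys e].
    by rewrite !hcompE h1 psiK.
  by apply: h2 => //; apply: (can_inj phiK).
have gen' g : sg (labels (image iota') [:: p (j (bL ord0)); p (j (bL ord_max))]) g.
  have [q <-] := sp g; have GQ q' : sg (image i) q' \/ sg (image j) q' ->
      sg (labels (image iota') [:: p (j (bL ord0)); p (j (bL ord_max))]) (p q').
    case=> /sg_image[x ->].
      by rewrite pi; apply: sg_in; left; exists (phi x); rewrite hcompE phiK.
    elim: (free_basis_sg bLP x) => {x} [_ [k ->]||x y _ h1 _ h2|x _ h].
    - apply: sg_in; right; have [->|nk] := eqVneq k ord0; first by rewrite !inE eqxx.
      have -> : k = ord_max by apply: val_inj; case: k nk => [[|[|]]].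
      by rewrite !inE eqxx orbT.
    - by rewrite !hom1; exact: sg1.
    - by rewrite !gmulfM; exact: sgM.
    - by rewrite !homV; exact: sgV.
  elim: (free_product_sg FL q) => {q} [q [h|h]||x y _ h1 _ h2|x _ h].
  - by apply: GQ; left; exact: sg_in.
  - by apply: GQ; right; exact: sg_in.
  - by rewrite hom1; exact: sg1.
  - by rewrite gmulfM; exact: sgM.
  - by rewrite homV; exact: sgV.
have dec' : freely_decomposable_mod iota'.
  have [A [B [iA [iB [AB h nB]]]]] := dec.
  by exists A, B, iA, iB; split=> // x; exact: h.
have FP (H : groupType) (k : {multiplicative H -> G}) :
    is_free_product iota' k -> is_free_product iota k.
  move=> h; apply: (free_product_eq h (j := phi)); first exact: can_inj phiK.
    by move=> x; exists (psi x); exact: psiK.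
  by move=> x; rewrite hcompE phiK.
case: (concrete_free_group_case res' gen' dec').
- by move=> [T [t [k [h1 /FP h2]]]]; apply: Or31; exists T, t, k.
- by move=> [H [k [h1 h2 /FP h3]]]; apply: Or32; exists H, k.
move=> [al [C [z [B [bB [cF [cB [M [u [v [S [s [k [l [[zc za bab am] [sc fp ku]]]]]]]]]]]]]]]].
apply: Or33; exists (psi al), C, z, B, bB, (hcomp psi cF), cB, M, (hcomp u phi), v, S, s, k, l.
split; split=> //.
- by rewrite hcompE za.
- have [a1 a2 a3 a4] := am; split=> [|//|c|K f g fg].
  + by move=> c c'; rewrite !hcompE => /(can_inj psiK)/a1.
  + by rewrite !hcompE psiK a3.
  have [c|[h [h1 h2]] U] := a4 K (hcomp f psi) g; first by rewrite hcompE -fg.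
  split; first by exists h; split=> // x; rewrite hcompE h1 hcompE phiK.
  move=> h' h'' e1 e2 e3 e4; apply: U => // x.
    by rewrite hcompE -e1 hcompE psiK.
  by rewrite hcompE -e3 hcompE psiK.
- by move=> x; rewrite hcompE ku hcompE phiK.
Qed.
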